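(* Let $\pi_\eta$ be the fundamental group of an orientable, closed Seifert manifold with orientable base of genus $g$ and Euler number $e(\eta)$. The Chen ranks $\theta_k$ and the holonomy Chen ranks $\bar\theta_k$ of $\pi_\eta$ are computed as follows. \begin{enumerate} \item If $e(\eta)=0$, then $\theta_1(\pi_\eta)=\bar\theta_1(\pi_\eta)=2g+1$, and $\theta_k(\pi_\eta)=\bar\theta_k(\pi_\eta)=\theta_k(\Pi_g)$ for $k\ge2$. \item If $e(\eta)\neq0$, then $\bar\theta_k(\pi_\eta)=\theta_k(F_{2g})$ for $k\ge1$. \item If $e(\eta)\ne0$, then $\theta_1(\pi_\eta)=2g$, $\theta_2(\pi_\eta)=g(2g-1)$, and $\theta_k(\pi_\eta)=\theta_k(\Pi_g)$ for $k\ge3$. \end{enumerate} Here the Chen ranks of $F_{2g}$ and $\Pi_g$ are given by $\theta_k(F_{2g})=(k-1)\binom{2g+k-2}{k}$ for $k\ge2$, and by $\theta_1(\Pi_g)=2g$, $\theta_2(\Pi_g)=2g^2-g-1$, and $\theta_k(\Pi_g)=(k-1)\binom{2g+k-2}{k}-\binom{2g+k-3}{k-2}$ for $k\ge3$.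
   Context: The Seifert manifold $M$ has Seifert bundle $\eta\colon M\to\Sigma_g$, where $\Sigma_g$ is the closed orientable surface of genus $g$, and its fundamental group is \[ \pi_\eta=\langle x_1,y_1,\dots,x_g,y_g,z_1,\dots,z_s,h\mid h\text{ central},\ [x_1,y_1]\cdots[x_g,y_g]z_1\cdots z_s=h^b,\ z_i^{\alpha_i}h^{\beta_i}=1\ (i=1,\dots,s)\rangle, \] with $b=b(\eta)$ an integer and $(\alpha_i,\beta_i)$ pairs of coprime integers, $\alpha_i\ge2$; the Euler number is $e(\eta)=-b(\eta)-\sum_{i=1}^s\beta_i/\alpha_i$. $\Pi_g=\pi_1(\Sigma_g)$, and $F_{2g}$ is the free group of rank $2g$. For a finitely generated group $G$: $\operatorname{gr}_k(G)=(\Gamma_kG/\Gamma_{k+1}G)\otimes\mathbb{Q}$ with $\Gamma_1G=G$, $\Gamma_{k+1}G=[\Gamma_kG,G]$; $G''=[[G,G],[G,G]]$; the Chen ranks are $\theta_k(G)=\dim_{\mathbb{Q}}\operatorname{gr}_k(G/G'')$; the holonomy Chen ranks are $\bar\theta_k(G)=\dim_{\mathbb{Q}}(\mathfrak{h}/\mathfrak{h}'')_k$, where $\mathfrak{h}''=[[\mathfrak{h},\mathfrak{h}],[\mathfrak{h},\mathfrak{h}]]$ and $\mathfrak{h}=\mathfrak{h}(G)=\mathfrak{lie}(H_1(G;\mathbb{Q}))/\langle\operatorname{im}\mu_G^\vee\rangle$ is the holonomy Lie algebra. Here $\mathfrak{lie}(V)$ is the free $\mathbb{Q}$-Lie algebra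 on $V$ (in degree $1$), $\langle\cdot\rangle$ denotes the Lie ideal generated, and $\mu_G^\vee\colon H_2(G;\mathbb{Q})\to\bigwedge^2H_1(G;\mathbb{Q})\cong\mathfrak{lie}_2(H_1(G;\mathbb{Q}))$ (with $v\wedge w\leftrightarrow[v,w]$) is the dual of the cup-product map $\mu_G\colon H^1(G;\mathbb{Q})\wedge H^1(G;\mathbb{Q})\to H^2(G;\mathbb{Q})$.
   Formalization: The formula θ_2(Π_g)=2g²−g−1 is stated only for g≥1, since at g=0 it would give −1 while Π_0 is trivial and θ_2(Π_0)=0; every other claim is stated for all g≥0. *)

(* Defs.v *)
From HB Require Import structures.
From mathcomp Require Import all_boot all_order all_algebra finmap.
From mathcomp Require Import boolp classical_sets functions.
From mathcomp Require Import monalg ring.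

Set Implicit Arguments.
Unset Strict Implicit.
Unset Printing Implicit Defensive.

Import GRing.Theory.
Local Open Scope classical_set_scope.
Local Open Scope quotient_scope.
Local Open Scope ring_scope.

Section Subgroups.
Local Open Scope group_scope.
Variable G : groupType.

(* the subgroup generated by S *)
Inductive gen (S : set G) : set G :=
| gen_in x : S x -> gen S x
| gen_1 : gen S 1
| gen_M x y : gen S x -> gen S y -> gen S (x * y)
| gen_V x : gen S x -> gen S x^-1.

(* the normal closure of S *)
Definition nclosure (S : set G) : set G :=
  gen [set z | exists x y, S x /\ z = x ^ y].

Definition commutator (A B : set G) : set G :=
  gen [set z | exists a b, [/\ A a, B b & z = [~ a, b]]].

Fixpoint lower_central_rec (n : nat) : set G :=
  if n is n'.+1 then commutator (lower_central_rec n') setT else setT.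

(* Gamma_k, numbered from Gamma_1 = G; the value at k = 0 is a dummy *)
Definition lower_central (k : nat) : set G := lower_central_rec k.-1.

Definition derived2 : set G :=
  commutator (commutator setT setT) (commutator setT setT).

Lemma nclosureJ (S : set G) x y : nclosure S x -> nclosure S (x ^ y).
Proof.
elim=> [_ [a [b [Sa ->]]]||u v _ IHu _ IHv|u _ IHu].
- by apply: gen_in; exists a, (b * y); split=> //; rewrite conjgM.
- by rewrite conj1g; apply: gen_1.
- by rewrite conjMg; apply: gen_M.
- by rewrite conjVg; apply: gen_V.
Qed.

End Subgroups.

(* the group structure on the subgroup generated by S *)
Definition subgrp (G : groupType) (S : set G) := {x : G | `[< gen S x >]}.

Section SubgrpGroup.
Local Open Scope group_scope.
Variables (G : groupType) (S : set G).

HB.instance Definition _ := SubChoice.on (subgrp S).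

Fact subgrp_closed : group_closed (fun x : G => `[< gen S x >]).
Proof.
split=> [|x y]; first exact/asboolP/gen_1.
move=> /asboolP Sx /asboolP Sy; apply/asboolP.
by apply: gen_M => //; apply: gen_V.
Qed.

HB.instance Definition _ :=
  SubChoice_isSubGroup.Build G (fun x : G => `[< gen S x >]) (subgrp S)
    subgrp_closed.

End SubgrpGroup.

Section QuotientGroup.
Local Open Scope group_scope.
Variables (G : groupType) (S : set G).

Definition qgrp_rel : rel G := fun x y => `[< nclosure S (x^-1 * y) >].

Fact qgrp_rel_equiv : equiv_class_of qgrp_rel.
Proof.
split=> [x|x y|y x z].
- by apply/asboolP; rewrite mulVg; apply: gen_1.
- by apply/asboolP/asboolP => /gen_V; rewrite invgM invgK.
- move=> /asboolP xy /asboolP yz; apply/asboolP.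
  by have := gen_M xy yz; rewrite -mulgA mulVKg.
Qed.
Canonical qgrp_equiv := EquivRelPack qgrp_rel_equiv.

(* the quotient of G by the normal closure of S *)
Definition qgrp := {eq_quot qgrp_equiv}.
HB.instance Definition _ := Choice.on qgrp.
HB.instance Definition _ := EqQuotient.on qgrp.

Definition qpi (x : G) : qgrp := \pi_qgrp x.

Lemma qpiK : cancel (repr : qgrp -> G) qpi.
Proof. exact: reprK. Qed.

Lemma qgrpP x y :
  qpi x = qpi y <-> nclosure S (x^-1 * y).
Proof.
split=> [/eqP|H]; first by rewrite eqquotE => /asboolP.
by apply/eqP; rewrite eqquotE; apply/asboolP.
Qed.

Definition qgrp_one : qgrp := qpi 1.
Definition qgrp_inv (a : qgrp) : qgrp := qpi ((repr a)^-1).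
Definition qgrp_mul (a b : qgrp) : qgrp := qpi (repr a * repr b).

Lemma nclosure_repr x : nclosure S ((repr (qpi x))^-1 * x).
Proof. by apply/qgrpP; rewrite qpiK. Qed.

Lemma pi_qgrp_inv x : qgrp_inv (qpi x) = qpi x^-1.
Proof.
apply/qgrpP; rewrite invgK.
have := nclosureJ x^-1 (gen_V (nclosure_repr x)).
by rewrite invgM invgK /conjg invgK -mulgA mulVKg.
Qed.

Lemma pi_qgrp_mul x y : qgrp_mul (qpi x) (qpi y) = qpi (x * y).
Proof.
apply/qgrpP; rewrite invgM.
have := gen_M (nclosure_repr y) (nclosureJ y (nclosure_repr x)).
by rewrite /conjg !mulgA mulgK.
Qed.

Fact qgrp_mulA : associative qgrp_mul.
Proof.
by move=> a b c; rewrite -[a]qpiK -[b]qpiK -[c]qpiK !pi_qgrp_mul mulgA.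
Qed.
Fact qgrp_mul1 : left_id qgrp_one qgrp_mul.
Proof. by move=> a; rewrite -[a]qpiK pi_qgrp_mul mul1g. Qed.
Fact qgrp_mulr1 : right_id qgrp_one qgrp_mul.
Proof. by move=> a; rewrite -[a]qpiK pi_qgrp_mul mulg1. Qed.
Fact qgrp_mulV : left_inverse qgrp_one qgrp_inv qgrp_mul.
Proof. by move=> a; rewrite -[a]qpiK pi_qgrp_inv pi_qgrp_mul mulVg. Qed.
Fact qgrp_mulrV : right_inverse qgrp_one qgrp_inv qgrp_mul.
Proof. by move=> a; rewrite -[a]qpiK pi_qgrp_inv pi_qgrp_mul mulgV. Qed.

HB.instance Definition _ := isGroup.Build qgrp
  qgrp_mulA qgrp_mul1 qgrp_mulr1 qgrp_mulV qgrp_mulrV.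

End QuotientGroup.

(* A word is a sequence of letters (x, e), where (x, false) stands for x and  *)
(* (x, true) for x^-1.                                                        *)
Section FreeGroup.
Variable X : choiceType.

Inductive word_eq : seq (X * bool) -> seq (X * bool) -> Prop :=
| word_refl u : word_eq u u
| word_sym u v : word_eq u v -> word_eq v u
| word_trans u v w : word_eq u v -> word_eq v w -> word_eq u w
| word_cancel u v x e : word_eq (u ++ (x, e) :: (x, ~~ e) :: v) (u ++ v).

Definition fgrp_rel : rel (seq (X * bool)) := fun u v => `[< word_eq u v >].

Fact fgrp_rel_equiv : equiv_class_of fgrp_rel.
Proof.
split=> [u|u v|v u w].
- exact/asboolP/word_refl.
- by apply/asboolP/asboolP => /word_sym.
- by move=> /asboolP uv /asboolP vw; apply/asboolP/(word_trans uv).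
Qed.
Canonical fgrp_equiv := EquivRelPack fgrp_rel_equiv.

Definition fgrp := {eq_quot fgrp_equiv}.
HB.instance Definition _ := Choice.on fgrp.
HB.instance Definition _ := EqQuotient.on fgrp.

Definition fpi (x : seq (X * bool)) : fgrp := \pi_fgrp x.

Lemma fpiK : cancel (repr : fgrp -> seq (X * bool)) fpi.
Proof. exact: reprK. Qed.

Lemma fgrpP u v : fpi u = fpi v <-> word_eq u v.
Proof.
split=> [/eqP|H]; first by rewrite eqquotE => /asboolP.
by apply/eqP; rewrite eqquotE; apply/asboolP.
Qed.

Definition word_inv (u : seq (X * bool)) := rev [seq (p.1, ~~ p.2) | p <- u].

Lemma word_cat u u' v v' :
  word_eq u u' -> word_eq v v' -> word_eq (u ++ v) (u' ++ v').
Proof.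
move=> uu' vv'; apply: (@word_trans _ (u' ++ v)).
  elim: uu' => [*|*|*|w1 w2 x e].
  - exact: word_refl.
  - exact: word_sym.
  - by apply: word_trans; eassumption.
  - by rewrite -!catA; apply: word_cancel.
elim: vv' => [*|*|*|w1 w2 x e].
- exact: word_refl.
- exact: word_sym.
- by apply: word_trans; eassumption.
- by rewrite !catA; apply: word_cancel.
Qed.

Lemma word_inv_eq u v : word_eq u v -> word_eq (word_inv u) (word_inv v).
Proof.
elim=> [*|*|*|w1 w2 x e].
- exact: word_refl.
- exact: word_sym.
- by apply: word_trans; eassumption.
- rewrite /word_inv !map_cat !rev_cat /= !rev_cons -!cats1 -!catA /=.
  by rewrite negbK; have := word_cancel (word_inv w2) (word_inv w1) x e.
Qed.

Lemma word_mulV u : word_eq (word_inv u ++ u) [::].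
Proof.
elim: u => [|[x e] u IHu]; first exact: word_refl.
rewrite /word_inv /= rev_cons -cats1 -catA /=.
have := word_cancel (word_inv u) u x (~~ e); rewrite negbK => H.
exact: word_trans H IHu.
Qed.

Lemma word_invK u : word_inv (word_inv u) = u.
Proof.
rewrite /word_inv map_rev revK -map_comp -[RHS]map_id.
by apply: eq_map => -[x e] /=; rewrite negbK.
Qed.

Definition fgrp_one : fgrp := fpi [::].
Definition fgrp_inv (a : fgrp) : fgrp := fpi (word_inv (repr a)).
Definition fgrp_mul (a b : fgrp) : fgrp := fpi (repr a ++ repr b).

Lemma word_repr u : word_eq (repr (fpi u)) u.
Proof. by apply/fgrpP; rewrite fpiK. Qed.

Lemma pi_fgrp_inv u : fgrp_inv (fpi u) = fpi (word_inv u).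
Proof. exact/fgrpP/word_inv_eq/word_repr. Qed.

Lemma pi_fgrp_mul u v : fgrp_mul (fpi u) (fpi v) = fpi (u ++ v).
Proof. by apply/fgrpP/word_cat; apply: word_repr. Qed.

Fact fgrp_mulA : associative fgrp_mul.
Proof.
by move=> a b c; rewrite -[a]fpiK -[b]fpiK -[c]fpiK !pi_fgrp_mul catA.
Qed.
Fact fgrp_mul1 : left_id fgrp_one fgrp_mul.
Proof. by move=> a; rewrite -[a]fpiK pi_fgrp_mul. Qed.
Fact fgrp_mulr1 : right_id fgrp_one fgrp_mul.
Proof. by move=> a; rewrite -[a]fpiK pi_fgrp_mul cats0. Qed.
Fact fgrp_mulV : left_inverse fgrp_one fgrp_inv fgrp_mul.
Proof.
move=> a; rewrite -[a]fpiK pi_fgrp_inv pi_fgrp_mul.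
exact/fgrpP/word_mulV.
Qed.
Fact fgrp_mulrV : right_inverse fgrp_one fgrp_inv fgrp_mul.
Proof.
move=> a; rewrite -[a]fpiK pi_fgrp_inv pi_fgrp_mul.
by apply/fgrpP; have := word_mulV (word_inv (repr a)); rewrite word_invK.
Qed.

HB.instance Definition _ := isGroup.Build fgrp
  fgrp_mulA fgrp_mul1 fgrp_mulr1 fgrp_mulV fgrp_mulrV.

Definition fgen (x : X) : fgrp := fpi ([:: (x, false)]).

End FreeGroup.

Definition expgz (G : groupType) (x : G) (n : int) : G :=
  match n with Posz m => (x ^+ m)%g | Negz m => (x ^- m.+1)%g end.

Definition free_group (n : nat) : groupType := fgrp 'I_n.

(* The library's commutator is [~ x, y] = x^-1 y^-1 x y, whereas topologists  *)
(* often use [x, y] = x y x^-1 y^-1; replacing x_i, y_i by their inverses     *)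
(* exchanges the two presentations.                                           *)
Section SurfaceGroup.
Local Open Scope group_scope.
Variable g : nat.

Definition surface_gen : choiceType := ('I_g + 'I_g)%type.
Definition surface_x (i : 'I_g) : fgrp surface_gen := fgen (inl i : surface_gen).
Definition surface_y (i : 'I_g) : fgrp surface_gen := fgen (inr i : surface_gen).

Definition surface_rels : set (fgrp surface_gen) :=
  [set \prod_(i < g) [~ surface_x i, surface_y i]].

Definition surface_group : groupType := qgrp surface_rels.

End SurfaceGroup.

Section SeifertGroup.
Local Open Scope group_scope.
Variables (g s : nat) (b : int) (alpha beta : 'I_s -> int).

Definition seifert_gen : choiceType := ('I_g + 'I_g + 'I_s + unit)%type.
Definition seifert_x (i : 'I_g) : fgrp seifert_gen :=
  fgen (inl (inl (inl i)) : seifert_gen).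
Definition seifert_y (i : 'I_g) : fgrp seifert_gen :=
  fgen (inl (inl (inr i)) : seifert_gen).
Definition seifert_z (i : 'I_s) : fgrp seifert_gen :=
  fgen (inl (inr i) : seifert_gen).
Definition seifert_h : fgrp seifert_gen := fgen (inr tt : seifert_gen).

Definition seifert_rels : set (fgrp seifert_gen) :=
  [set r | [\/ exists t : seifert_gen, r = [~ seifert_h, fgen t],
               r = \prod_(i < g) [~ seifert_x i, seifert_y i] *
                   \prod_(i < s) seifert_z i / expgz seifert_h b |
               exists i : 'I_s,
                 r = expgz (seifert_z i) (alpha i) * expgz seifert_h (beta i)]].

Definition seifert_group : groupType := qgrp seifert_rels.

Definition euler_number : rat :=
  (- b%:~R - \sum_(i < s) (beta i)%:~R / (alpha i)%:~R)%R.

End SeifertGroup.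

Section Subspaces.
Variable V : lmodType rat.

Inductive lspan (S : set V) : set V :=
| span_in v : S v -> lspan S v
| span_0 : lspan S 0
| span_D u v : lspan S u -> lspan S v -> lspan S (u + v)
| span_Z c v : lspan S v -> lspan S (c *: v).

Lemma span_N (S : set V) v : lspan S v -> lspan S (- v).
Proof. by rewrite -scaleN1r; apply: span_Z. Qed.

Lemma span_B (S : set V) u v : lspan S u -> lspan S v -> lspan S (u - v).
Proof. by move=> Su Sv; apply: span_D => //; apply: span_N. Qed.

End Subspaces.

(* the vector space structure on the span of S *)
Definition lsub (V : lmodType rat) (S : set V) := {v : V | `[< lspan S v >]}.

Section LsubLmod.
Variables (V : lmodType rat) (S : set V).

HB.instance Definition _ := SubChoice.on (lsub S).

Fact lsub_closed : subsemimod_closed (fun v : V => `[< lspan S v >]).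
Proof.
split; first split=> [|u v].
- exact/asboolP/span_0.
- by move=> /asboolP Su /asboolP Sv; apply/asboolP/span_D.
- by move=> c v /asboolP Sv; apply/asboolP/span_Z.
Qed.

HB.instance Definition _ :=
  GRing.SubChoice_isSubLmodule.Build rat V (fun v : V => `[< lspan S v >])
    (lsub S) lsub_closed.

End LsubLmod.

Section QuotientSpace.
Variables (V : lmodType rat) (S : set V).

Definition lquot_rel : rel V := fun u v => `[< lspan S (u - v) >].

Fact lquot_rel_equiv : equiv_class_of lquot_rel.
Proof.
split=> [u|u v|v u w].
- by apply/asboolP; rewrite subrr; apply: span_0.
- by apply/asboolP/asboolP => /span_N; rewrite opprB.
- move=> /asboolP uv /asboolP vw; apply/asboolP.
  by have := span_D uv vw; rewrite addrA subrK.
Qed.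
Canonical lquot_equiv := EquivRelPack lquot_rel_equiv.

(* the quotient of V by the span of S *)
Definition lquot := {eq_quot lquot_equiv}.
HB.instance Definition _ := Choice.on lquot.
HB.instance Definition _ := EqQuotient.on lquot.

Definition lpi (x : V) : lquot := \pi_lquot x.

Lemma lpiK : cancel (repr : lquot -> V) lpi.
Proof. exact: reprK. Qed.

Lemma lquotP u v : lpi u = lpi v <-> lspan S (u - v).
Proof.
split=> [/eqP|H]; first by rewrite eqquotE => /asboolP.
by apply/eqP; rewrite eqquotE; apply/asboolP.
Qed.

Definition lquot_zero : lquot := lpi 0.
Definition lquot_opp (a : lquot) : lquot := lpi (- repr a).
Definition lquot_add (a b : lquot) : lquot := lpi (repr a + repr b).
Definition lquot_scale (c : rat) (a : lquot) : lquot := lpi (c *: repr a).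

Lemma span_repr u : lspan S (repr (lpi u) - u).
Proof. by apply/lquotP; rewrite lpiK. Qed.

Lemma pi_lquot_opp u : lquot_opp (lpi u) = lpi (- u).
Proof. by apply/lquotP; rewrite -opprD; apply/span_N/span_repr. Qed.

Lemma pi_lquot_add u v : lquot_add (lpi u) (lpi v) = lpi (u + v).
Proof. by apply/lquotP; rewrite opprD addrACA; apply: span_D; apply: span_repr. Qed.

Lemma pi_lquot_scale c u : lquot_scale c (lpi u) = lpi (c *: u).
Proof. by apply/lquotP; rewrite -scalerBr; apply/span_Z/span_repr. Qed.

Fact lquot_addA : associative lquot_add.
Proof.
by move=> a b c; rewrite -[a]lpiK -[b]lpiK -[c]lpiK !pi_lquot_add addrA.
Qed.
Fact lquot_addC : commutative lquot_add.
Proof. by move=> a b; rewrite -[a]lpiK -[b]lpiK !pi_lquot_add addrC. Qed.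
Fact lquot_add0 : left_id lquot_zero lquot_add.
Proof. by move=> a; rewrite -[a]lpiK pi_lquot_add add0r. Qed.
Fact lquot_addN : left_inverse lquot_zero lquot_opp lquot_add.
Proof. by move=> a; rewrite -[a]lpiK pi_lquot_opp pi_lquot_add addNr. Qed.

HB.instance Definition _ := GRing.isZmodule.Build lquot
  lquot_addA lquot_addC lquot_add0 lquot_addN.

Fact lquot_scaleA c d a : lquot_scale c (lquot_scale d a) = lquot_scale (c * d) a.
Proof. by rewrite -[a]lpiK !pi_lquot_scale scalerA. Qed.
Fact lquot_scale1 : left_id 1 lquot_scale.
Proof. by move=> a; rewrite -[a]lpiK pi_lquot_scale scale1r. Qed.
Lemma lpiD u v : lpi u + lpi v = lpi (u + v).
Proof. exact: pi_lquot_add. Qed.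
Fact lquot_scaleDr : right_distributive lquot_scale +%R.
Proof.
move=> c a b; rewrite -[a]lpiK -[b]lpiK lpiD.
by rewrite !pi_lquot_scale lpiD scalerDr.
Qed.
Fact lquot_scaleDl a : {morph lquot_scale^~ a : c d / c + d}.
Proof. by move=> c d; rewrite -[a]lpiK !pi_lquot_scale lpiD scalerDl. Qed.

HB.instance Definition _ := GRing.Zmodule_isLmodule.Build rat lquot
  lquot_scaleA lquot_scale1 lquot_scaleDr lquot_scaleDl.

Fact lpi_is_linear : linear lpi.
Proof. by move=> c u v; rewrite -lpiD -pi_lquot_scale. Qed.

HB.instance Definition _ := GRing.isLinear.Build rat V lquot *:%R lpi lpi_is_linear.

End QuotientSpace.

Arguments lquot {V} S.
Arguments lpi {V} S x.

Section Dimension.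
Variable V : lmodType rat.

Definition is_basis (n : nat) (e : 'I_n -> V) : Prop :=
  forall v : V, exists! c : 'rV[rat]_n, v = \sum_(i < n) c 0 i *: e i.

Definition has_dim (n : nat) : Prop := exists e : 'I_n -> V, is_basis e.

(* None stands for infinite dimension *)
Definition dimQ : option nat :=
  if pselect (exists n, has_dim n) is left ex then Some (sval (cid ex)) else None.

Lemma has_dim_le n m : has_dim n -> has_dim m -> (n <= m)%N.
Proof.
move=> [e eb] [f fb].
have /choice [a ae] i : exists c : 'rV[rat]_m, e i = \sum_j c 0 j *: f j.
  by have [c [ce _]] := fb (e i); exists c.
have /choice [a' af] j : exists c : 'rV[rat]_n, f j = \sum_i c 0 i *: e i.
  by have [c [cf _]] := eb (f j); exists c.
pose A := \matrix_(i, j) a i 0 j; pose B := \matrix_(j, i) a' j 0 i.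
apply: (@mulmx1_min _ n m A B); apply/row_matrixP => i.
have [c [_ cU]] := eb (e i).
rewrite -(cU (row i 1%:M)); last first.
  rewrite (bigD1 i) //= !mxE eqxx scale1r big1 ?addr0 // => k /negbTE ki.
  by rewrite !mxE eq_sym ki scale0r.
symmetry; apply: cU; rewrite {1}ae.
under eq_bigr => j _ do rewrite af scaler_sumr.
rewrite exchange_big /=; apply: eq_bigr => k _; rewrite !mxE scaler_suml.
by apply: eq_bigr => j _; rewrite !mxE scalerA.
Qed.

Lemma dimQE n : has_dim n -> dimQ = Some n.
Proof.
move=> Vn; rewrite /dimQ; case: pselect => [ex|[]]; last by exists n.
case: (cid ex) => m /= Vm; congr Some.
by apply/eqP; rewrite eqn_leq !has_dim_le.
Qed.

End Dimension.

(* the linear extension of f : X -> V to the vector space with basis X *)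
Definition linext (X : choiceType) (V : lmodType rat) (f : X -> V)
    (c : {malg rat[X]}) : V :=
  \sum_(x <- msupp c) c@_x *: f x.

Section LinearExtension.
Variables (X : choiceType) (V : lmodType rat) (f : X -> V).
Local Open Scope fset_scope.

Lemma linextEw (d : {fset X}) (c : {malg rat[X]}) :
  msupp c `<=` d -> linext f c = \sum_(x <- d) c@_x *: f x.
Proof.
move=> le; rewrite /linext (big_fset_incl _ le) //= => x xd /mcoeff_outdom ->.
by rewrite scale0r.
Qed.

Lemma linextU x : linext f << x >> = f x.
Proof. by rewrite (linextEw msuppU_le) big_seq_fset1 mcoeffUU scale1r. Qed.

Fact linext_is_linear : linear (linext f).
Proof.
move=> k c c'; pose d := msupp (k *: c + c') `|` (msupp c `|` msupp c').
have s1 : msupp (k *: c + c') `<=` d by rewrite fsubsetUl.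
have s2 : msupp c `<=` d by rewrite fsubsetU // fsubsetUl orbT.
have s3 : msupp c' `<=` d by rewrite fsubsetU // fsubsetUr orbT.
rewrite (linextEw s1) (linextEw s2) (linextEw s3).
rewrite scaler_sumr -big_split /=; apply: eq_bigr => x _.
by rewrite mcoeffD mcoeffZ scalerDl scalerA.
Qed.

HB.instance Definition _ :=
  GRing.isLinear.Build rat {malg rat[X]} V *:%R (linext f) linext_is_linear.

End LinearExtension.

(* the map on V / span S induced by f, provided f is linear and vanishes on S *)
Definition lquot_lift (V W : lmodType rat) (S : set V) (f : V -> W)
  (a : lquot S) : W := f (repr a).

Section LquotLift.
Variables (V W : lmodType rat) (S : set V) (f : {linear V -> W}).
Hypothesis fS : forall v, S v -> f v = 0.

Lemma lquot_liftE v : lquot_lift f (lpi S v) = f v.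
Proof.
apply/eqP; rewrite -subr_eq0 -linearB; apply/eqP.
elim: (span_repr S v) => [u /fS //||u w _ fu _ fw|c u _ fu].
- exact: linear0.
- by rewrite linearD fu fw addr0.
- by rewrite linearZ /= fu scaler0.
Qed.

Lemma lquot_lift_linear : linear (@lquot_lift V W S f).
Proof.
move=> c a b; rewrite -[a]lpiK -[b]lpiK -linearP.
by rewrite !lquot_liftE linearP.
Qed.

End LquotLift.

(* A tensor Q for an abelian group A written multiplicatively: the Q-vector   *)
(* space on the symbols << x >>, standing for x tensor 1, modulo additivity   *)
Section TensorQ.
Variable A : groupType.

Definition tensorQ_rels : set {malg rat[A]} :=
  [set r | exists x y : A, r = << (x * y)%g >> - << x >> - << y >>].

Definition tensorQ : lmodType rat := lquot tensorQ_rels.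

End TensorQ.

Section Wedge.
Variable V : lmodType rat.

Definition wedge_rels : set {malg rat[(V * V)%type]} :=
  [set r | [\/ exists c u v w,
                 r = << (c *: u + v, w) >> - c *: << (u, w) >> - << (v, w) >>,
               exists c u v w,
                 r = << (w, c *: u + v) >> - c *: << (w, u) >> - << (w, v) >> |
               exists u, r = << (u, u) >>]].

Definition wedge2 : lmodType rat := lquot wedge_rels.

Definition wedge (u v : V) : wedge2 := lpi wedge_rels << (u, v) >>.

(* the map on the exterior square induced by an alternating bilinear map *)
Definition wedge_lift (W : lmodType rat) (B : V -> V -> W) : wedge2 -> W :=
  lquot_lift (linext (fun p : (V * V)%type => B p.1 p.2)).

Section Lift.
Variables (W : lmodType rat) (B : V -> V -> W).
Hypothesis Bl : forall w, linear (B^~ w).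
Hypothesis Br : forall w, linear (B w).
Hypothesis Balt : forall u, B u u = 0.

Fact wedge_lift_rels r :
  wedge_rels r -> linext (fun p : (V * V)%type => B p.1 p.2) r = 0.
Proof.
case=> [[c [u [v [w ->]]]]|[c [u [v [w ->]]]]|[u ->]].
- by rewrite !linearB linearZ /= !linextU /= Bl addrAC addrK subrr.
- by rewrite !linearB linearZ /= !linextU /= Br addrAC addrK subrr.
- by rewrite linextU /=.
Qed.

Lemma wedge_liftE u v : wedge_lift B (wedge u v) = B u v.
Proof. by rewrite /wedge_lift (lquot_liftE wedge_lift_rels) /= linextU. Qed.

Lemma wedge_lift_linear : linear (wedge_lift B).
Proof. exact: (lquot_lift_linear wedge_lift_rels). Qed.

End Lift.
End Wedge.

(* Homology and cohomology of G with trivial rational coefficients, in low    *)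
(* degrees, from the inhomogeneous bar complex                                *)

Section BarComplex.
Variable G : groupType.

Definition bar1 := {malg rat[G]}.
Definition bar2 := {malg rat[(G * G)%type]}.
Definition bar3 := {malg rat[(G * G * G)%type]}.

(* the differential bar1 -> bar0 vanishes *)
Definition bar_d2 : bar2 -> bar1 :=
  linext (fun p : (G * G)%type =>
    << p.2 >> - << (p.1 * p.2)%g >> + << p.1 >> : {malg rat[G]}).
Definition bar_d3 : bar3 -> bar2 :=
  linext (fun p : (G * G * G)%type =>
    << (p.1.2, p.2) >> - << ((p.1.1 * p.1.2)%g, p.2) >>
    + << (p.1.1, (p.1.2 * p.2)%g) >> - << p.1 >> : {malg rat[(G * G)%type]}).

Definition H_1 : lmodType rat := lquot (range bar_d2).

Definition cycles2 : lmodType rat := lsub [set c | bar_d2 c = 0].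
Definition H_2 : lmodType rat :=
  lquot [set z : cycles2 | exists c, val z = bar_d3 c].

Definition cobar1 : lmodType rat := G -> rat^o.
Definition cobar2 : lmodType rat := (G * G)%type -> rat^o.
Definition cobar3 : lmodType rat := (G * G * G)%type -> rat^o.

(* the differential cobar0 -> cobar1 vanishes *)
Definition cobar_d1 (f : cobar1) : cobar2 :=
  fun p => f p.2 - f (p.1 * p.2)%g + f p.1.
Definition cobar_d2 (f : cobar2) : cobar3 :=
  fun p => f (p.1.2, p.2) - f ((p.1.1 * p.1.2)%g, p.2)
           + f (p.1.1, (p.1.2 * p.2)%g) - f p.1.

Definition coH1 : lmodType rat := lsub [set f | cobar_d1 f = 0].

Definition cocycles2 : lmodType rat := lsub [set f | cobar_d2 f = 0].
Definition coH2 : lmodType rat :=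
  lquot [set z : cocycles2 | exists f, val z = cobar_d1 f].

End BarComplex.

Lemma span_ker (V W : lmodType rat) (f : V -> W) v :
  linear f -> lspan [set v | f v = 0] v -> f v = 0.
Proof.
move=> fL; pose F := GRing.isLinear.Build rat V W *:%R f fL.
pose f' : {linear V -> W} := HB.pack f F.
elim=> [//||u w _ fu _ fw|c u _ fu].
- exact: (linear0 f').
- by apply: etrans (linearD f' u w) _; rewrite /= fu fw addr0.
- by apply: etrans (linearZ_LR f' c u) _; rewrite /= fu scaler0.
Qed.

Section CupProduct.
Variable G : groupType.

Fact cobar_d1_linear : linear (@cobar_d1 G).
Proof.
move=> c f u; apply/funext => p; rewrite /cobar_d1.
have E (x x' y y' z z' : rat) : (c * x + x') - (c * y + y') + (c * z + z') =
  c * (x - y + z) + (x' - y' + z') by ring.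
exact: E.
Qed.

Lemma coH1M (f : coH1 G) x y :
  (val f : G -> rat) (x * y)%g = (val f : G -> rat) x + (val f : G -> rat) y.
Proof.
have /asboolP /(span_ker cobar_d1_linear) := valP f.
move=> /(congr1 (@^~ (x, y))); rewrite /cobar_d1 /= => /eqP.
by rewrite addrAC subr_eq0 addrC eq_sym => /eqP.
Qed.

Definition cup_cochain (f u : coH1 G) : cobar2 G :=
  fun p => (val f : G -> rat) p.1 * (val u : G -> rat) p.2.

Fact cup_subproof (f u : coH1 G) :
  `[< lspan [set c | cobar_d2 c = 0] (cup_cochain f u) >].
Proof.
apply/asboolP/span_in/funext => -[[x y] z].
rewrite /cobar_d2 /cup_cochain /= !coH1M.
have E (fx fy uy uz : rat) :
  fy * uz - (fx + fy) * uz + fx * (uy + uz) - fx * uy = 0 by ring.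
exact: E.
Qed.

Definition cup_cocycle (f u : coH1 G) : cocycles2 G :=
  exist _ (cup_cochain f u) (cup_subproof f u).

Definition cup (f u : coH1 G) : coH2 G := lpi _ (cup_cocycle f u).

Fact cup_linearl u : linear (cup^~ u).
Proof.
move=> c f f'; rewrite /cup -linearP; congr (lpi _ _).
apply/val_inj/funext => p.
have E (x x' y : rat) : (c * x + x') * y = c * (x * y) + x' * y by ring.
exact: E.
Qed.

Fact cup_linearr f : linear (cup f).
Proof.
move=> c u u'; rewrite /cup -linearP; congr (lpi _ _).
apply/val_inj/funext => p.
have E (x y y' : rat) : x * (c * y + y') = c * (x * y) + x * y' by ring.
exact: E.
Qed.

(* f cup f is the coboundary of - f^2 / 2 *)
Fact cup_alt f : cup f f = 0.
Proof.
rewrite -(linear0 (lpi _)) /cup; apply/lquotP; rewrite subr0.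
apply: span_in; exists (fun x => - (val f : G -> rat) x ^+ 2 / 2).
apply/funext => -[x y]; rewrite /cobar_d1 /= /cup_cochain /= coH1M.
have E (a b : rat) : a * b = - b ^+ 2 / 2 - (- (a + b) ^+ 2 / 2) + - a ^+ 2 / 2.
  by field.
exact: E.
Qed.

Definition mu : wedge2 (coH1 G) -> coH2 G := wedge_lift cup.

Lemma mu_wedge f u : mu (wedge f u) = cup f u.
Proof. exact: (wedge_liftE cup_linearl cup_linearr cup_alt). Qed.

Definition kron1 (f : coH1 G) (a : H_1 G) : rat^o :=
  lquot_lift (linext (val f : G -> rat^o)) a.
Definition kron2 (f : coH2 G) (a : H_2 G) : rat^o :=
  linext (val (repr f) : (G * G)%type -> rat^o) (val (repr a)).

Lemma linext_comp (X Y : choiceType) (V : lmodType rat) (h : Y -> V)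
    (k : X -> {malg rat[Y]}) c :
  linext h (linext k c) = linext (fun x => linext h (k x)) c.
Proof.
rewrite {2}/linext linear_sum; apply: eq_bigr => x _.
by rewrite linearZ.
Qed.

Lemma linext0 (X : choiceType) (V : lmodType rat) (f : X -> V) c :
  (forall x, f x = 0) -> linext f c = 0.
Proof. by move=> f0; rewrite /linext big1 // => x _; rewrite f0 scaler0. Qed.

Lemma linext_funP (X : choiceType) c (f f' : X -> rat^o) k :
  linext (fun x => k *: f x + f' x) c = k *: linext f c + linext f' c.
Proof.
rewrite /linext scaler_sumr -big_split; apply: eq_bigr => x _ /=.
by rewrite scalerDr !scalerA mulrC.
Qed.

Fact kron1_rels (f : coH1 G) a :
  range (@bar_d2 G) a -> linext (val f : G -> rat^o) a = 0.
Proof.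
case=> c _ <-; rewrite /bar_d2 linext_comp; apply: linext0 => -[x y] /=.
by rewrite linearD linearB /= !linextU coH1M opprD addrCA subrr addr0 addNr.
Qed.

Lemma kron1E f x : kron1 f (lpi _ << x >>) = (val f : G -> rat^o) x.
Proof. by rewrite /kron1 (lquot_liftE (@kron1_rels f)) /= linextU. Qed.

Lemma kron1_linearr f : linear (kron1 f).
Proof. exact: (lquot_lift_linear (@kron1_rels f)). Qed.

Lemma kron1_linearl a : linear (kron1^~ a).
Proof. by move=> c f u; rewrite /kron1 /lquot_lift -linext_funP. Qed.

Lemma cycles2P (z : cycles2 G) : bar_d2 (val z) = 0.
Proof. by have /asboolP /(span_ker (@linext_is_linear _ _ _)) := valP z. Qed.

Fact cobar_d2_linear : linear (@cobar_d2 G).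
Proof.
move=> c f u; apply/funext => p; rewrite /cobar_d2.
have E (x x' y y' z z' t t' : rat) :
  (c * x + x') - (c * y + y') + (c * z + z') - (c * t + t') =
  c * (x - y + z - t) + (x' - y' + z' - t') by ring.
exact: E.
Qed.

Lemma cocycles2P (z : cocycles2 G) : cobar_d2 (val z) = 0.
Proof. by have /asboolP /(span_ker cobar_d2_linear) := valP z. Qed.

Lemma linext_cobar_d1 (f : cobar1 G) c :
  linext (cobar_d1 f : (G * G)%type -> rat^o) c =
  linext (f : G -> rat^o) (bar_d2 c).
Proof.
rewrite /bar_d2 linext_comp; congr linext; apply/funext => -[x y].
by rewrite linearD linearB /= !linextU.
Qed.

Lemma linext_cobar_d2 (f : cobar2 G) c :
  linext (cobar_d2 f : (G * G * G)%type -> rat^o) c =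
  linext (f : (G * G)%type -> rat^o) (bar_d3 c).
Proof.
rewrite /bar_d3 linext_comp; congr linext; apply/funext => -[[x y] z].
by rewrite !(linearD, linearN) /= !linextU.
Qed.

Lemma kron2E (z : cocycles2 G) (c : cycles2 G) :
  kron2 (lpi _ z) (lpi _ c) = linext (val z : (G * G)%type -> rat^o) (val c).
Proof.
rewrite /kron2; set z' := repr _; set c' := repr _.
have z0 (u : cocycles2 G) (v : cycles2 G) :
    lspan [set u : cocycles2 G | exists f, val u = cobar_d1 f] u ->
  linext (val u : (G * G)%type -> rat^o) (val v) = 0.
  elim=> [{}u [f ->]||u1 u2 _ IH1 _ IH2|k u1 _ IH1].
  - by rewrite linext_cobar_d1 cycles2P linear0.
  - exact: linext0.
  - have := linext_funP (val v) (val u1) (val u2) 1.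
    by rewrite IH1 IH2 scaler0 addr0 => <-; congr linext; apply/funext => p;
       rewrite scale1r.
  - have := linext_funP (val v) (val u1) 0 k.
    by rewrite IH1 (@linext0 _ _ 0) // scaler0 addr0 => <-;
       congr linext; apply/funext => p; rewrite addr0.
have c0 (u : cocycles2 G) (v : cycles2 G) :
    lspan [set v : cycles2 G | exists c, val v = bar_d3 c] v ->
  linext (val u : (G * G)%type -> rat^o) (val v) = 0.
  elim=> [{}v [d ->]||v1 v2 _ IH1 _ IH2|k v1 _ IH1].
  - by rewrite -linext_cobar_d2 cocycles2P linext0.
  - exact: linear0.
  - have -> : val (v1 + v2) = val v1 + val v2 by [].
    by rewrite linearD /= IH1 IH2 addr0.
  - have -> : val (k *: v1) = k *: val v1 by [].
    by rewrite linearZ /= IH1 scaler0.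
have := z0 _ c' (span_repr _ z); have := c0 z _ (span_repr _ c).
rewrite -/z' -/c'.
have -> : val (c' - c) = val c' - val c by [].
rewrite linearB => /eqP; rewrite subr_eq0 => /eqP <- H.
have := linext_funP (val c') (val (z' - z)) (val z) 1.
rewrite H scaler0 add0r => E; apply: etrans E; congr linext; apply/funext => p.
by rewrite scale1r; exact/esym/subrK.
Qed.

(* the pairing of exterior squares with                                       *)
(* < f /\ u , a /\ b > = < f , a > < u , b > - < f , b > < u , a >            *)
Definition kron_det (f u : coH1 G) (a b : H_1 G) : rat^o :=
  kron1 f a * kron1 u b - kron1 f b * kron1 u a.
Definition kron_wedge (w : wedge2 (coH1 G)) (t : wedge2 (H_1 G)) : rat^o :=
  wedge_lift (fun f u => wedge_lift (kron_det f u) t) w.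

Fact kron_det_linearl f u b : linear ((kron_det f u)^~ b).
Proof.
move=> c x y; rewrite /kron_det !kron1_linearr.
have E (x1 x2 x3 x4 x5 x6 : rat) : (c * x1 + x2) * x3 - x4 * (c * x5 + x6) =
  c * (x1 * x3 - x4 * x5) + (x2 * x3 - x4 * x6) by ring.
exact: E.
Qed.

Fact kron_det_linearr f u a : linear (kron_det f u a).
Proof.
move=> c x y; rewrite /kron_det !kron1_linearr.
have E (x1 x2 x3 x4 x5 x6 : rat) : x3 * (c * x1 + x2) - (c * x5 + x6) * x4 =
  c * (x3 * x1 - x5 * x4) + (x3 * x2 - x6 * x4) by ring.
exact: E.
Qed.

Fact kron_det_alt f u a : kron_det f u a a = 0.
Proof. exact: subrr. Qed.

Lemma kron_wedgeE f u a b :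
  kron_wedge (wedge f u) (wedge a b) = kron_det f u a b.
Proof.
have P (B B' B'' : H_1 G -> H_1 G -> rat^o) k t :
    (forall a b, B'' a b = k *: B a b + B' a b) ->
  wedge_lift B'' t = k *: wedge_lift B t + wedge_lift B' t.
  move=> BE; rewrite /wedge_lift /lquot_lift -linext_funP.
  by congr linext; apply/funext => p; rewrite BE.
have E k (x1 x2 x3 x4 x5 x6 : rat) : (k * x1 + x2) * x3 - (k * x4 + x5) * x6 =
  k * (x1 * x3 - x4 * x6) + (x2 * x3 - x5 * x6) by ring.
have E' k (x1 x2 x3 x4 x5 x6 : rat) : x3 * (k * x1 + x2) - x6 * (k * x4 + x5) =
  k * (x3 * x1 - x6 * x4) + (x3 * x2 - x6 * x5) by ring.
rewrite /kron_wedge wedge_liftE; first exact: (wedge_liftE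
  (kron_det_linearl f u) (kron_det_linearr f u) (kron_det_alt f u)).
- move=> v k f1 f2; apply: P => x y; rewrite /kron_det !kron1_linearl; exact: E.
- move=> v k f1 f2; apply: P => x y; rewrite /kron_det !kron1_linearl; exact: E'.
- move=> v; rewrite /wedge_lift /lquot_lift linext0 // => p.
  by rewrite /kron_det mulrC subrr.
Qed.

(* The dual of mu as a relation: t is the image of c under the transpose of   *)
(* mu, cohomology being identified with the dual of homology by the pairings  *)
(* above. For finite-dimensional H_1 each c has exactly one such t. Rescaling *)
(* kron_wedge by a nonzero constant does not change the set of values t.      *)
Definition mu_dual (c : H_2 G) (t : wedge2 (H_1 G)) : Prop :=
  forall w : wedge2 (coH1 G), kron_wedge w t = kron2 (mu w) c.

End CupProduct.

HB.mixin Record isLieAlgebra L of GRing.Lmodule rat L := {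
  lie : L -> L -> L;
  lie_linearl : forall y, linear (lie^~ y);
  lie_linearr : forall x, linear (lie x);
  liexx : forall x, lie x x = 0;
  jacobi : forall x y z,
    lie x (lie y z) + lie y (lie z x) + lie z (lie x y) = 0
}.

#[short(type="lieAlgType")]
HB.structure Definition LieAlgebra := {L of isLieAlgebra L & GRing.Lmodule rat L}.

Section LieTheory.
Variable L : lieAlgType.

(* the ideal generated by S *)
Inductive lideal (S : set L) : set L :=
| lideal_in x : S x -> lideal S x
| lideal_0 : lideal S 0
| lideal_D x y : lideal S x -> lideal S y -> lideal S (x + y)
| lideal_Z c x : lideal S x -> lideal S (c *: x)
| lideal_lie x y : lideal S y -> lideal S (lie x y).

Definition lie_commutator (A B : set L) : set L :=
  lspan [set z | exists a b, [/\ A a, B b & z = lie a b]].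

Definition lie_derived2 : set L :=
  lie_commutator (lie_commutator setT setT) (lie_commutator setT setT).

Lemma lieC (x y : L) : lie x y = - lie y x.
Proof.
have Dl u v w : lie (u + v) w = lie u w + lie v w :> L.
  by have := lie_linearl w 1 u v; rewrite !scale1r.
have Dr u v w : lie w (u + v) = lie w u + lie w v :> L.
  by have := lie_linearr w 1 u v; rewrite !scale1r.
have := liexx (x + y); rewrite Dl !Dr !liexx add0r addr0.
by move=> /eqP; rewrite addr_eq0 => /eqP.
Qed.

Lemma lideal_span S x : lspan (lideal S) x -> lideal S x.
Proof.
elim=> [//||u v _ Su _ Sv|c u _ Su].
- exact: lideal_0.
- exact: lideal_D.
- exact: lideal_Z.
Qed.

End LieTheory.

Section LieQuotient.
Variables (L : lieAlgType) (S : set L).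

(* the quotient of L by the ideal generated by S *)
Definition lie_quot := lquot (lideal S).
HB.instance Definition _ := GRing.Lmodule.on lie_quot.

Definition lie_pi : L -> lie_quot := lpi (lideal S).

Lemma lie_piP x y : lie_pi x = lie_pi y <-> lideal S (x - y).
Proof.
split=> [/lquotP/lideal_span //|H]; exact/lquotP/span_in.
Qed.

Definition lie_quot_lie (a b : lie_quot) : lie_quot := lie_pi (lie (repr a) (repr b)).

Fact lie_quot_lieE x y : lie_quot_lie (lie_pi x) (lie_pi y) = lie_pi (lie x y).
Proof.
apply/lie_piP; set x' := repr (lie_pi x); set y' := repr (lie_pi y).
have Hx : lideal S (x' - x) by apply/lie_piP; rewrite /lie_pi lpiK.
have Hy : lideal S (y' - y) by apply/lie_piP; rewrite /lie_pi lpiK.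
have Dl u v w : lie (u - v) w = lie u w - lie v w :> L.
  by have := lie_linearl w (-1) v u; rewrite !scaleN1r ![- _ + _]addrC.
have Dr u v w : lie w (u - v) = lie w u - lie w v :> L.
  by have := lie_linearr w (-1) v u; rewrite !scaleN1r ![- _ + _]addrC.
have -> : lie x' y' - lie x y = lie x' (y' - y) + -1 *: lie y (x' - x).
  by rewrite scaleN1r -(lieC (x' - x)) Dr Dl addrA subrK.
by apply: lideal_D; [|apply: lideal_Z]; apply: lideal_lie.
Qed.

Lemma lie_pi_linear : linear lie_pi.
Proof. exact: linearP. Qed.

Lemma lie_pi_surj a : exists x, a = lie_pi x.
Proof. by exists (repr a); rewrite /lie_pi lpiK. Qed.

Fact lie_quot_linearl b : linear (lie_quot_lie^~ b).
Proof.
move=> c a a'; have [[x ->] [x' ->] [y ->]] :=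
  And3 (lie_pi_surj a) (lie_pi_surj a') (lie_pi_surj b).
by rewrite -lie_pi_linear !lie_quot_lieE lie_linearl lie_pi_linear.
Qed.
Fact lie_quot_linearr a : linear (lie_quot_lie a).
Proof.
move=> c b b'; have [[x ->] [y ->] [y' ->]] :=
  And3 (lie_pi_surj a) (lie_pi_surj b) (lie_pi_surj b').
by rewrite -lie_pi_linear !lie_quot_lieE lie_linearr lie_pi_linear.
Qed.
Fact lie_quot_xx a : lie_quot_lie a a = 0.
Proof.
have [x ->] := lie_pi_surj a.
by rewrite lie_quot_lieE liexx [LHS](linear0 (lpi _)).
Qed.
Fact lie_quot_jacobi x y z :
  lie_quot_lie x (lie_quot_lie y z) + lie_quot_lie y (lie_quot_lie z x)
  + lie_quot_lie z (lie_quot_lie x y) = 0.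
Proof.
have [[u ->] [v ->] [w ->]] :=
  And3 (lie_pi_surj x) (lie_pi_surj y) (lie_pi_surj z).
rewrite !lie_quot_lieE.
have D a b : lie_pi a + lie_pi b = lie_pi (a + b) by rewrite [RHS]linearD.
by rewrite !D jacobi [LHS](linear0 (lpi _)).
Qed.

HB.instance Definition _ := isLieAlgebra.Build lie_quot
  lie_quot_linearl lie_quot_linearr lie_quot_xx lie_quot_jacobi.

End LieQuotient.

(* The free Lie algebra on the vector space V: formal Lie expressions in the  *)
(* elements of V, modulo the smallest congruence for which the Lie algebra    *)
(* laws hold and V -> freeLie V is linear.                                    *)
Inductive lterm (V : Type) : Type :=
| LGen of V
| LZero
| LOpp of lterm V
| LAdd of lterm V & lterm V
| LScale of rat & lterm V
| LLie of lterm V & lterm V.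

Arguments LZero {V}.

HB.instance Definition _ (V : Type) := gen_eqMixin (lterm V).
HB.instance Definition _ (V : Type) := gen_choiceMixin (lterm V).

Section FreeLie.
Variable V : lmodType rat.
Implicit Types s t u : lterm V.

Inductive lterm_eq : lterm V -> lterm V -> Prop :=
| lteq_refl t : lterm_eq t t
| lteq_sym s t : lterm_eq s t -> lterm_eq t s
| lteq_trans s t u : lterm_eq s t -> lterm_eq t u -> lterm_eq s u
| lteq_opp s t : lterm_eq s t -> lterm_eq (LOpp s) (LOpp t)
| lteq_add s s' t t' :
    lterm_eq s s' -> lterm_eq t t' -> lterm_eq (LAdd s t) (LAdd s' t')
| lteq_scale c s t : lterm_eq s t -> lterm_eq (LScale c s) (LScale c t)
| lteq_lie s s' t t' :
    lterm_eq s s' -> lterm_eq t t' -> lterm_eq (LLie s t) (LLie s' t')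
| lteq_addA s t u : lterm_eq (LAdd s (LAdd t u)) (LAdd (LAdd s t) u)
| lteq_addC s t : lterm_eq (LAdd s t) (LAdd t s)
| lteq_add0 t : lterm_eq (LAdd LZero t) t
| lteq_addN t : lterm_eq (LAdd (LOpp t) t) LZero
| lteq_scaleA c d t : lterm_eq (LScale c (LScale d t)) (LScale (c * d) t)
| lteq_scale1 t : lterm_eq (LScale 1 t) t
| lteq_scaleDr c s t :
    lterm_eq (LScale c (LAdd s t)) (LAdd (LScale c s) (LScale c t))
| lteq_scaleDl c d t :
    lterm_eq (LScale (c + d) t) (LAdd (LScale c t) (LScale d t))
| lteq_linearl u c s t :
    lterm_eq (LLie (LAdd (LScale c s) t) u) (LAdd (LScale c (LLie s u)) (LLie t u))
| lteq_linearr u c s t :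
    lterm_eq (LLie u (LAdd (LScale c s) t)) (LAdd (LScale c (LLie u s)) (LLie u t))
| lteq_liexx t : lterm_eq (LLie t t) LZero
| lteq_jacobi s t u :
    lterm_eq (LAdd (LAdd (LLie s (LLie t u)) (LLie t (LLie u s)))
                   (LLie u (LLie s t))) LZero
| lteq_gen c v w :
    lterm_eq (LGen (c *: v + w)) (LAdd (LScale c (LGen v)) (LGen w)).

Definition freeLie_rel : rel (lterm V) := fun s t => `[< lterm_eq s t >].

Fact freeLie_rel_equiv : equiv_class_of freeLie_rel.
Proof.
split=> [u|u v|v u w].
- exact/asboolP/lteq_refl.
- by apply/asboolP/asboolP => /lteq_sym.
- by move=> /asboolP uv /asboolP vw; apply/asboolP/(lteq_trans uv).
Qed.
Canonical freeLie_equiv := EquivRelPack freeLie_rel_equiv.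

Definition freeLie := {eq_quot freeLie_equiv}.
HB.instance Definition _ := Choice.on freeLie.
HB.instance Definition _ := EqQuotient.on freeLie.

Definition flpi (t : lterm V) : freeLie := \pi_freeLie t.

Lemma flpiK : cancel (repr : freeLie -> lterm V) flpi.
Proof. exact: reprK. Qed.

Lemma flpiP s t : flpi s = flpi t <-> lterm_eq s t.
Proof.
split=> [/eqP|H]; first by rewrite eqquotE => /asboolP.
by apply/eqP; rewrite eqquotE; apply/asboolP.
Qed.

Lemma lterm_repr t : lterm_eq (repr (flpi t)) t.
Proof. by apply/flpiP; rewrite flpiK. Qed.

Definition fl_zero : freeLie := flpi LZero.
Definition fl_opp (a : freeLie) : freeLie := flpi (LOpp (repr a)).
Definition fl_add (a b : freeLie) : freeLie := flpi (LAdd (repr a) (repr b)).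
Definition fl_scale c (a : freeLie) : freeLie := flpi (LScale c (repr a)).
Definition fl_lie (a b : freeLie) : freeLie := flpi (LLie (repr a) (repr b)).

Lemma fl_oppE t : fl_opp (flpi t) = flpi (LOpp t).
Proof. exact/flpiP/lteq_opp/lterm_repr. Qed.
Lemma fl_addE s t : fl_add (flpi s) (flpi t) = flpi (LAdd s t).
Proof. by apply/flpiP/lteq_add; apply: lterm_repr. Qed.
Lemma fl_scaleE c t : fl_scale c (flpi t) = flpi (LScale c t).
Proof. exact/flpiP/lteq_scale/lterm_repr. Qed.
Lemma fl_lieE s t : fl_lie (flpi s) (flpi t) = flpi (LLie s t).
Proof. by apply/flpiP/lteq_lie; apply: lterm_repr. Qed.

Fact fl_addA : associative fl_add.
Proof.
move=> a b c; rewrite -[a]flpiK -[b]flpiK -[c]flpiK !fl_addE.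
exact/flpiP/lteq_addA.
Qed.
Fact fl_addC : commutative fl_add.
Proof. by move=> a b; rewrite -[a]flpiK -[b]flpiK !fl_addE; apply/flpiP/lteq_addC. Qed.
Fact fl_add0 : left_id fl_zero fl_add.
Proof. by move=> a; rewrite -[a]flpiK fl_addE; apply/flpiP/lteq_add0. Qed.
Fact fl_addN : left_inverse fl_zero fl_opp fl_add.
Proof. by move=> a; rewrite -[a]flpiK fl_oppE fl_addE; apply/flpiP/lteq_addN. Qed.

HB.instance Definition _ := GRing.isZmodule.Build freeLie
  fl_addA fl_addC fl_add0 fl_addN.

Lemma flpiD s t : flpi s + flpi t = flpi (LAdd s t).
Proof. exact: fl_addE. Qed.

Fact fl_scaleA c d a : fl_scale c (fl_scale d a) = fl_scale (c * d) a.
Proof. by rewrite -[a]flpiK !fl_scaleE; apply/flpiP/lteq_scaleA. Qed.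
Fact fl_scale1 : left_id 1 fl_scale.
Proof. by move=> a; rewrite -[a]flpiK fl_scaleE; apply/flpiP/lteq_scale1. Qed.
Fact fl_scaleDr : right_distributive fl_scale +%R.
Proof.
move=> c a b; rewrite -[a]flpiK -[b]flpiK flpiD !fl_scaleE flpiD.
exact/flpiP/lteq_scaleDr.
Qed.
Fact fl_scaleDl a : {morph fl_scale^~ a : c d / c + d}.
Proof.
by move=> c d; rewrite -[a]flpiK !fl_scaleE flpiD; apply/flpiP/lteq_scaleDl.
Qed.

HB.instance Definition _ := GRing.Zmodule_isLmodule.Build rat freeLie
  fl_scaleA fl_scale1 fl_scaleDr fl_scaleDl.

Lemma flpiZ c t : c *: flpi t = flpi (LScale c t).
Proof. exact: fl_scaleE. Qed.

Fact fl_linearl a : linear (fl_lie^~ a).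
Proof.
move=> c x y; rewrite -[a]flpiK -[x]flpiK -[y]flpiK.
by rewrite flpiZ flpiD !fl_lieE flpiZ flpiD; apply/flpiP/lteq_linearl.
Qed.
Fact fl_linearr a : linear (fl_lie a).
Proof.
move=> c x y; rewrite -[a]flpiK -[x]flpiK -[y]flpiK.
by rewrite flpiZ flpiD !fl_lieE flpiZ flpiD; apply/flpiP/lteq_linearr.
Qed.
Fact fl_liexx a : fl_lie a a = 0.
Proof. by rewrite -[a]flpiK fl_lieE; apply/flpiP/lteq_liexx. Qed.
Fact fl_jacobi a b c :
  fl_lie a (fl_lie b c) + fl_lie b (fl_lie c a) + fl_lie c (fl_lie a b) = 0.
Proof.
rewrite -[a]flpiK -[b]flpiK -[c]flpiK !fl_lieE !flpiD.
exact/flpiP/lteq_jacobi.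
Qed.

HB.instance Definition _ := isLieAlgebra.Build freeLie
  fl_linearl fl_linearr fl_liexx fl_jacobi.

Definition lgen (v : V) : freeLie := flpi (LGen v).

Lemma lgen_linear : linear lgen.
Proof. by move=> c v w; rewrite flpiZ flpiD; apply/flpiP/lteq_gen. Qed.

(* the homogeneous component lie_k (V) *)
Inductive lie_deg : nat -> set freeLie :=
| deg_gen v : lie_deg 1 (lgen v)
| deg_0 k : lie_deg k 0
| deg_D k x y : lie_deg k x -> lie_deg k y -> lie_deg k (x + y)
| deg_Z k c x : lie_deg k x -> lie_deg k (c *: x)
| deg_lie i j x y : lie_deg i x -> lie_deg j y -> lie_deg (i + j) (lie x y).

(* the identification of the exterior square of V with lie_2 (V) *)
Definition wedge_lie : wedge2 V -> freeLie :=
  wedge_lift (fun v w => lie (lgen v) (lgen w)).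

End FreeLie.

Section ChenRanks.
Variable G : groupType.

(* qgrp and lie_quot divide out by the normal subgroup, respectively the      *)
(* ideal, generated by the given set. Gamma_(k+1), G'' and h'' already are    *)
(* normal subgroups and an ideal.                                             *)
Definition lcs_quotient (H : groupType) (k : nat) : groupType :=
  qgrp [set x : subgrp (@lower_central H k) | lower_central k.+1 (val x)].

Definition gr (H : groupType) (k : nat) : lmodType rat := tensorQ (lcs_quotient H k).

Definition chen_rank (k : nat) : option nat := dimQ (gr (qgrp (@derived2 G)) k).

Definition holonomy : lieAlgType :=
  lie_quot [set wedge_lie t | t in [set t | exists c : H_2 G, mu_dual c t]].

Definition holonomy_metab : lieAlgType := lie_quot (@lie_derived2 holonomy).

Definition holonomy_metab_pi (x : freeLie (H_1 G)) : holonomy_metab :=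
  lie_pi _ (lie_pi _ x : holonomy).

Definition holonomy_metab_deg (k : nat) : lmodType rat :=
  lsub [set holonomy_metab_pi x | x in @lie_deg (H_1 G) k].

Definition holonomy_chen_rank (k : nat) : option nat := dimQ (holonomy_metab_deg k).

End ChenRanks.

(* Main.v *)
(* Chen groups and metabelian holonomy Lie algebras are both spanned in       *)
(* degree k by left-normed brackets of k generators. By antisymmetry, the     *)
(* Jacobi identity and the commutation of all but the first two entries the   *)
(* basic ones suffice, and a surface relation removes one more letter at the  *)
(* bottom. Independence comes from the action of a free metabelian group on   *)
(* a free module over power series (Magnus): the leading terms of the basic   *)
(* brackets are distinct Koszul boundaries over the polynomial ring, the      *)
(* surface relation being the symplectic vector omega, and a combination of   *)
(* the remaining brackets is a multiple of omega only if it is zero.          *)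
(*                                                                            *)
(* In a Seifert group the z_i are, up to roots, powers of the central h, and  *)
(* the long relation says that the product of the [x_i, y_i] is h^(-e) up to  *)
(* roots. If e = 0 this is the surface relation together with a central       *)
(* direction of degree 1. If e <> 0, it puts h in degree 2, where it replaces *)
(* the missing surface commutator, and the surface relation returns from      *)
(* degree 3 on because h is central. A homomorphism to a Heisenberg group     *)
(* over Q detects h. For e <> 0 these Heisenberg groups also trivialise all   *)
(* cup products of degree 1 classes, so that the holonomy Lie algebra is      *)
(* free; for e = 0 they show that cup products are multiples of omega, and    *)
(* bar cycles carried by the long relation and by commuting pairs [h, x_i]    *)
(* realise the relations of the holonomy Lie algebra.                         *)
From HB Require Import structures.
Require Import Defs.
From mathcomp Require Import all_boot all_order all_algebra finmap.
From mathcomp Require Import boolp classical_sets functions.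
From mathcomp Require Import monalg ring zify.

Set Implicit Arguments.
Unset Strict Implicit.
Unset Printing Implicit Defensive.

Import GRing.Theory Num.Theory.
Local Open Scope classical_set_scope.
Local Open Scope quotient_scope.
Local Open Scope ring_scope.

(** * Presented groups and the associated graded of a group *)

Section Homs.
Local Open Scope group_scope.
Variables (G K : groupType) (f : G -> K).
Hypothesis fM : {morph f : x y / x * y}.

Lemma hom1 : f 1 = 1.
Proof. by apply: (@mulgI _ (f 1)); rewrite -fM !mulg1. Qed.
Lemma homV x : f x^-1 = (f x)^-1.
Proof. by symmetry; apply: mulg1_eq; rewrite -fM mulgV hom1. Qed.
Lemma homR x y : f [~ x, y] = [~ f x, f y].
Proof. by rewrite /commg /conjg !(fM, homV). Qed.
Lemma homX x n : f (x ^+ n) = f x ^+ n.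
Proof. by elim: n => [|n IH]; rewrite ?hom1 // !expgS fM IH. Qed.
Lemma hom_prod I (r : seq I) (P : pred I) (F : I -> G) :
  f (\prod_(i <- r | P i) F i) = \prod_(i <- r | P i) f (F i).
Proof. exact: (big_morph f fM hom1). Qed.
Lemma hom_expgz x n : f (expgz x n) = expgz (f x) n.
Proof. by case: n => n /=; rewrite ?homV homX. Qed.

Lemma hom_gen (S : set G) (T : K -> Prop) :
  (forall x, S x -> T (f x)) -> T 1 -> (forall x y, T x -> T y -> T (x * y)) ->
  (forall x, T x -> T x^-1) -> forall x, gen S x -> T (f x).
Proof.
move=> fS T1 TM TV x; elim=> [{}x /fS//||u v _ Tu _ Tv|u _ Tu].
- by rewrite hom1.
- by rewrite fM; apply: TM.
- by rewrite homV; apply: TV.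
Qed.

Lemma hom_gen1 (S : set G) x : (forall x, S x -> f x = 1) -> gen S x -> f x = 1.
Proof.
move=> fS; apply: (hom_gen (T := fun y => y = 1)) => // [u v -> ->|u ->].
- by rewrite mulg1.
- by rewrite invg1.
Qed.

Lemma hom_nclosure (S : set G) x : (forall x, S x -> f x = 1) ->
  nclosure S x -> f x = 1.
Proof.
move=> fS; apply: hom_gen1 => _ [u [v [/fS fu ->]]].
by rewrite /conjg !(fM, homV) fu mul1g mulVg.
Qed.

Definition qgrp_lift (S : set G) (a : qgrp S) : K := f (repr a).

Section QgrpLift.
Variable (S : set G).
Hypothesis fS : forall x, S x -> f x = 1.

Lemma qgrp_liftE x : qgrp_lift (qpi S x) = f x.
Proof.
have := hom_nclosure fS (nclosure_repr S x); rewrite fM homV => /mulg1_eq.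
by rewrite invgK.
Qed.

Lemma qgrp_liftM : {morph @qgrp_lift S : x y / x * y}.
Proof.
move=> a b; rewrite -[a]qpiK -[b]qpiK; rewrite -[_ * _]/(qgrp_mul _ _).
by rewrite pi_qgrp_mul !qgrp_liftE fM.
Qed.
End QgrpLift.
End Homs.

Arguments qgrp_lift {G K} f {S} a.

Lemma qpiM (G : groupType) (S : set G) : {morph @qpi G S : x y / (x * y)%g}.
Proof. by move=> x y; rewrite -pi_qgrp_mul. Qed.

Lemma qpi_eq1 (G : groupType) (S : set G) x : S x -> qpi S x = 1%g.
Proof.
move=> Sx; rewrite -[RHS]/(qpi S 1%g); apply/qgrpP; rewrite mulg1; apply: gen_V.
by apply: gen_in; exists x, 1%g; rewrite conjg1.
Qed.

Section FgrpLift.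
Local Open Scope group_scope.
Variables (X : choiceType) (K : groupType) (f : X -> K).

Definition word_eval (w : seq (X * bool)) : K :=
  \prod_(p <- w) (if p.2 then (f p.1)^-1 else f p.1).

Lemma word_eval_eq u v : word_eq u v -> word_eval u = word_eval v.
Proof.
elim=> [//||w1 w2 w3 _ -> _ -> //|w1 w2 x e]; first by [].
rewrite /word_eval !big_cat !big_cons /=; congr (_ * _); rewrite mulgA.
by case: e => /=; rewrite ?mulVg ?mulgV mul1g.
Qed.

Definition fgrp_lift (a : fgrp X) : K := word_eval (repr a).

Lemma fgrp_lift_pi w : fgrp_lift (fpi w) = word_eval w.
Proof. exact/word_eval_eq/word_repr. Qed.

Lemma fgrp_liftM : {morph fgrp_lift : x y / x * y}.
Proof.
move=> a b; rewrite -[a]fpiK -[b]fpiK -[_ * _]/(fgrp_mul _ _) pi_fgrp_mul.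
by rewrite !fgrp_lift_pi /word_eval big_cat.
Qed.

Lemma fgrp_liftE x : fgrp_lift (fgen x) = f x.
Proof. by rewrite fgrp_lift_pi /word_eval big_seq1. Qed.
End FgrpLift.

Lemma fgrp_gen (X : choiceType) (a : fgrp X) : gen (range (@fgen X)) a.
Proof.
rewrite -[a]fpiK; elim: (repr a) => [|[x e] w IH]; first exact: gen_1.
have -> : fpi ((x, e) :: w) = (fpi [:: (x, e)] * fpi w)%g.
  by rewrite -[RHS]/(fgrp_mul _ _) pi_fgrp_mul.
apply: gen_M => //; case: e; last by apply: gen_in; exists x.
have -> : fpi [:: (x, true)] = (fgen x)^-1%g by rewrite -[RHS]/(fgrp_inv _) pi_fgrp_inv.
by apply: gen_V; apply: gen_in; exists x.
Qed.

Lemma gen_sub (G : groupType) (S T : set G) x :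
  (forall y, S y -> gen T y) -> gen S x -> gen T x.
Proof.
move=> ST; elim=> [y /ST//||y z _ Ty _ Tz|y _ Ty]; first exact: gen_1.
- exact: gen_M.
- exact: gen_V.
Qed.

Lemma qgrp_gen (G : groupType) (S T : set G) :
  (forall x, gen T x) -> forall a : qgrp S, gen (qpi S @` T) a.
Proof.
move=> GT a; rewrite -[a]qpiK.
elim: (GT (repr a)) => [x Tx||x y _ Sx _ Sy|x _ Sx].
- by apply: gen_in; exists x.
- exact: gen_1.
- by rewrite qpiM; apply: gen_M.
- by rewrite (homV (@qpiM _ _)); apply: gen_V.
Qed.

Section LowerCentral.
Local Open Scope group_scope.
Variable G : groupType.
Local Notation L := (@lower_central_rec G).

Lemma lcs1 n : L n 1.
Proof. by case: n => [//|n]; apply: gen_1. Qed.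
Lemma lcsM n x y : L n x -> L n y -> L n (x * y).
Proof. by case: n => [//|n]; apply: gen_M. Qed.
Lemma lcsV n x : L n x -> L n x^-1.
Proof. by case: n => [//|n]; apply: gen_V. Qed.
Lemma lcsX n x k : L n x -> L n (x ^+ k).
Proof.
by move=> Lx; elim: k => [|k IH]; [apply: lcs1 | rewrite expgS; apply: lcsM].
Qed.
Lemma lcs_prod n I (r : seq I) (P : pred I) (F : I -> G) :
  (forall i, P i -> L n (F i)) -> L n (\prod_(i <- r | P i) F i).
Proof. by move=> LF; elim/big_rec: _ => [|i x Pi]; [apply: lcs1 | apply/lcsM/LF]. Qed.

Lemma lcsR n x y : L n x -> L n.+1 [~ x, y].
Proof. by move=> Lx; apply: gen_in; exists x, y. Qed.
Lemma lcsJ n x y : L n x -> L n (x ^ y).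
Proof.
elim: n x y => [//|n IH] x y; elim=> [_ [a [b [La _ ->]]]||u v _ Lu _ Lv|u _ Lu].
- by rewrite conjRg; apply/lcsR/IH.
- by rewrite conj1g; apply: gen_1.
- by rewrite conjMg; apply: gen_M.
- by rewrite conjVg; apply: gen_V.
Qed.
Lemma lcsS n x : L n.+1 x -> L n x.
Proof.
elim=> [_ [a [b [La _ ->]]]||u v _ Lu _ Lv|u _ Lu].
- by rewrite /commg; apply: lcsM; [apply: lcsV | apply: lcsJ].
- exact: lcs1.
- exact: lcsM.
- exact: lcsV.
Qed.
Lemma lcs_le m n x : (m <= n)%N -> L n x -> L m x.
Proof. by move=> /subnK <-; elim: (n - m)%N => [//|k IH] /lcsS. Qed.
Lemma commMgE x y z : [~ x * y, z] = [~ x, z] * [~ [~ x, z], y] * [~ y, z] :> G.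
Proof. by rewrite /commg /conjg !gnorm. Qed.
Lemma commgME x y z : [~ x, y * z] = [~ x, z] * ([~ x, y] * [~ [~ x, y], z]) :> G.
Proof. by rewrite /commg /conjg !gnorm. Qed.

Lemma lcs_gen n x : gen (L n) x <-> L n x.
Proof.
split; last exact: gen_in.
elim=> [//||u v _ Lu _ Lv|u _ Lu]; [exact: lcs1 | exact: lcsM | exact: lcsV].
Qed.
End LowerCentral.

Lemma lcs_hom (G K : groupType) (f : G -> K) n x :
  {morph f : x y / (x * y)%g} -> lower_central_rec n x -> lower_central_rec n (f x).
Proof.
move=> fM; elim: n x => [//|n IH] x; apply: hom_gen => //.
- by move=> _ [a [b [La _ ->]]]; rewrite (homR fM); apply/lcsR/IH.
- exact: lcs1.
- exact: lcsM.
- exact: lcsV.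
Qed.

Lemma lspan_ind (V : lmodType rat) (S T : set V) :
  (forall v, S v -> lspan T v) -> forall v, lspan S v -> lspan T v.
Proof.
move=> ST v; elim=> [u /ST//||u w _ Tu _ Tw|c u _ Tu].
- exact: span_0.
- exact: span_D.
- exact: span_Z.
Qed.

Lemma lspan_sum (V : lmodType rat) (S : set V) I (r : seq I) (P : pred I) (F : I -> V) :
  (forall i, P i -> lspan S (F i)) -> lspan S (\sum_(i <- r | P i) F i).
Proof.
by move=> SF; elim/big_rec: _ => [|i x Pi]; [apply: span_0 | apply/span_D/SF].
Qed.

Lemma lspan_linear (V W : lmodType rat) (S : set V) (T : set W) (f : V -> W) :
  linear f -> (forall v, S v -> lspan T (f v)) -> forall v, lspan S v -> lspan T (f v).
Proof.
move=> fL fS v; pose F := GRing.isLinear.Build rat V W *:%R f fL.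
pose f' : {linear V -> W} := HB.pack f F.
elim=> [u /fS//||u w _ Tu _ Tw|c u _ Tu].
- rewrite -[f]/(f' : V -> W) linear0; exact: span_0.
- rewrite -[f]/(f' : V -> W) linearD; exact: span_D.
- rewrite -[f]/(f' : V -> W) linearZ; exact: span_Z.
Qed.

Lemma linear_fun0 (V W : lmodType rat) (f : V -> W) : linear f -> f 0 = 0.
Proof. by move=> fL; have := fL (-1) 0 0; rewrite !scaleN1r oppr0 addr0 addNr. Qed.
Lemma linear_funD (V W : lmodType rat) (f : V -> W) : linear f -> {morph f : x y / x + y}.
Proof. by move=> fL x y; have := fL 1 x y; rewrite !scale1r. Qed.
Lemma linear_funZ (V W : lmodType rat) (f : V -> W) : linear f ->
  forall c x, f (c *: x) = c *: f x.
Proof. by move=> fL c x; have := fL c x 0; rewrite (linear_fun0 fL) !addr0. Qed.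
Lemma linear_funN (V W : lmodType rat) (f : V -> W) : linear f -> {morph f : x / - x}.
Proof. by move=> fL x; rewrite -scaleN1r (linear_funZ fL) scaleN1r. Qed.
Lemma linear_fun_sum (V W : lmodType rat) (f : V -> W) I (r : seq I) (P : pred I) F :
  linear f -> f (\sum_(i <- r | P i) F i) = \sum_(i <- r | P i) f (F i).
Proof. by move=> fL; apply: (big_morph f (linear_funD fL) (linear_fun0 fL)). Qed.

Lemma linext_malg (X : choiceType) (c : {malg rat[X]}) :
  c = \sum_(x <- msupp c) c@_x *: << x >>.
Proof.
rewrite {1}(monalgE c); apply: eq_bigr => x _; apply/malgP => y.
by rewrite mcoeffZ !mcoeffU mulr_natr.
Qed.

Section TensorQTheory.
Variable A : groupType.
Definition tq (x : A) : tensorQ A := lpi (@tensorQ_rels A) << x >>.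

Lemma tqM : {morph tq : x y / (x * y)%g >-> x + y}.
Proof.
move=> x y; rewrite /tq lpiD; apply/lquotP; rewrite opprD addrA.
by apply: span_in; exists x, y.
Qed.

Lemma tq_span v : lspan (range tq) v.
Proof.
rewrite -[v]lpiK (linext_malg (repr v)) linear_sum; apply: lspan_sum => x _.
by rewrite linearZ; apply/span_Z/span_in; exists x.
Qed.

Lemma tq_univ (W : lmodType rat) (f : A -> W) :
  {morph f : x y / (x * y)%g >-> x + y} ->
  exists2 g : tensorQ A -> W, linear g & forall x, g (tq x) = f x.
Proof.
move=> fM; have K v : tensorQ_rels v -> linext f v = 0.
  by move=> [x [y ->]]; rewrite !linearB /= !linextU fM addrAC addrK subrr.
exists (lquot_lift (linext f)); first exact: (lquot_lift_linear K).
by move=> x; rewrite /tq (lquot_liftE K) /= linextU.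
Qed.
End TensorQTheory.

Section Gr.
Local Open Scope group_scope.
Variable H : groupType.
Local Notation L := (@lower_central_rec H).

(* [tau n] is the class in gr_(n+1); its value off Gamma_(n+1) is junk. *)
Definition tau (n : nat) (x : H) : gr H n.+1 :=
  if pselect (gen (@lower_central H n.+1) x) is left p
  then tq (qpi _ (exist _ x (asboolT p) : subgrp (@lower_central H n.+1)))
  else 0%R.

Lemma tauE n x (p : `[< gen (@lower_central H n.+1) x >]) :
  tau n x = tq (qpi _ (exist _ x p : subgrp (@lower_central H n.+1))).
Proof.
rewrite /tau; case: pselect => [q|[]]; last exact/asboolP.
by congr (tq (qpi _ _)); apply/val_inj.
Qed.

Lemma tauM n x y : L n x -> L n y -> tau n (x * y) = (tau n x + tau n y)%R.
Proof.
move=> Lx Ly; have px : `[< gen (L n) x >] by apply/asboolP/lcs_gen.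
have py : `[< gen (L n) y >] by apply/asboolP/lcs_gen.
have pxy : `[< gen (L n) (x * y) >] by apply/asboolP/lcs_gen/lcsM.
rewrite (tauE px) (tauE py) (tauE pxy) -tqM -qpiM.
by congr (tq (qpi _ _)); apply/val_inj.
Qed.

Lemma tau0 n x : L n.+1 x -> tau n x = 0%R.
Proof.
move=> Lx; have px : `[< gen (L n) x >] by apply/asboolP/lcs_gen/lcsS.
rewrite (tauE px) qpi_eq1 //=; apply: (@addIr _ (tq 1)).
by rewrite -tqM mulg1 add0r.
Qed.

Lemma tau_span n v : lspan (tau n @` L n) v.
Proof.
apply: lspan_ind (tq_span v) => _ [a _ <-]; rewrite -[a]qpiK.
move: (repr a) => -[x px]; apply: span_in; exists x; last exact: tauE.
by apply/lcs_gen/asboolP.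
Qed.

Lemma tau_univ n (W : lmodType rat) (f : H -> W) :
  (forall x y, L n x -> L n y -> f (x * y) = (f x + f y)%R) ->
  (forall x, L n.+1 x -> f x = 0%R) ->
  exists2 g : gr H n.+1 -> W, linear g & forall x, L n x -> g (tau n x) = f x.
Proof.
move=> fM f0.
pose S := [set x : subgrp (@lower_central H n.+1) | @lower_central H n.+2 (val x)].
have Lv (x : subgrp (@lower_central H n.+1)) : L n (val x).
  by apply/lcs_gen/asboolP/(valP x).
pose f1 (x : subgrp (@lower_central H n.+1)) : W := f (val x).
have f1M : {morph f1 : x y / x * y >-> (x + y)%R} by move=> x y; apply: fM.
have f11 : f1 1 = 0%R by apply: (@addIr _ (f1 1)); rewrite -f1M mulg1 add0r.
have f1V x : f1 x^-1 = (- f1 x)%R.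
  by apply/eqP; rewrite -addr_eq0 -f1M mulVg f11.
have f1S x : nclosure S x -> f1 x = 0%R.
  elim=> [_ [u [v [Su ->]]]||u v _ fu _ fv|u _ fu] //.
  - by rewrite /conjg !(f1M, f1V) addrCA addNr addr0; apply: f0.
  - by rewrite f1M fu fv addr0.
  - by rewrite f1V fu oppr0.
pose f2 (a : lcs_quotient H n.+1) : W := f1 (repr a).
have f2E x : f2 (qpi S x) = f1 x.
  by have := f1S _ (nclosure_repr S x); rewrite f1M f1V addrC => /subr0_eq ->.
have f2M : {morph f2 : x y / x * y >-> (x + y)%R}.
  move=> a b; rewrite -[a]qpiK -[b]qpiK -qpiM.
  by rewrite -/S !f2E f1M.
have [g gL gE] := tq_univ f2M; exists g => // x Lx.
have px : `[< gen (L n) x >] by apply/asboolP/lcs_gen.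
by rewrite (tauE px) gE f2E.
Qed.

Lemma tau1 n : tau n 1 = 0%R.
Proof. by apply: tau0; apply: lcs1. Qed.
Lemma tauV n x : L n x -> tau n x^-1 = (- tau n x)%R.
Proof.
by move=> Lx; apply/eqP; rewrite -addr_eq0 -tauM ?mulVg ?tau1 //; apply: lcsV.
Qed.
Lemma tauX n x k : L n x -> tau n (x ^+ k) = (tau n x *+ k)%R.
Proof.
move=> Lx; elim: k => [|k IH]; first exact: tau1.
by rewrite expgS tauM ?IH ?mulrS //; apply: lcsX.
Qed.
Lemma tau_prod n I (r : seq I) (P : pred I) (F : I -> H) :
  (forall i, P i -> L n (F i)) ->
  tau n (\prod_(i <- r | P i) F i) = (\sum_(i <- r | P i) tau n (F i))%R.
Proof.
move=> LF; elim: r => [|i r IH]; first by rewrite !big_nil tau1.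
by rewrite !big_cons; case: ifP => // Pi; rewrite tauM ?IH //; [apply: LF | apply: lcs_prod].
Qed.
End Gr.

Section FamilyDim.
Variables (V : lmodType rat) (J : finType).

Definition indep (e : J -> V) :=
  forall c : J -> rat, \sum_j c j *: e j = 0 -> forall j, c j = 0.

Lemma span_family (e : J -> V) v :
  lspan (range e) v -> exists c : J -> rat, v = \sum_j c j *: e j.
Proof.
elim=> [_ [j _ <-]||u w _ [c ->] _ [d ->]|k u _ [c ->]].
- exists (fun i => (i == j)%:R); rewrite (bigD1 j) //= eqxx scale1r big1 ?addr0 //.
  by move=> i /negbTE ->; rewrite scale0r.
- by exists (fun=> 0); rewrite big1 // => i _; rewrite scale0r.
- exists (fun i => c i + d i); rewrite -big_split; apply: eq_bigr => i _.
  by rewrite scalerDl.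
- exists (fun i => k * c i); rewrite scaler_sumr; apply: eq_bigr => i _.
  by rewrite scalerA.
Qed.

Lemma dimQ_family (e : J -> V) :
  (forall v, lspan (range e) v) -> indep e -> dimQ V = Some #|J|.
Proof.
move=> eS eI; apply: dimQE; exists (fun i => e (enum_val i)) => v.
have sumE (c : J -> rat) :
    \sum_j c j *: e j = \sum_(i < #|J|) c (enum_val i) *: e (enum_val i).
  exact/reindex/onW_bij/enum_val_bij.
have [c ->] := span_family (eS v); exists (\row_i c (enum_val i)); split.
  by rewrite sumE; apply: eq_bigr => i _; rewrite mxE.
move=> d; rewrite sumE => /eqP; rewrite -subr_eq0 -sumrB => /eqP H.
apply/rowP => i; rewrite mxE; apply/eqP; rewrite -subr_eq0; apply/eqP.
have := eI (fun j => c j - d 0 (enum_rank j)); rewrite sumE.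
under eq_bigr => k _ do rewrite enum_valK.
move=> /(_ _ (enum_val i)); rewrite enum_valK; apply.
by rewrite -[RHS]H; apply: eq_bigr => k _; rewrite scalerBl.
Qed.

Lemma indep_linear (W : lmodType rat) (f : V -> W) (e : J -> V) :
  linear f -> (forall c : J -> rat, \sum_j c j *: f (e j) = 0 -> forall j, c j = 0) ->
  indep e.
Proof.
move=> fL fI c; move/(congr1 f); rewrite linear_fun_sum // (linear_fun0 fL) => E.
apply: fI; rewrite -[RHS]E; apply: eq_bigr => j _; by rewrite (linear_funZ fL).
Qed.
End FamilyDim.

Lemma dimQ_lsub (V : lmodType rat) (S : set V) (J : finType) (e : J -> V) :
  (forall v, S v -> lspan (range e) v) -> (forall j, lspan S (e j)) -> indep e ->
  dimQ (lsub S) = Some #|J|.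
Proof.
move=> Se eS eI.
pose e' j : lsub S := exist _ (e j) (asboolT (eS j)).
apply: (@dimQ_family _ _ e').
- move=> v; have [c vE] := span_family (lspan_ind Se (asboolW (valP v))).
  have -> : v = \sum_j c j *: e' j.
    by apply/val_inj; rewrite vE linear_sum; apply: eq_bigr => j _.
  by apply: lspan_sum => j _; apply/span_Z/span_in; exists j.
- apply: (@indep_linear _ _ _ (val : lsub S -> V)) => [c x y|c]; first by [].
  exact: eI.
Qed.

(** * Basic metabelian commutators *)

Section ChenIndex.
Variables (n m : nat) (bad : pred 'I_n).

(* A pair (i, p :: s) with p :: s sorted and p < i stands for the basic       *)
(* commutator [g_i, g_p, g_s].                                                *)
Definition basic_pair (p : 'I_n * m.+1.-tuple 'I_n) :=
  [&& sorted leq [seq val i | i <- p.2], (thead p.2 < p.1)%N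
    & ~~ ((thead p.2 == 0 :> nat) && bad p.1)].

Definition chen_index : finType := {p | basic_pair p}.

Variables (W : lmodType rat) (B : 'I_n -> 'I_n -> seq 'I_n -> W).

Definition basic_val (p : chen_index) :=
  B (sval p).1 (thead (sval p).2) (behead (sval p).2).

Hypothesis Balt : forall i j s, size s = m -> B i j s = - B j i s.
Hypothesis Bperm : forall i j s s', size s = m -> perm_eq s s' -> B i j s = B i j s'.
Hypothesis Bjac : forall i j l s, (size s).+1 = m ->
  B i j (l :: s) + B j l (i :: s) + B l i (j :: s) = 0.

Local Notation S := (lspan (range basic_val)).

Lemma alt_diag i s : size s = m -> B i i s = 0.
Proof.
move=> sm; have /eqP := Balt i i sm; rewrite -subr_eq0 opprK -mulr2n -scaler_nat.
by rewrite scaler_eq0 => /orP[|/eqP //]; rewrite pnatr_eq0.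
Qed.

Lemma span_basic_min (i l : 'I_n) s : size s = m -> (l <= i)%N ->
  all (fun k : 'I_n => l <= k)%N s -> ~~ ((l == 0 :> nat) && bad i) -> S (B i l s).
Proof.
move=> sm li ls Q; have [il|il] := eqVneq i l.
  by rewrite il alt_diag //; apply: span_0.
pose lo : rel 'I_n := fun x y => (x <= y)%N.
have st : size (l :: sort lo s) == m.+1 by rewrite /= size_sort sm.
have bP : basic_pair (i, Tuple st).
  apply/and3P; split=> //=; last by rewrite ltn_neqAle eq_sym il.
  have lo_tr : transitive leq := leq_trans.
  rewrite (path_sortedE lo_tr) all_map all_sort ls /= sorted_map.
  by apply: sort_sorted => x y; apply: leq_total.
pose q : chen_index := exist _ (i, Tuple st) bP.
have -> : B i l s = basic_val q.
  by rewrite /basic_val /=; apply: Bperm => //; rewrite perm_sym perm_sort.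
by apply: span_in; exists q.
Qed.

Lemma span_basic_mem (i j l : 'I_n) s : size s = m -> l \in s ->
  S (B i l (j :: rem l s)) -> S (B j l (i :: rem l s)) -> S (B i j s).
Proof.
move=> sm ls S1 S2; rewrite (Bperm _ _ sm (perm_to_rem ls)).
have rm : (size (rem l s)).+1 = m by rewrite size_rem // sm prednK // -sm; case: (s) ls.
have /eqP := Bjac i j l rm; rewrite -addrA addr_eq0 => /eqP ->.
by apply: span_N; apply: span_D => //; rewrite Balt /= ?rm //; apply: span_N.
Qed.

Lemma seq_min (s : seq 'I_n) : s != [::] ->
  exists2 l, l \in s & all (fun k : 'I_n => l <= k)%N s.
Proof.
elim: s => [//|x s IH] _; have [->|/IH [l ls lmin]] := eqVneq s [::].
  by exists x; rewrite ?inE //= leqnn.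
have [xl|lx] := leqP x l; [exists x | exists l] => //=.
- by rewrite inE eqxx.
- by rewrite leqnn; apply: sub_all lmin => k; apply: leq_trans.
- by rewrite inE ls orbT.
- by rewrite (ltnW lx) lmin.
Qed.

Lemma span_basic_ok i j s : ~~ bad i -> ~~ bad j -> size s = m -> S (B i j s).
Proof.
move=> bi bj sm; have [|l] := @seq_min (i :: j :: s); first by [].
rewrite !inE => /or3P[/eqP->|/eqP->|ls] /and3P[li lj lmin].
- by rewrite Balt //; apply/span_N/span_basic_min => //; rewrite negb_and bj orbT.
- by apply/span_basic_min => //; rewrite negb_and bi orbT.
- have rm : (size (rem l s)).+1 = m by rewrite size_rem // sm prednK // -sm; case: (s) ls.
  have lr : all (fun k : 'I_n => l <= k)%N (rem l s).
    by apply/allP => k /mem_rem; move: k; apply/allP.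
  apply: (span_basic_mem sm ls); apply: span_basic_min; rewrite /= ?lj ?li //.
    by rewrite negb_and bi orbT.
  by rewrite negb_and bj orbT.
Qed.

Hypothesis Sbad : forall (i l : 'I_n) s, bad i -> l = 0 :> nat -> size s = m -> S (B i l s).

Lemma span_basic i j s : size s = m -> S (B i j s).
Proof.
have Smin (k l : 'I_n) r : size r = m -> (l <= k)%N ->
    all (fun k : 'I_n => l <= k)%N r -> S (B k l r).
  move=> rm lk lr; have [/andP[/eqP l0 bk]|Q] := boolP ((l == 0 :> nat) && bad k).
    exact: Sbad.
  exact: span_basic_min.
move=> sm; have [|l] := @seq_min (i :: j :: s); first by [].
rewrite !inE => /or3P[/eqP->|/eqP->|ls] /and3P[li lj lmin].
- by rewrite Balt //; apply/span_N/Smin.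
- exact/Smin.
- have rm : (size (rem l s)).+1 = m by rewrite size_rem // sm prednK // -sm; case: (s) ls.
  have lr : all (fun k : 'I_n => l <= k)%N (rem l s).
    by apply/allP => k /mem_rem; move: k; apply/allP.
  by apply: (span_basic_mem sm ls); apply: Smin; rewrite /= ?lj ?li.
Qed.
End ChenIndex.

Definition sx g (a : 'I_g) : 'I_(g + g) := lshift g a.
Definition sy g (a : 'I_g) : 'I_(g + g) := rshift g a.
Definition sbad g : pred 'I_(g + g) := fun i => i == g :> nat.

Lemma span_basic_surface g m (W : lmodType rat)
  (B : 'I_(g + g) -> 'I_(g + g) -> seq 'I_(g + g) -> W) :
  (forall i j s, size s = m -> B i j s = - B j i s) ->
  (forall i j s s', size s = m -> perm_eq s s' -> B i j s = B i j s') ->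
  (forall i j l s, (size s).+1 = m ->
     B i j (l :: s) + B j l (i :: s) + B l i (j :: s) = 0) ->
  (forall s, size s = m -> \sum_a B (sx a) (sy a) s = 0) ->
  forall i j s, size s = m -> lspan (range (@basic_val _ m (@sbad g) _ B)) (B i j s).
Proof.
move=> Balt Bperm Bjac Bsurf; apply: span_basic => // i l s /eqP ig l0 sm.
have g0 : (0 < g)%N by case: (posnP g) => // g0; have := ltn_ord i; rewrite ig g0.
have -> : l = sx (Ordinal g0) by apply: val_inj.
have -> : i = sy (Ordinal g0) by apply: val_inj; rewrite /= addn0.
have := Bsurf s sm; rewrite (bigD1 (Ordinal g0)) //= Balt // => /eqP.
rewrite addrC subr_eq0 => /eqP <-; apply: lspan_sum => a a0.
have a0' : nat_of_ord a <> 0%N by move=> E; case/eqP: a0; apply: val_inj.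
by apply: span_basic_ok => //; rewrite /sbad /=; move: (ltn_ord a) a0'; lia.
Qed.

Section Counting.
Local Open Scope set_scope.

Section Heads.
Variable n : nat.
Local Notation sorted_tuple m := (fun t : m.-tuple 'I_n.+1 => sorted leq [seq val i | i <- t]).

Lemma card_sorted_head0 m :
  #|[set t : m.+1.-tuple 'I_n.+1 | sorted_tuple m.+1 t && (thead t == 0 :> nat)]| = 'C(m + n, m).
Proof.
rewrite -card_sorted_tuples; set A := [set _ | _]; set D := [set _ | _].
rewrite -(card_imset D (f := fun t : m.-tuple 'I_n.+1 => [tuple of ord0 :: t])); last first.
  by move=> t u /(congr1 val) [] /val_inj.
congr #|pred_of_set _|; apply/setP => t; rewrite inE; apply/idP/imsetP.
  case/tupleP: t => x t /andP[]; rewrite theadE => st /eqP x0.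
  exists t; first by rewrite inE; apply: path_sorted st.
  by apply: val_inj; congr (_ :: _); apply: val_inj.
case=> u; rewrite inE => su ->; rewrite theadE eqxx andbT /=.
by rewrite (path_sortedE leq_trans) su andbT; apply/allP.
Qed.

Lemma card_le_head m :
  #|[set p : 'I_n.+1 * m.+1.-tuple 'I_n.+1 | sorted_tuple m.+1 p.2 && (p.1 <= thead p.2)%N]|
  = 'C(m.+2 + n, m.+2).
Proof.
rewrite -card_sorted_tuples; set A := [set _ | _]; set D := [set _ | _].
rewrite -(card_imset A (f := fun p : 'I_n.+1 * m.+1.-tuple 'I_n.+1 => [tuple of p.1 :: p.2])).
  congr #|pred_of_set _|; apply/setP => t; rewrite inE; apply/imsetP/idP.
    case=> -[x u]; rewrite inE /= => /andP[su xu] ->.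
    move: su xu; case/tupleP: u => y u /=; rewrite theadE => su xu.
    by rewrite xu.
  case/tupleP: t => x t st; exists (x, t); last exact: val_inj.
  rewrite inE /=; move: st; case/tupleP: t => y t /=; rewrite theadE.
  by move=> /andP[xy ->].
by move=> [x t] [y u] /(congr1 val) [] -> /val_inj ->.
Qed.
End Heads.

Lemma card_chen_index n m : #|chen_index m (@pred0 'I_n)| = (m.+1 * 'C(n + m, m.+2))%N.
Proof.
rewrite card_sig; case: n => [|n].
  by rewrite bin_small ?muln0; [apply: eq_card0 => -[[]]|].
pose T := ('I_n.+1 * m.+1.-tuple 'I_n.+1)%type.
pose A := [set p : T | sorted leq [seq val i | i <- p.2]].
pose D := [set p : T | sorted leq [seq val i | i <- p.2] & (p.1 <= thead p.2)%N].
have DA : D \subset A by apply/fintype.subsetP => p; rewrite !inE => /andP[].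
have cA : #|A| = (n.+1 * 'C(m.+1 + n, m.+1))%N.
  have -> : A = finset.setX finset.setT
      [set t : m.+1.-tuple 'I_n.+1 | sorted leq [seq val i | i <- t]].
    by apply/setP => -[i t]; rewrite !inE.
  by rewrite cardsX card_sorted_tuples cardsT card_ord.
have -> : #|[pred x : T | basic_pair (@pred0 'I_n.+1) x]| = #|A :\: D|.
  apply: eq_card => p; rewrite !inE /basic_pair andbF andbT.
  by rewrite ltnNge; case: (sorted _ _); rewrite ?andbF ?andbT.
rewrite cardsD (finset.setIidPr DA) cA card_le_head.
rewrite -[(m.+2 + n)%N]/(m.+1 + n).+1 binS mulSn.
have -> : (n.+1 + m = m.+1 + n)%N by lia.
have := mul_bin_left (m.+1 + n) m.+1; rewrite addKn.
by move: 'C(_, _) 'C(_, _) => u v; nia.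
Qed.

Lemma card_surface_index g m : (0 < g)%N ->
  (#|chen_index m (@sbad g)| + 'C(g + g + m - 1, m) = m.+1 * 'C(g + g + m, m.+2))%N.
Proof.
move=> g0; rewrite -card_chen_index !card_sig.
have [n nE] : exists n, (g + g = n.+1)%N by exists (g + g).-1; rewrite prednK // addn_gt0 g0.
have gn : (g < g + g)%N by rewrite -{1}[g]addn0 ltn_add2l.
pose y0 : 'I_(g + g) := Ordinal gn.
pose T := ('I_(g + g) * m.+1.-tuple 'I_(g + g))%type.
pose A := [set p : T | basic_pair (@pred0 'I_(g + g)) p].
pose D := [set p : T | [&& sorted leq [seq val i | i <- p.2], thead p.2 == 0 :> nat & p.1 == y0]].
have DA : D \subset A.
  apply/fintype.subsetP => -[i t]; rewrite !inE /basic_pair /= => /and3P[-> /eqP -> /eqP ->].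
  by rewrite andbF /= g0.
have cD : #|D| = 'C(g + g + m - 1, m).
  have -> : D = finset.setX (finset.set1 y0) [set t : m.+1.-tuple 'I_(g + g) |
      sorted leq [seq val i | i <- t] && (thead t == 0 :> nat)].
    by apply/setP => -[i t]; rewrite !inE /= andbA andbC.
  rewrite cardsX cards1 mul1n /= nE card_sorted_head0.
  by rewrite addSn subn1 /= addnC.
have -> : #|[pred x : T | basic_pair (@sbad g) x]| = #|A :\: D|.
  apply: eq_card => p; rewrite !inE /basic_pair andbF andbT /sbad -val_eqE /=.
  case: (sorted _ _) => //=; case: eqP => [->|_] /=.
    exact: andbC.
  exact: andbT.
have -> : #|[pred x : T | basic_pair (@pred0 'I_(g + g)) x]| = #|A|.
  by apply: eq_card => p; rewrite !inE.
by rewrite cardsD (finset.setIidPr DA) -cD subnK // subset_leq_card.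
Qed.
End Counting.

(** * Koszul vectors over a polynomial ring *)

Section Kvec.
Variables (n : nat) (R : comAlgType rat) (X : 'I_n -> R).

(* The leading term of the left-normed commutator [g_i, g_j, g_s] in the      *)
(* Magnus representation: an element of the free R-module on 'I_n, lying in   *)
(* the image of the Koszul differential.                                      *)
Definition kvec i j s : 'I_n -> R := fun q =>
  (-1) ^+ size s * \prod_(k <- s) X k * (X i *+ (q == j) - X j *+ (q == i)).

Lemma kvec_rcons i j s l q : kvec i j (rcons s l) q = - (X l * kvec i j s q).
Proof.
have E (a b c d : R) : -1 * a * (b * d) * c = - (d * (a * b * c)).
  by rewrite !mulN1r !mulNr (mulrC b) (mulrCA a) !mulrA.
by rewrite /kvec size_rcons -cats1 big_cat big_seq1 /= exprS E.
Qed.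

Lemma kvecE i j s q : kvec i j s q = (-1) ^+ size s *:
  (\prod_(k <- i :: s) X k *+ (q == j) - \prod_(k <- j :: s) X k *+ (q == i)).
Proof.
rewrite /kvec !big_cons -mulrA mulrBr !mulrnAr ![_ * X _]mulrC.
by rewrite -[RHS]mul1r -scalerAr scalerAl -[_ *: 1]/(in_alg R _) rmorphXn rmorphN1.
Qed.
End Kvec.

Definition komega g (R : comAlgType rat) (X : 'I_(g + g) -> R) : 'I_(g + g) -> R :=
  \sum_(a < g) kvec X (sx a) (sy a) [::].

Lemma komegaE g (R : comAlgType rat) (X : 'I_(g + g) -> R) q : komega X q =
  \sum_(a < g) (X (sx a) *+ (q == sy a) - X (sy a) *+ (q == sx a)).
Proof.
rewrite /komega fct_sumE; apply: eq_bigr => a _.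
by rewrite /kvec big_nil expr0 !mul1r.
Qed.

Lemma komega_y g (R : comAlgType rat) (X : 'I_(g + g) -> R) (a : 'I_g) :
  komega X (sy a) = X (sx a).
Proof.
rewrite komegaE (bigD1 a) //= eqxx eq_rlshift subr0 big1 ?addr0 // => b /negbTE ba.
by rewrite eq_rlshift (inj_eq (@rshift_inj _ _)) eq_sym ba subr0.
Qed.

Section Monomials.
Variable n : nat.
Implicit Types (i q : 'I_n) (s : seq 'I_n).

Definition mon s : 'X_{1..n} := \big[mmul/mone]_(i <- s) ucm i.

Lemma monE s q : mon s q = count_mem q s.
Proof.
rewrite /mon; elim: s => [|i s IH]; first by rewrite big_nil cm1.
by rewrite big_cons cmM cmU IH.
Qed.

Lemma mon_perm s s' : mon s = mon s' -> perm_eq s s'.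
Proof. by move=> E; apply/allP => q _ /=; rewrite -!monE E. Qed.

Lemma coefUM (k : 'X_{1..n}) (r : {malg rat['X_{1..n}]}) m :
  (<< k >> * r)@_m = \sum_(k' <- msupp r) (r@_k' *+ (mmul k k' == m)).
Proof.
rewrite [_ * _]fgmulUg raddf_sum; apply: eq_bigr => k' _.
by rewrite /= mcoeffU mul1r.
Qed.

Lemma prod_ucm s :
  \prod_(i <- s) (<< ucm i >> : {malg rat['X_{1..n}]}) = << mon s >>.
Proof.
rewrite /mon; elim: s => [|i s IH]; first by rewrite !big_nil.
rewrite !big_cons IH; apply/malgP => m.
by rewrite [_ * _]fgmulUU mulr1.
Qed.

(* An opaque interface to Q[X_1, ..., X_n]: on the concrete monoid algebra,   *)
(* unification unfolds products instead of failing.                           *)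
Record poly_ring := PolyRing {
  pr_ring : comAlgType rat;
  pr_X : 'I_n -> pr_ring;
  pr_coef : 'X_{1..n} -> pr_ring -> rat^o;
  pr_coef_linear : forall m, linear (pr_coef m);
  pr_coefX : forall s m, pr_coef m (\prod_(i <- s) pr_X i) = (mon s == m)%:R;
  pr_coefM0 : forall i (m : 'X_{1..n}) r, m i = 0%N -> pr_coef m (pr_X i * r) = 0;
  pr_coefM : forall i m r, pr_coef (mmul (ucm i) m) (pr_X i * r) = pr_coef m r;
  pr_coef_inj : forall r, (forall m, pr_coef m r = 0) -> r = 0
}.

Lemma mpoly_ring : poly_ring.
Proof.
pose R : comAlgType rat := {malg rat['X_{1..n}]}.
pose X i : R := << ucm i >>.
apply: (@PolyRing R X (fun m r => (r : {malg rat['X_{1..n}]})@_m)).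
- by move=> m c x y; rewrite mcoeffD mcoeffZ.
- by move=> s m; rewrite -[RHS]mcoeffU1 -prod_ucm.
- move=> i m r mi; rewrite /X coefUM big1 // => k _; case: eqP => // E.
  by have := mi; rewrite -E cmM cmUU.
- move=> i m r.
  rewrite /X coefUM -[RHS](@linextU _ _ (fun k => (r@_k : rat^o)) m).
  rewrite linextU [in RHS](monalgE r) raddf_sum; apply: eq_bigr => k _ /=.
  rewrite mcoeffU; congr (_ *+ nat_of_bool _); apply/eqP/eqP => [E|-> //].
  apply/eqP/cmP => q; have := congr1 (fun m : 'X_{1..n} => m q) E.
  by rewrite !cmM => /addnI.
- by move=> r r0; apply/malgP => m; rewrite mcoeff0 r0.
Qed.
End Monomials.

Section KoszulCoef.
Variables (n : nat) (P : poly_ring n).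
Local Notation R := (pr_ring P).
Local Notation X := (@pr_X n P).

Lemma pr_X_inj0 i (r : R) : r * X i = 0 -> r = 0.
Proof.
move=> r0; apply: pr_coef_inj => m; rewrite -(pr_coefM i) mulrC r0.
exact: (linear_fun0 (pr_coef_linear _)).
Qed.

Lemma coef_kvec i j s q m :
  pr_coef m (kvec X i j s q) = (-1) ^+ size s *
    ((mon (i :: s) == m)%:R *+ (q == j) - (mon (j :: s) == m)%:R *+ (q == i)) :> rat.
Proof.
have L := pr_coef_linear (p := P) m.
rewrite kvecE (linear_funZ L); congr (_ * _).
rewrite (linear_funD L) (linear_funN L).
by do 2!case: (_ == _ :> 'I_n); rewrite ?mulr1n ?mulr0n ?(linear_fun0 L) ?pr_coefX.
Qed.
End KoszulCoef.

Section KoszulIndep.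
Variables (n m : nat) (bad : pred 'I_n) (P : poly_ring n).
Local Notation R := (pr_ring P).
Local Notation X := (@pr_X n P).

Lemma chen_index_le (p : chen_index m bad) (q : 'I_n) :
  q \in tval (sval p).2 -> (thead (sval p).2 <= q)%N.
Proof.
case: p => -[i t] /= /and3P[/= st _ _]; case/tupleP: t st => j t /=.
rewrite theadE (path_sortedE leq_trans) => /andP[/allP H _].
by rewrite inE => /orP[/eqP->|qt] //; apply: H; apply: map_f.
Qed.

Lemma behead_chen (p : chen_index m bad) :
  thead (sval p).2 :: behead (sval p).2 = (sval p).2.
Proof. by case: p => -[i t] /= _; case/tupleP: t => j t; rewrite theadE. Qed.

Lemma kvec_indep_coef (c : chen_index m bad -> rat) (p0 : chen_index m bad) :
  pr_coef (mon (sval p0).2) (\sum_p c p *: basic_val (kvec X) p (sval p0).1)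
  = - (-1) ^+ m * c p0 :> rat.
Proof.
have L := pr_coef_linear (p := P) (mon (sval p0).2).
rewrite (linear_fun_sum _ _ _ L) (bigD1 p0) //= big1 ?addr0 => [|p pp0].
  rewrite (linear_funZ L) coef_kvec size_behead size_tuple /= behead_chen !eqxx.
  have lt : (thead (sval p0).2 < (sval p0).1)%N by case: (p0) => q /= /and3P[].
  have -> : ((sval p0).1 == thead (sval p0).2) = false.
    by apply/negbTE; apply: contraTneq lt => ->; rewrite ltnn.
  by rewrite mulr0n sub0r mulr1n mulrN1 -[_ *: _]/(_ * _) mulrC.
rewrite (linear_funZ L) coef_kvec size_behead size_tuple behead_chen.
set t1 := _ *+ _; set t2 := _ *+ _.
have -> : t1 = 0.
  rewrite /t1; case: eqP => [E|_]; last by rewrite mul0rn.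
  case: eqP => // ij; exfalso.
  have lt0 : (thead (sval p0).2 < (sval p0).1)%N by case: (p0) => q /= /and3P[].
  have lt : (thead (sval p).2 < (sval p).1)%N by case: (p) => q /= /and3P[].
  have : thead (sval p0).2 \in (sval p).1 :: behead (sval p).2.
    by rewrite (perm_mem (mon_perm E)) -behead_chen mem_head.
  rewrite inE => /orP[/eqP h|h].
    by move: lt0 lt; rewrite h ij => a b; have := ltn_trans a b; rewrite ltnn.
  have := chen_index_le (p := p) (q := thead (sval p0).2).
  rewrite -behead_chen inE h orbT => /(_ isT); rewrite -ij => a.
  by have := leq_trans lt0 a; rewrite ltnn.
have -> : t2 = 0; last by rewrite subrr mulr0 scaler0.
rewrite /t2; case: eqP => [E|_]; last by rewrite mul0rn.
case: eqP => // ii; exfalso.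
case/eqP: pp0; apply: val_inj; move: E ii.
case: p {t1 t2} => -[i t] Q; case: p0 {L} => -[i0 t0] Q0 /= E ->; congr (_, _).
have lo_anti : antisymmetric (fun x y : 'I_n => (x <= y)%N).
  by move=> x y xy; apply/val_inj/anti_leq.
have lo_tr : transitive (fun x y : 'I_n => (x <= y)%N).
  by move=> y x z; apply: leq_trans.
apply/val_inj/(sorted_eq lo_tr lo_anti); last exact: mon_perm.
- by case/and3P: Q => /=; rewrite sorted_map.
- by case/and3P: Q0 => /=; rewrite sorted_map.
Qed.

Lemma kvec_indep : indep (basic_val (m := m) (bad := bad) (kvec X)).
Proof.
move=> c E p0; have := kvec_indep_coef c p0.
have -> : \sum_p c p *: basic_val (kvec X) p (sval p0).1 = 0.
  rewrite -[RHS](congr1 (fun f => f (sval p0).1) E) fct_sumE.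
  by apply: eq_bigr => p _.
rewrite (linear_fun0 (pr_coef_linear _)) => /esym /eqP.
by rewrite mulNr oppr_eq0 mulf_eq0 signr_eq0 => /eqP.
Qed.
End KoszulIndep.

Section SurfaceIndep.
Variables (g : nat) (P : poly_ring (g + g)).
Local Notation R := (pr_ring P).
Local Notation X := (@pr_X _ P).

Lemma komega_torsion_free (r : R) : (0 < g)%N ->
  (forall q, r * komega X q = 0) -> r = 0.
Proof.
move=> g0 /(_ (sy (Ordinal g0))); rewrite komega_y; exact: pr_X_inj0.
Qed.

Lemma kvec_indep_surface m (c : chen_index m (@sbad g) -> rat) (r : R) :
  \sum_p c p *: basic_val (kvec X) p = (fun q => r * komega X q) ->
  forall p, c p = 0.
Proof.
move=> E p0; have g0 : (0 < g)%N.
  by case: (posnP g) => // g0; have := ltn_ord (sval p0).1; lia.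
pose a0 := Ordinal g0.
have r0 : r = 0.
  apply: pr_coef_inj => k; rewrite -(pr_coefM (sx a0)).
  set k0 := mmul _ k; have k00 : k0 (sx a0) != 0%N by rewrite /k0 cmM cmUU.
  have L := pr_coef_linear (p := P) k0.
  have := congr1 (fun f : 'I_(g + g) -> R => f (sy a0)) E.
  rewrite /= komega_y mulrC => <-; rewrite fct_sumE (linear_fun_sum _ _ _ L).
  rewrite big1 // => p _.
  rewrite /= (linear_funZ L) coef_kvec.
  have x0min (s : seq 'I_(g + g)) : mon s = k0 -> sx a0 \in s.
    by move=> sk; rewrite -has_pred1 has_count -monE sk lt0n.
  have [lt bd] : (thead (sval p).2 < (sval p).1)%N /\
      ~~ ((thead (sval p).2 == 0 :> nat) && sbad (sval p).1).
    by case: (p) => q /= /and3P[].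
  have noti : sx a0 \in (sval p).1 :: behead (sval p).2 -> thead (sval p).2 = 0 :> nat.
    rewrite inE => /orP[/eqP h|h]; first by move: lt; rewrite -h.
    apply/eqP; rewrite -leqn0 -[0%N]/(nat_of_ord (sx a0)).
    by apply: chen_index_le; rewrite -behead_chen inE h orbT.
  rewrite behead_chen; case: eqP => [/x0min/noti z|_].
    have -> : (sy a0 == thead (sval p).2) = false.
      by rewrite -val_eqE /= z addn0 gtn_eqF.
    case: eqP => [/x0min|_]; last by rewrite mul0rn subrr mulr0 scaler0.
    move=> _; have -> : (sy a0 == (sval p).1) = false; last by rewrite subrr mulr0 scaler0.
    apply: contraNF bd => /eqP h; rewrite z eqxx -h /sbad /= addn0 eqxx //.
  rewrite mul0rn sub0r; case: eqP => [/x0min h|_]; last by rewrite mul0rn oppr0 mulr0 scaler0.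
  have z : thead (sval p).2 = 0 :> nat.
    apply/eqP; rewrite -leqn0 -[0%N]/(nat_of_ord (sx a0)).
    exact: chen_index_le.
  have -> : (sy a0 == (sval p).1) = false; last by rewrite oppr0 mulr0 scaler0.
  by apply: contraNF bd => /eqP h1; rewrite z eqxx -h1 /sbad /= addn0 eqxx.
apply: (@kvec_indep _ _ _ P c); rewrite E; apply/funext => q.
by rewrite r0 mul0r.
Qed.
End SurfaceIndep.

(** * Left-normed commutators in metabelian groups *)

Section GrBracket.
Local Open Scope group_scope.
Variable H : groupType.
Local Notation L := (@lower_central_rec H).

Lemma tauRl n a a' b : L n a -> L n a' ->
  tau n.+1 [~ a * a', b] = (tau n.+1 [~ a, b] + tau n.+1 [~ a', b])%R.
Proof.
move=> La La'; have Lab := lcsR b La; have Lc := lcsR a' Lab.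
rewrite commMgE (tauM (lcsM Lab (lcsS Lc)) (lcsR b La')) (tauM Lab (lcsS Lc)).
by rewrite (tau0 Lc) addr0.
Qed.

Lemma tauRr n a b b' : L n a ->
  tau n.+1 [~ a, b * b'] = (tau n.+1 [~ a, b] + tau n.+1 [~ a, b'])%R.
Proof.
move=> La; have Lab := lcsR b La; have Lc := lcsR b' Lab.
have Lab' := lcsR b' La.
rewrite commgME (tauM Lab' (lcsM Lab (lcsS Lc))) (tauM Lab (lcsS Lc)).
by rewrite (tau0 Lc) addr0 addrC.
Qed.

Lemma tau_ad n b : exists2 g : gr H n.+1 -> gr H n.+2, linear g &
  forall a, L n a -> g (tau n a) = tau n.+1 [~ a, b].
Proof.
apply: tau_univ => [x y|x Lx]; first exact: tauRl.
by apply: tau0; apply: lcsR.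
Qed.

Lemma additive_gen_span (W : lmodType rat) (f : H -> W) (S : set H) (T : set W) x :
  (forall y z, f (y * z) = (f y + f z)%R) -> (forall y, S y -> lspan T (f y)) ->
  gen S x -> lspan T (f x).
Proof.
move=> fM fS; have f1 : f 1 = 0%R by apply: (@addIr _ (f 1)); rewrite -fM mulg1 add0r.
elim=> [y /fS//||y z _ Ty _ Tz|y _ Ty].
- by rewrite f1; apply: span_0.
- by rewrite fM; apply: span_D.
- have -> : f y^-1 = (- f y)%R by apply/eqP; rewrite -addr_eq0 -fM mulVg f1.
  exact: span_N.
Qed.

Lemma tau_lcs_span n x : L n.+1 x ->
  lspan [set tau n.+1 [~ p.1, p.2] | p in [set p : H * H | L n p.1]] (tau n.+1 x).
Proof.
elim=> [_ [a [b [La _ ->]]]||u v Lu Tu Lv Tv|u Lu Tu].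
- by apply: span_in; exists (a, b).
- by rewrite tau1; apply: span_0.
- by rewrite tauM //; apply: span_D.
- by rewrite tauV //; apply: span_N.
Qed.

(* Generators of this kind contribute no letters to left-normed commutators;  *)
(* in a Seifert group they include h and the z_i.                             *)
Definition gr_central (b : H) := forall n a, L n a -> tau n.+1 [~ a, b] = 0%R.

Variables (I : Type) (c : I -> H).
Hypothesis Hgen : forall x, gen (range c `|` gr_central) x.

Lemma gr_span_step n (T : set H) :
  (forall v, lspan (tau n @` T) v) -> (forall t, T t -> L n t) ->
  forall v, lspan (tau n.+1 @` [set x | exists t i, T t /\ x = [~ t, c i]]) v.
Proof.
move=> ST TL v; apply: lspan_ind (tau_span v) => _ [x Lx <-].
apply: lspan_ind (tau_lcs_span Lx) => _ [[a b] /= La <-].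
have [g gL gE] := tau_ad n b; rewrite -gE //.
apply: (lspan_linear gL) (ST (tau n a)) => _ [t Tt <-]; rewrite gE; last exact: TL.
apply: (additive_gen_span (f := fun b => tau n.+1 [~ t, b])) (Hgen b).
- by move=> y z; apply/tauRr/TL.
- move=> y [[i _ <-]|/(_ n t (TL _ Tt)) ->]; last exact: span_0.
  by apply: span_in; exists [~ t, c i] => //; exists t, i.
Qed.

Lemma gr2_span v : lspan (tau 1 @` [set x | exists i j, x = [~ c i, c j]]) v.
Proof.
apply: lspan_ind (tau_span v) => _ [x Lx <-].
apply: lspan_ind (tau_lcs_span Lx) => _ [[a b] /= La <-].
apply: (additive_gen_span (f := fun b => tau 1 [~ a, b])) (Hgen b).
  by move=> y z; apply: tauRr.
move=> y [[j _ <-]|/(_ 0%N a Logic.I) ->]; last exact: span_0.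
apply: (additive_gen_span (f := fun a => tau 1 [~ a, c j])) (Hgen a).
  by move=> u z; apply: tauRl.
move=> u [[i _ <-]|uc]; first by apply: span_in; exists [~ c i, c j] => //; exists i, j.
rewrite -invgR tauV; last exact: (@lcsR _ 0).
by rewrite (uc 0%N (c j) Logic.I) oppr0; apply: span_0.
Qed.

Definition cfold a (s : seq I) := foldl (fun x l => [~ x, c l]) a s.

Lemma lcs_cfold n a s : L n a -> L (size s + n)%N (cfold a s).
Proof.
by elim: s n a => [//|l s IH] n a La; have := IH _ _ (lcsR (c l) La); rewrite -addSnnS.
Qed.

Lemma gr_span_cfold m v : lspan
  (tau m.+1 @` [set x | exists i j s, size s = m /\ x = cfold [~ c i, c j] s]) v.
Proof.
elim: m v => [|m IH] v.
  apply: lspan_ind (gr2_span v) => _ [_ [i [j ->]] <-]; apply: span_in.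
  by exists [~ c i, c j] => //; exists i, j, [::].
have TL t : (exists i j s, size s = m /\ t = cfold [~ c i, c j] s) -> L m.+1 t.
  move=> [i [j [s [sm ->]]]]; rewrite -addn1 -sm; apply: lcs_cfold.
  exact: (@lcsR _ 0).
apply: lspan_ind (gr_span_step IH TL v) => _ [_ [t [l [[i [j [s [sm ->]]]] ->]]] <-].
apply: span_in; exists [~ cfold [~ c i, c j] s, c l] => //.
by exists i, j, (rcons s l); rewrite size_rcons sm /cfold foldl_rcons.
Qed.
End GrBracket.

Lemma foldl_perm (A : Type) (T : choiceType) (f : A -> T -> A) (Q : A -> Prop) :
  (forall a x, Q a -> Q (f a x)) ->
  (forall a x y, Q a -> f (f a x) y = f (f a y) x) ->
  forall s s' a, Q a -> perm_eq s s' -> foldl f a s = foldl f a s'.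
Proof.
move=> Qf fC.
have front x s2 s1 a : Q a -> foldl f a (s1 ++ x :: s2) = foldl f (f a x) (s1 ++ s2).
  elim: s1 a => [//|y s1 IH] a Qa /=; rewrite IH; last exact: Qf.
  by rewrite fC.
elim=> [|x s IH] s' a Qa ps; first by case: s' ps => // y s' /perm_size.
have xs' : x \in s' by rewrite -(perm_mem ps) mem_head.
have [s1 [s2 E]] : exists s1 s2, s' = s1 ++ x :: s2.
  by case/splitPr: xs' => s1 s2; exists s1, s2.
move: ps; rewrite E => ps; rewrite front //=; apply: IH; first exact: Qf.
by rewrite -(perm_cons x); apply: perm_trans ps _; rewrite perm_catC /= perm_cons perm_catC.
Qed.

Section Metabelian.
Local Open Scope group_scope.
Variable H : groupType.
Local Notation L := (@lower_central_rec H).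
Hypothesis Hmet : forall a b, L 1 a -> L 1 b -> commute a b.

Lemma lcs1R x y : L 1 [~ x, y].
Proof. exact: (@lcsR _ 0). Qed.

Lemma metabRMl a a' w : L 1 a -> L 1 a' -> [~ a * a', w] = [~ a, w] * [~ a', w].
Proof.
move=> La La'; rewrite commMgE.
by have /commgP/eqP -> := Hmet (lcs1R a w) La'; rewrite mulg1.
Qed.

Lemma metabRVl a w : L 1 a -> [~ a^-1, w] = [~ a, w]^-1.
Proof.
move=> La; symmetry; apply: mulg1_eq.
by rewrite -metabRMl // ?mulgV ?comm1g //; apply: lcsV.
Qed.

Lemma metabRr a b : L 1 a -> L 1 b -> [~ a, b] = 1.
Proof. by move=> La Lb; apply/eqP/commgP/Hmet. Qed.

Lemma metabRMr a b w : L 1 a -> L 1 b -> [~ a, w * b] = [~ a, w].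
Proof.
move=> La Lb; rewrite commgME (metabRr La Lb) mul1g (metabRr (lcs1R _ _) Lb).
exact: mulg1.
Qed.

Lemma metabRC a x y : L 1 a -> [~ [~ a, x], y] = [~ [~ a, y], x].
Proof.
move=> La; have E : [~ a, x * y] = [~ a, y * x].
  by rewrite [x * y]commgC metabRMr //; apply: lcs1R.
rewrite (commgME a x y) (commgME a y x) in E.
apply: (mulgI [~ a, x]); apply: (mulgI [~ a, y]).
by rewrite E [RHS]mulgA (Hmet (lcs1R a y) (lcs1R a x)); apply: mulgA.
Qed.

Lemma metab_jacobi (x y z : H) :
  [~ [~ x, y], z] * [~ [~ y, z], x] * [~ [~ z, x], y] = 1.
Proof.
have HW : [~ [~ x, y^-1], z] ^ y * [~ [~ y, z^-1], x] ^ z * [~ [~ z, x^-1], y] ^ x = 1.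
  by rewrite /commg /conjg !gnorm.
have step (u v w : H) : [~ [~ u, v^-1], w] ^ v = [~ [~ u, v], w]^-1.
  have -> : [~ u, v^-1] = ([~ u, v]^-1) ^ v^-1 by rewrite /commg /conjg !gnorm.
  rewrite conjRg conjgKV metabRVl; last exact: lcs1R.
  have -> : w ^ v = w * [~ w, v] by rewrite /commg mulVKg.
  by rewrite metabRMr //; apply: lcs1R.
have {}HW : [~ [~ z, x], y] * ([~ [~ y, z], x] * [~ [~ x, y], z]) = 1.
  by apply: invg_inj; rewrite invg1 2!invgM -!step.
rewrite (Hmet (lcs1R [~ x, y] z) (lcs1R [~ y, z] x)) -[RHS]HW.
by apply: Hmet; [apply: lcsM|]; apply: lcs1R.
Qed.

Variables (n : nat) (c : 'I_n -> H).

Lemma cfold1 s : cfold c 1 s = 1.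
Proof. by elim: s => [//|l s IH]; rewrite /= comm1g. Qed.

Lemma cfoldM a b s : L 1 a -> L 1 b -> cfold c (a * b) s = cfold c a s * cfold c b s.
Proof.
elim: s a b => [//|l s IH] a b La Lb; rewrite /= metabRMl // IH //; exact: lcs1R.
Qed.

Lemma cfoldV a s : L 1 a -> cfold c a^-1 s = (cfold c a s)^-1.
Proof.
move=> La; symmetry; apply: mulg1_eq.
by rewrite -cfoldM ?mulgV ?cfold1 //; apply: lcsV.
Qed.

Lemma cfoldX a s k : L 1 a -> cfold c (a ^+ k) s = cfold c a s ^+ k.
Proof.
move=> La; elim: k => [|k IH]; first by rewrite !expg0 cfold1.
by rewrite !expgS cfoldM ?IH //; apply: lcsX.
Qed.

Lemma cfold_prod (J : Type) (r : seq J) (F : J -> H) s : (forall j, L 1 (F j)) ->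
  cfold c (\prod_(j <- r) F j) s = \prod_(j <- r) cfold c (F j) s.
Proof.
move=> LF; elim: r => [|j r IH]; first by rewrite !big_nil cfold1.
by rewrite !big_cons cfoldM ?IH //; apply: lcs_prod.
Qed.

Definition grB m i j s : gr H m.+2 := tau m.+1 (cfold c [~ c i, c j] s).

Lemma lcs_cfoldR m i j s : size s = m -> L m.+1 (cfold c [~ c i, c j] s).
Proof. by move=> sm; rewrite -addn1 -sm; apply/lcs_cfold/lcs1R. Qed.

Lemma grB_alt m i j s : size s = m -> grB m i j s = (- grB m j i s)%R.
Proof.
move=> sm; rewrite /grB -invgR cfoldV; last exact: lcs1R.
by rewrite tauV //; apply: lcs_cfoldR.
Qed.

Lemma grB_perm m i j s s' : size s = m -> perm_eq s s' -> grB m i j s = grB m i j s'.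
Proof.
move=> _ ps; congr (tau _ _).
apply: (@foldl_perm _ _ _ (L 1)) ps => [a x La|a x y La|]; try exact: lcs1R.
exact: metabRC.
Qed.

Lemma grB_jacobi m i j l s : (size s).+1 = m ->
  (grB m i j (l :: s) + grB m j l (i :: s) + grB m l i (j :: s) = 0)%R.
Proof.
move=> sm; have LC u v w : L m.+1 (cfold c [~ [~ c u, c v], c w] s).
  by rewrite -sm -addn2; apply/lcs_cfold/lcsR/lcs1R.
rewrite /grB /= -!tauM //; last by apply: lcsM.
rewrite -!cfoldM; try by [apply: lcs1R | apply: lcsM; apply: lcs1R].
by rewrite metab_jacobi cfold1 tau1.
Qed.

Hypothesis Hgen : forall x, gen (range c `|` @gr_central H) x.

Lemma gr_span_basic m v : lspan (range (@basic_val _ m pred0 _ (grB m))) v.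
Proof.
apply: lspan_ind (gr_span_cfold Hgen v) => _ [_ [i [j [s [sm ->]]]] <-].
apply: (span_basic (B := grB m)) => //.
- exact: grB_alt.
- exact: grB_perm.
- exact: grB_jacobi.
Qed.
End Metabelian.

Lemma gr_span_surface g (H : groupType) (c : 'I_(g + g) -> H) m v :
  (forall a b : H, lower_central_rec 1 a -> lower_central_rec 1 b -> commute a b) ->
  (forall x, gen (range c `|` @gr_central H) x) ->
  (forall s, size s = m ->
     tau m.+1 (cfold c (\prod_(a < g) [~ c (sx a), c (sy a)])%g s) = 0) ->
  lspan (range (@basic_val _ m (@sbad g) _ (grB c m))) v.
Proof.
move=> Hmet Hgen rel.
apply: lspan_ind (gr_span_cfold Hgen v) => _ [_ [i [j [s [sm ->]]]] <-].
apply: (span_basic_surface (B := grB c m)) => //.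
- exact: grB_alt.
- exact: grB_perm.
- exact: grB_jacobi.
- move=> t tm; rewrite -[RHS](rel t tm) (cfold_prod Hmet); last by move=> a; apply: lcs1R.
  by rewrite tau_prod // => a _; apply: lcs_cfoldR.
Qed.

(** * The Magnus representation *)

Definition fps (R : comNzRingType) := nat -> R.

Section Fps.
Variable R : comNzRingType.
Implicit Types f g h : fps R.

HB.instance Definition _ := GRing.Zmodule.copy (fps R) (nat -> R).

Definition fps_mul f g : fps R := fun n => \sum_(i < n.+1) f i * g (n - i)%N.
Definition fps_one : fps R := fun n => (n == 0)%:R.

Local Notation trunc N f := (\poly_(i < N.+1) f i).

Lemma fps_mulE N f g n : (n <= N)%N -> fps_mul f g n = (trunc N f * trunc N g)`_n.
Proof.
move=> nN; rewrite coefM; apply: eq_bigr => i _; rewrite !coef_poly.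
have iN : (i < N.+1)%N by apply: leq_trans (ltn_ord i) _.
by rewrite iN ltnS (leq_trans (leq_subr _ _) nN).
Qed.

Fact fps_mulC : commutative fps_mul.
Proof. by move=> f g; apply/funext => n; rewrite !(@fps_mulE n) // mulrC. Qed.

Lemma fps_mul_trunc f g h n :
  fps_mul f (fps_mul g h) n = (trunc n f * (trunc n g * trunc n h))`_n.
Proof.
rewrite (@fps_mulE n) // coefM [RHS]coefM; apply: eq_bigr => i _; congr (_ * _).
by rewrite coef_poly ltnS leq_subr (@fps_mulE n) // leq_subr.
Qed.

Fact fps_mulA : associative fps_mul.
Proof.
move=> f g h; apply/funext => n; rewrite [RHS](congr1 (fun f => f n) (fps_mulC _ h)).
by rewrite !fps_mul_trunc mulrA mulrC.
Qed.

Fact fps_mul1 : left_id fps_one fps_mul.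
Proof.
move=> f; apply/funext => n; rewrite /fps_mul big_ord_recl mul1r subn0 big1 ?addr0 //.
by move=> i _; rewrite /fps_one /= mul0r.
Qed.

Fact fps_mulDl : left_distributive fps_mul +%R.
Proof.
move=> f g h; apply/funext => n; rewrite [RHS]/GRing.add /= /fps_mul -big_split /=.
by apply: eq_bigr => i _; rewrite -mulrDl.
Qed.

Fact fps_one_neq0 : fps_one != 0.
Proof.
apply/eqP => /(congr1 (fun f => f 0%N)) /eqP; rewrite /fps_one /=.
by rewrite oner_eq0.
Qed.

HB.instance Definition _ := GRing.Zmodule_isComNzRing.Build (fps R)
  fps_mulA fps_mulC fps_mul1 fps_mulDl fps_one_neq0.

Lemma fps_coefME f g n : (f * g) n = \sum_(i < n.+1) f i * g (n - i)%N.
Proof. by []. Qed.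
Lemma fps_coefD f g n : (f + g) n = f n + g n. Proof. by []. Qed.
Lemma fps_coefN f n : (- f) n = - f n. Proof. by []. Qed.
Lemma fps_coef1 n : (1 : fps R) n = (n == 0)%:R. Proof. by []. Qed.
Lemma fps_coef_bool (b : bool) n : (b%:R : fps R) n = (b && (n == 0))%:R.
Proof. by case: b. Qed.

Definition fps_ord k f := forall j, (j < k)%N -> f j = 0.

Lemma fps_coefM i j f g : fps_ord i f -> fps_ord j g -> (f * g) (i + j)%N = f i * g j.
Proof.
move=> fi gj; rewrite fps_coefME.
have lt : (i < (i + j).+1)%N by rewrite ltnS leq_addr.
rewrite (bigD1 (Ordinal lt)) //= addKn big1 ?addr0 // => k /eqP ki.
have [lk|lk|E] := ltngtP k i.
- by rewrite fi ?mul0r.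
- by rewrite gj ?mulr0 //; move: (ltn_ord k); lia.
- by case: ki; apply: val_inj.
Qed.

Lemma fps_ordM i j f g : fps_ord i f -> fps_ord j g -> fps_ord (i + j) (f * g).
Proof.
move=> fi gj k kij; rewrite fps_coefME big1 // => l _.
have [lk|lk] := ltnP l i; first by rewrite fi ?mul0r.
by rewrite gj ?mulr0 //; move: (ltn_ord l); lia.
Qed.

Lemma fps_coefM0 k f g : fps_ord k g -> (f * g) k = f 0%N * g k.
Proof. by apply: (@fps_coefM 0). Qed.
Lemma fps_coefM1 k f g : fps_ord 1 f -> fps_ord k g -> (f * g) k.+1 = f 1%N * g k.
Proof. exact: (@fps_coefM 1). Qed.

Lemma fps_coef0 f g : (f * g) 0%N = f 0%N * g 0%N.
Proof. exact: (@fps_coefM 0 0). Qed.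

Lemma fps_ord1 f : f 0%N = 0 -> fps_ord 1 f.
Proof. by move=> f0 [|j]. Qed.

Definition fps_lin (x : R) : fps R := fun k => if k is k'.+1 then (k' == 0)%:R * x else 1.
Definition fps_geom (x : R) : fps R := fun k => (- x) ^+ k.

Lemma fps_lin_geom x : fps_lin x * fps_geom x = 1.
Proof.
apply/funext => -[|n]; rewrite fps_coefME big_ord_recl /=.
  by rewrite big_ord0 addr0 mul1r /fps_geom expr0.
rewrite big_ord_recl /= big1 ?addr0 => [|i _]; last by rewrite mul0r mul0r.
by rewrite !mul1r subn0 subSS subn0 /fps_geom exprS mulNr addNr.
Qed.

End Fps.

(* Pairs (u, v) acting on S^n by m |-> u m + v, for S the power series ring;  *)
(* u is stored together with its inverse and has constant term 1.             *)
Section Aff.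
Variables (R : comNzRingType) (n : nat).
Local Notation S := (fps R).

Definition aff_pred (p : S * S * ('I_n -> S)) :=
  [&& p.1.1 * p.1.2 == 1, p.1.1 0%N == 1 & p.1.2 0%N == 1].
Definition aff := {p | aff_pred p}.
HB.instance Definition _ := SubChoice.on aff.
Implicit Types a b : aff.

Definition au a : S := (val a).1.1.
Definition aw a : S := (val a).1.2.
Definition av a : 'I_n -> S := (val a).2.

Lemma auw a : au a * aw a = 1.
Proof. by have /and3P[/eqP] := valP a. Qed.
Lemma au0 a : au a 0%N = 1.
Proof. by have /and3P[_ /eqP] := valP a. Qed.
Lemma aw0 a : aw a 0%N = 1.
Proof. by have /and3P[_ _ /eqP] := valP a. Qed.

Lemma aff_eq a b : au a = au b -> aw a = aw b -> av a = av b -> a = b.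
Proof.
rewrite /au /aw /av => E1 E2 E3; apply: val_inj.
by move: E1 E2 E3; case: (val a) => -[? ?] ?; case: (val b) => -[? ?] ? /= -> -> ->.
Qed.

Fact aff_mul_subproof a b :
  aff_pred (au a * au b, aw a * aw b, fun q => av a q + au a * av b q).
Proof.
by rewrite /aff_pred /= mulrACA !auw mulr1 !fps_coef0 !au0 !aw0 mulr1 !eqxx.
Qed.
Definition aff_mul a b : aff := exist aff_pred _ (aff_mul_subproof a b).

Fact aff_inv_subproof a : aff_pred (aw a, au a, fun q => - (aw a * av a q)).
Proof. by rewrite /aff_pred /= mulrC auw au0 aw0 !eqxx. Qed.
Definition aff_inv a : aff := exist aff_pred _ (aff_inv_subproof a).

Fact aff_tr_subproof (v : 'I_n -> S) : aff_pred (1, 1, v).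
Proof. by rewrite /aff_pred /= mulr1 !eqxx. Qed.
Definition aff_tr v : aff := exist aff_pred _ (aff_tr_subproof v).

Fact aff_gen_subproof x (i : 'I_n) :
  aff_pred (fps_lin x, fps_geom x, fun q => (q == i)%:R).
Proof. by rewrite /aff_pred /= fps_lin_geom /fps_geom expr0 !eqxx. Qed.
Definition aff_gen x i : aff := exist aff_pred _ (aff_gen_subproof x i).

Fact aff_mulA : associative aff_mul.
Proof.
move=> a b c; apply: aff_eq; rewrite /au /aw /av /= ?mulrA //.
by apply/funext => q; rewrite mulrDr mulrA addrA.
Qed.
Fact aff_mul1 : left_id (aff_tr 0) aff_mul.
Proof.
move=> a; apply: aff_eq; rewrite /au /aw /av /= ?mul1r //.
by apply/funext => q; rewrite mul1r add0r.
Qed.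
Fact aff_mulr1 : right_id (aff_tr 0) aff_mul.
Proof.
move=> a; apply: aff_eq; rewrite /au /aw /av /= ?mulr1 //.
by apply/funext => q; rewrite mulr0 addr0.
Qed.
Fact aff_mulV : left_inverse (aff_tr 0) aff_inv aff_mul.
Proof.
move=> a; apply: aff_eq; rewrite /au /aw /av /=; rewrite ?[_.1.2 * _.1.1]mulrC ?auw //.
by apply/funext => q; rewrite addNr.
Qed.
Fact aff_mulrV : right_inverse (aff_tr 0) aff_inv aff_mul.
Proof.
move=> a; apply: aff_eq; rewrite /au /aw /av /=; rewrite ?[_.1.2 * _.1.1]mulrC ?auw //.
apply/funext => q; rewrite mulrN mulrA.
by rewrite -/(au a) -/(aw a) auw mul1r subrr.
Qed.
HB.instance Definition _ := isGroup.Build aff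
  aff_mulA aff_mul1 aff_mulr1 aff_mulV aff_mulrV.

Lemma auM a b : au (a * b)%g = au a * au b. Proof. by []. Qed.
Lemma avM a b q : av (a * b)%g q = av a q + au a * av b q. Proof. by []. Qed.

Lemma aff_trD v v' : (aff_tr v * aff_tr v')%g = aff_tr (fun q => v q + v' q).
Proof.
apply: aff_eq; rewrite /au /aw /av /= ?mulr1 //.
by apply/funext => q; rewrite mul1r.
Qed.

Lemma aff_trV v : (aff_tr v)^-1%g = aff_tr (fun q => - v q).
Proof. by apply: aff_eq => //; apply/funext => q; rewrite /av /= mul1r. Qed.

Lemma aff_trJ v b : (aff_tr v ^ b)%g = aff_tr (fun q => aw b * v q).
Proof.
apply: (mulgI b); rewrite /conjg mulVKg; apply: aff_eq.
- by rewrite !auM mul1r mulr1.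
- by rewrite /aw /= mul1r mulr1.
- apply/funext => q; rewrite !avM /av /= mul1r mulrA auw mul1r.
  exact: addrC.
Qed.

Lemma aff_commg a b : [~ a, b]%g = aff_tr (fun q =>
  aw a * aw b * ((au a - 1) * av b q - (au b - 1) * av a q)).
Proof.
apply: (mulgI (b * a)%g); rewrite -commgC; apply: aff_eq.
- by rewrite !auM mulr1 mulrC.
- by rewrite /aw /= mulr1 mulrC.
- apply/funext => q; rewrite !avM auM /av /= -/(av a) -/(av b).
  have -> : au b * au a * (aw a * aw b * ((au a - 1) * av b q - (au b - 1) * av a q)) =
    (au a * aw a) * (au b * aw b) * ((au a - 1) * av b q - (au b - 1) * av a q) by ring.
  by rewrite !auw; ring.
Qed.

Lemma aff_metab a b c d : [~ [~ a, b], [~ c, d]]%g = 1%g.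
Proof.
rewrite !aff_commg; apply: aff_eq => //; apply/funext => q.
by rewrite /av /au /= !subrr !mul0r subrr mulr0.
Qed.

Definition alead k a (q : 'I_n -> R) := exists v,
  [/\ forall i, fps_ord k (v i), a = aff_tr v & forall i, q i = v i k].

Lemma aleadM k a b q q' : alead k a q -> alead k b q' -> alead k (a * b)%g (q + q').
Proof.
move=> [v [ov -> qv]] [v' [ov' -> qv']]; rewrite aff_trD; exists (fun q => v q + v' q); split=> //.
- by move=> i j jk; rewrite fps_coefD ov ?ov' ?addr0.
- by move=> i; rewrite fps_coefD -qv -qv'.
Qed.

Lemma aleadV k a q : alead k a q -> alead k a^-1%g (- q).
Proof.
move=> [v [ov -> qv]]; rewrite aff_trV; exists (fun q => - v q); split=> //.
- by move=> i j jk; rewrite fps_coefN ov ?oppr0.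
- by move=> i; rewrite fps_coefN -qv.
Qed.

Lemma alead1 k : alead k 1%g 0.
Proof. by exists 0. Qed.

Lemma aleadS k a q : alead k.+1 a q -> alead k a 0.
Proof.
move=> [v [ov -> qv]]; exists v; split=> // i; last by rewrite ov.
by move=> j jk; apply: ov; apply: ltnW.
Qed.

Lemma fps_ordB1 (u : S) : u 0%N = 1 -> fps_ord 1 (u - 1).
Proof. by move=> u0; apply: fps_ord1; rewrite fps_coefD u0 fps_coefN subrr. Qed.

Lemma fps_coefB1 (u : S) : (u - 1) 1%N = u 1%N.
Proof. by rewrite fps_coefD fps_coefN fps_coef1 subr0. Qed.

Lemma alead_comm a b :
  alead 1 [~ a, b]%g (fun q => au a 1%N * av b q 0%N - au b 1%N * av a q 0%N).
Proof.
rewrite aff_commg; eexists; split; [|by []|].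
- move=> q; apply: (@fps_ordM _ 0 1) => // j j1.
  rewrite fps_coefD fps_coefN.
  by rewrite !(@fps_ordM _ 1 0) ?subr0 //; apply/fps_ordB1/au0.
- move=> q; cbv beta; rewrite fps_coefM0; last first.
    move=> j j1; rewrite fps_coefD fps_coefN.
    by rewrite !(@fps_ordM _ 1 0) ?subr0 //; apply/fps_ordB1/au0.
  rewrite fps_coef0 !aw0 !mul1r fps_coefD fps_coefN.
  by rewrite !fps_coefM1 ?fps_coefB1 //; apply/fps_ordB1/au0.
Qed.

Lemma aleadR k a b q : alead k a q ->
  alead k.+1 [~ a, b]%g (fun i => - (au b 1%N * q i)).
Proof.
move=> [v [ov -> qv]]; rewrite aff_commg; eexists; split; [|by []|].
- move=> i; rewrite /aw /au /av /= subrr mul0r sub0r mul1r.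
  apply: (@fps_ordM _ 0 k.+1) => // j jk; rewrite fps_coefN.
  by rewrite (@fps_ordM _ 1 k) ?oppr0 // => l l1; apply: fps_ordB1 => //; apply: au0.
- move=> i; rewrite /aw /au /av /= subrr mul0r sub0r mul1r.
  cbv beta; rewrite fps_coefM0; last first.
    move=> j jk; rewrite fps_coefN.
    by rewrite (@fps_ordM _ 1 k) ?oppr0 // => l l1; apply: fps_ordB1 => //; apply: au0.
  rewrite -/(aw b) aw0 mul1r fps_coefN qv.
  by rewrite fps_coefM1 ?fps_coefB1 // => l l1; apply: fps_ordB1 => //; apply: au0.
Qed.
End Aff.

Section MetabelianQuotient.
Local Open Scope group_scope.

Lemma lcs1_commute (K : groupType) :
  (forall a b c d : K, [~ [~ a, b], [~ c, d]] = 1) ->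
  forall a b : K, lower_central_rec 1 a -> lower_central_rec 1 b -> commute a b.
Proof.
move=> K0 a b La; elim=> [_ [c [d [_ _ ->]]]||u v _ Cu _ Cv|u _ Cu].
- elim: La => [_ [e [f [_ _ ->]]]||u v _ Cu _ Cv|u _ Cu].
  + by apply/commgP/eqP.
  + exact/commute_sym/commute1.
  + by apply/commute_sym/commuteM; apply: commute_sym.
  + exact/commute_sym/commuteV/commute_sym.
- exact: commute1.
- exact: commuteM.
- exact: commuteV.
Qed.

Lemma derived2_ker (G K : groupType) (f : G -> K) :
  {morph f : x y / x * y} ->
  (forall a b : K, lower_central_rec 1 a -> lower_central_rec 1 b -> commute a b) ->
  forall x, derived2 x -> f x = 1.
Proof.
move=> fM KM x; apply: (hom_gen1 fM) => _ [a [b [La Lb ->]]].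
rewrite (homR fM); apply/eqP/commgP/KM; exact: (@lcs_hom _ _ _ 1).
Qed.

Definition metab (G : groupType) : groupType := qgrp (@derived2 G).

Lemma lcs1_qpi (G : groupType) (S : set G) (a : qgrp S) :
  lower_central_rec 1 a -> exists2 a', lower_central_rec 1 a' & a = qpi S a'.
Proof.
elim=> [_ [c [d [_ _ ->]]]||_ _ _ [u' Lu ->] _ [v' Lv ->]|_ _ [u' Lu ->]].
- exists [~ repr c, repr d]; first exact: (@lcsR _ 0).
  by rewrite (homR (@qpiM _ _)) !qpiK.
- by exists 1 => //; apply: lcs1.
- by exists (u' * v'); [apply: lcsM | rewrite qpiM].
- by exists u'^-1; [apply: lcsV | rewrite (homV (@qpiM _ _))].
Qed.

Lemma metab_commute (G : groupType) (a b : metab G) :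
  lower_central_rec 1 a -> lower_central_rec 1 b -> commute a b.
Proof.
move=> /lcs1_qpi [a' La ->] /lcs1_qpi [b' Lb ->]; apply/commgP/eqP.
rewrite -(homR (@qpiM _ _)); apply: qpi_eq1; apply: gen_in.
by exists a', b'.
Qed.
End MetabelianQuotient.

Definition lineq n (R : comAlgType rat) (w : 'I_n -> R) : set ('I_n -> R) :=
  [set v | exists r, v = fun i => r * w i].

Lemma lspan_lineq n (R : comAlgType rat) (w v : 'I_n -> R) :
  lspan (lineq w) v -> lineq w v.
Proof.
elim=> [//||_ _ _ [r ->] _ [r' ->]|c _ _ [r ->]].
- by exists 0; apply/funext => i; rewrite mul0r.
- by exists (r + r'); apply/funext => i; rewrite mulrDl.
- by exists (c *: r); apply/funext => i; rewrite -scalerAl.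
Qed.

Section Magnus.
Variables (n : nat) (R : comAlgType rat) (X : 'I_n -> R).
Variables (r : 'I_n -> fps R) (w : 'I_n -> R).
Hypothesis r_lead : forall (s : fps R) k, (forall i, fps_ord k (s * r i)) ->
  exists z, forall i, (s * r i) k = z * w i.

Definition aff_rels : set (aff R n) := [set a | exists s, a = aff_tr (fun i => s * r i)].
Definition magnus : groupType := qgrp aff_rels.

Lemma aff_rels_nclosure a : nclosure aff_rels a -> aff_rels a.
Proof.
elim=> [_ [_ [b [[s ->] ->]]]||_ _ _ [s ->] _ [s' ->]|_ _ [s ->]].
- exists (aw b * s); rewrite aff_trJ; congr aff_tr; apply/funext => q.
  by rewrite mulrA.
- by exists 0; congr aff_tr; apply/funext => q; rewrite mul0r.
- by exists (s + s'); rewrite aff_trD; congr aff_tr; apply/funext => q; rewrite mulrDl.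
- by exists (- s); rewrite aff_trV; congr aff_tr; apply/funext => q; rewrite mulNr.
Qed.

Lemma magnus_commute (a b : magnus) :
  lower_central_rec 1 a -> lower_central_rec 1 b -> commute a b.
Proof.
apply: lcs1_commute => {}a {}b c d; rewrite -[a]qpiK -[b]qpiK -[c]qpiK -[d]qpiK.
have E x y : [~ qpi aff_rels x, qpi aff_rels y]%g = qpi aff_rels [~ x, y]%g.
  by rewrite (homR (@qpiM _ _)).
by rewrite (E (repr a) (repr b)) (E (repr c) (repr d)) E aff_metab.
Qed.

Lemma magnus_eq (a b : aff R n) : qpi aff_rels a = qpi aff_rels b ->
  exists s, (a^-1 * b)%g = aff_tr (fun i => s * r i).
Proof. by move/qgrpP/aff_rels_nclosure. Qed.

Definition mlead k (y : magnus) q := exists2 a, alead k a q & y = qpi aff_rels a.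

Lemma mlead_uniq k y q q' : mlead k y q -> mlead k y q' -> lineq w (q - q').
Proof.
move=> [a Aa ->] [b Ab /magnus_eq [s E]].
have := aleadM (aleadV Aa) Ab; rewrite E => -[v [ov vE qE]].
have {}vE : v = fun i => s * r i by rewrite -[v]/(av (aff_tr v)) -vE.
have [z zE] : exists z, forall i, (s * r i) k = z * w i.
  by apply: r_lead => i; have := ov i; rewrite vE.
exists (- z); apply/funext => i; have := qE i; rewrite vE zE mulNr => <-.
have D (t u : R) : t - u = - (- t + u) by rewrite opprD opprK.
exact: D.
Qed.

Lemma mleadM k y y' q q' : mlead k y q -> mlead k y' q' -> mlead k (y * y')%g (q + q').
Proof.
move=> [a Aa ->] [b Ab ->]; rewrite -qpiM; exists (a * b)%g => //.
exact: aleadM.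
Qed.

Lemma mlead_lcs k y : lower_central_rec k.+1 y -> exists q, mlead k.+1 y q.
Proof.
elim: k y => [|k IH] y.
all: elim=> [_ [c [d [Lc _ ->]]]||u v _ [q [a Aa ->]] _ [q' [b Ab ->]]|u _ [q [a Aa ->]]].
2,6: by exists 0, 1%g => //; apply: alead1.
2,5: by exists (q + q'), (a * b)%g; [apply: aleadM | rewrite qpiM].
2,4: by exists (- q), a^-1%g; [apply: aleadV | rewrite (homV (@qpiM _ _))].
- rewrite -[c]qpiK -[d]qpiK -(homR (@qpiM _ _)); eexists; eexists=> //.
  exact: alead_comm.
- have [q [a Aa ->]] := IH _ Lc; rewrite -[d]qpiK -(homR (@qpiM _ _)).
  by eexists; eexists=> //; apply: aleadR Aa.
Qed.

Variables (H : groupType) (c : 'I_n -> H) (f : H -> magnus).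
Hypothesis fM : {morph f : x y / (x * y)%g}.
Hypothesis fc : forall i, f (c i) = qpi _ (aff_gen (X i) i).

Lemma mlead_cfold i j s :
  mlead (size s).+1 (f (cfold c [~ c i, c j]%g s)) (kvec X i j s).
Proof.
elim/last_ind: s => [|s l [a Aa aE]].
  rewrite /= (homR fM) !fc -(homR (@qpiM _ _)); eexists=> //.
  have := alead_comm (aff_gen (X i) i) (aff_gen (X j) j); congr alead.
  apply/funext => q; rewrite /kvec big_nil expr0 !mul1r /au /av /= !mul1r.
  by rewrite !fps_coef_bool !andbT !mulr_natr.
rewrite size_rcons /cfold foldl_rcons (homR fM) [f (foldl _ _ _)]aE fc.
rewrite -(homR (@qpiM _ _)); eexists=> //.
have := aleadR (aff_gen (X l) l) Aa; congr alead; apply/funext => q.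
by rewrite kvec_rcons /au /= mul1r.
Qed.

Lemma magnus_functional m : exists2 g : gr H m.+2 -> lquot (lineq w), linear g &
  forall i j s, size s = m -> g (grB c m i j s) = lpi (lineq w) (kvec X i j s).
Proof.
pose F x : lquot (lineq w) := lpi _ (xget 0 [set q | mlead m.+1 (f x) q]).
have FE x q : mlead m.+1 (f x) q -> F x = lpi _ q.
  move=> Aq; apply/lquotP/span_in.
  by apply: mlead_uniq (Aq); apply: xgetPex; exists q.
have [g gL gE] : exists2 g : gr H m.+2 -> lquot (lineq w), linear g &
    forall x, lower_central_rec m.+1 x -> g (tau m.+1 x) = F x.
  apply: tau_univ => [x y Lx Ly|x Lx].
    have [q Aq] := mlead_lcs (lcs_hom fM Lx); have [q' Aq'] := mlead_lcs (lcs_hom fM Ly).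
    by rewrite (FE _ _ Aq) (FE _ _ Aq') (FE _ (q + q')) ?lpiD // fM; apply: mleadM.
  have [q [a Aa aE]] := mlead_lcs (lcs_hom fM Lx).
  rewrite (FE _ 0) ?[LHS](linear0 (lpi _)) //.
  by exists a => //; apply: aleadS Aa.
exists g => // i j s sm; rewrite gE; last exact: lcs_cfoldR.
by apply: FE; rewrite -sm; apply: mlead_cfold.
Qed.

Lemma magnus_functional1 : exists2 g : gr H 1 -> R, linear g &
  forall i, g (tau 0 (c i)) = X i.
Proof.
pose F (y : magnus) : R := au (repr y) 1%N.
have FE a : F (qpi _ a) = au a 1%N.
  have [s E] : exists s, ((repr (qpi aff_rels a))^-1 * a)%g = aff_tr (fun i => s * r i).
    by apply: magnus_eq; rewrite qpiK.
  rewrite -[a in RHS](mulVKg (repr (qpi aff_rels a))) E auM.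
  by rewrite [au (aff_tr _)]/(1 : fps R) mulr1.
have FM x y : F (x * y)%g = F x + F y.
  rewrite -[x]qpiK -[y]qpiK -qpiM !FE auM fps_coefME big_ord_recl big_ord1 /=.
  by rewrite subn0 subnn !au0 mul1r mulr1 addrC.
have F1 : F 1%g = 0 by apply: (@addIr _ (F 1%g)); rewrite -FM mulg1 add0r.
have FV x : F x^-1%g = - F x by apply/eqP; rewrite -addr_eq0 -FM mulVg F1.
have [g gL gE] : exists2 g : gr H 1 -> R, linear g &
    forall x, lower_central_rec 0 x -> g (tau 0 x) = F (f x).
  apply: tau_univ => [x y _ _|x]; first by rewrite fM FM.
  elim=> [_ [a [b [_ _ ->]]]||u v _ Fu _ Fv|u _ Fu].
  - by rewrite (homR fM) /commg /conjg !(FM, FV) addrA -opprD addNr.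
  - by rewrite (hom1 fM).
  - by rewrite fM FM Fu Fv addr0.
  - by rewrite (homV fM) FV Fu oppr0.
by exists g => // i; rewrite gE // fc FE /au /= mul1r.
Qed.
End Magnus.

Lemma fgen_metab_gen (X : choiceType) (S : set (fgrp X)) (a : metab (qgrp S)) :
  gen (range (fun x => qpi (@derived2 _) (qpi S (fgen x)))) a.
Proof.
have GT (b : qgrp S) := qgrp_gen (S := S) (@fgrp_gen X) b.
apply: gen_sub (qgrp_gen GT a) => _ [_ [_ [x _ <-] <-] <-].
by apply: gen_in; exists x.
Qed.

(** * Chen ranks of free and surface groups *)

Section FreeChen.
Variable n : nat.
Local Notation H := (metab (free_group n)).
Definition free_c (i : 'I_n) : H := qpi (@derived2 _) (fgen i).

Lemma free_c_gen x : gen (range free_c `|` @gr_central H) x.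
Proof.
apply: gen_sub (qgrp_gen (@fgrp_gen 'I_n) x) => _ [_ [i _ <-] <-].
by apply: gen_in; left; exists i.
Qed.

Section Rep.
Variables (R : comAlgType rat) (X : 'I_n -> R).
Let r : 'I_n -> fps R := 0.
Let w : 'I_n -> R := 0.

Lemma free_r_lead (s : fps R) k : (forall i, fps_ord k (s * r i)) ->
  exists z, forall i, (s * r i) k = z * w i.
Proof. by exists 0 => i; rewrite mul0r [r i]/(0 : fps R) mulr0. Qed.

Definition free_rep : H -> magnus r :=
  qgrp_lift (fgrp_lift (fun i => qpi (aff_rels r) (aff_gen (X i) i))).

Let free_rep_ker x (Dx : @derived2 (free_group n) x) := derived2_ker
  (fgrp_liftM (fun i => qpi (aff_rels r) (aff_gen (X i) i))) (@magnus_commute _ _ _) Dx.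

Lemma free_repM : {morph free_rep : x y / (x * y)%g}.
Proof. by move=> x y; apply: (qgrp_liftM (@fgrp_liftM _ _ _) free_rep_ker). Qed.

Lemma free_rep_c i : free_rep (free_c i) = qpi _ (aff_gen (X i) i).
Proof. by rewrite /free_rep /free_c (qgrp_liftE (@fgrp_liftM _ _ _) free_rep_ker) fgrp_liftE. Qed.
End Rep.

Lemma chen_rank_free m :
  chen_rank (free_group n) m.+2 = Some (m.+1 * 'C(n + m, m.+2))%N.
Proof.
rewrite -card_chen_index; apply: (@dimQ_family _ _ (basic_val (grB free_c m))).
  exact: (gr_span_basic (@metab_commute _) free_c_gen).
have P := mpoly_ring n; pose X := @pr_X n P.
have [g gL gE] := magnus_functional (@free_r_lead _) (@free_repM _ X) (@free_rep_c _ X) m.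
apply: (indep_linear gL) => c cE.
apply: (@kvec_indep n m pred0 P c).
have [z ->] : lineq 0 (\sum_p c p *: basic_val (kvec X) p); last first.
  by apply/funext => i; rewrite mulr0.
apply: lspan_lineq; rewrite -[X in lspan _ X]subr0; apply/lquotP.
rewrite linear_sum [RHS](linear0 (lpi _)) -[RHS]cE; apply: eq_bigr => p _.
by rewrite linearZ /= /basic_val gE // size_behead size_tuple.
Qed.

Lemma pr_X_indep (P : poly_ring n) (c : 'I_n -> rat) :
  \sum_i c i *: pr_X P i = 0 -> forall i, c i = 0.
Proof.
move=> E i; have L := pr_coef_linear (p := P) (mon [:: i]).
have C k j : pr_coef k (pr_X P j) = (mon [:: j] == k)%:R by rewrite -(pr_coefX P) big_seq1.
have := congr1 (pr_coef (mon [:: i])) E.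
rewrite (linear_fun_sum _ _ _ L) (linear_fun0 L) (bigD1 i) //= big1 ?addr0 => [|j ji].
  by rewrite (linear_funZ L) C eqxx -[_ *: _]/(_ * _) mulr1.
rewrite (linear_funZ L) C; case: eqP => [E1|]; last by rewrite scaler0.
have := congr1 (fun m : 'X_{1..n} => m i) E1.
by rewrite !monE /= (negbTE ji) eqxx.
Qed.

Lemma chen_rank_free1 : chen_rank (free_group n) 1 = Some n.
Proof.
have -> : Some n = Some #|'I_n| by rewrite card_ord.
apply: (@dimQ_family _ _ (fun i => tau 0 (free_c i))) => [v|].
  apply: lspan_ind (tau_span v) => _ [x _ <-].
  apply: (additive_gen_span (f := tau 0)) (qgrp_gen (@fgrp_gen 'I_n) x) => [y z|].
    exact: (@tauM _ 0).
  by move=> _ [_ [i _ <-] <-]; apply: span_in; exists i.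
have P := mpoly_ring n; pose X := @pr_X n P.
have [g gL gE] := magnus_functional1 (@free_repM _ X) (@free_rep_c _ X).
apply: (indep_linear gL) => c cE; apply: (@pr_X_indep P).
by rewrite -[RHS]cE; apply: eq_bigr => i _; rewrite gE.
Qed.
End FreeChen.

Lemma split_sx g (a : 'I_g) : fintype.split (sx a) = inl a.
Proof. exact: (unsplitK (inl a)). Qed.
Lemma split_sy g (a : 'I_g) : fintype.split (sy a) = inr a.
Proof. exact: (unsplitK (inr a)). Qed.

Section SurfaceChen.
Variable g : nat.
Local Notation Pi := (surface_group g).
Local Notation H := (metab Pi).
Definition surf_gen (i : 'I_(g + g)) : Pi :=
  qpi (@surface_rels g) (fgen (fintype.split i : surface_gen g)).
Definition surf_c (i : 'I_(g + g)) : H := qpi (@derived2 _) (surf_gen i).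

Lemma surf_rel : (\prod_(a < g) [~ surf_gen (sx a), surf_gen (sy a)] = 1)%g.
Proof.
rewrite -[RHS](@qpi_eq1 _ (@surface_rels g) _ (erefl _)) (hom_prod (@qpiM _ _)).
apply: eq_bigr => a _; rewrite (homR (@qpiM _ _)).
by rewrite /surf_gen split_sx split_sy.
Qed.

Lemma surf_c_gen0 x : gen (range surf_c) x.
Proof.
apply: gen_sub (fgen_metab_gen x) => _ [t _ <-]; apply: gen_in.
by exists (unsplit t) => //; rewrite /surf_c /surf_gen unsplitK.
Qed.

Lemma surf_c_gen x : gen (range surf_c `|` @gr_central H) x.
Proof. by apply: gen_sub (surf_c_gen0 x) => y Sy; apply: gen_in; left. Qed.

Lemma surf_c_rel : (\prod_(a < g) [~ surf_c (sx a), surf_c (sy a)] = 1)%g.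
Proof.
rewrite -[RHS](hom1 (@qpiM _ (@derived2 Pi))) -surf_rel (hom_prod (@qpiM _ _)).
by apply: eq_bigr => a _; rewrite (homR (@qpiM _ _)).
Qed.

Lemma surf_magnus (P : poly_ring (g + g)) :
  exists r : 'I_(g + g) -> fps (pr_ring P),
  (forall (s : fps (pr_ring P)) k, (forall i, fps_ord k (s * r i)) ->
    exists z, forall i, (s * r i) k = z * komega (@pr_X _ P) i) /\
  exists f : H -> magnus r, {morph f : x y / (x * y)%g} /\
    forall i, f (surf_c i) = qpi _ (aff_gen (pr_X P i) i).
Proof.
pose X := @pr_X _ P; pose e i := aff_gen (X i) i.
have [r [r_ord rE r1]] : alead 1 (\prod_(a < g) [~ e (sx a), e (sy a)])%g (komega X).
  rewrite /komega; elim/big_ind2: _ => [|x q y q' Ax Ay|a _]; first exact: alead1.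
    exact: aleadM.
  have := alead_comm (e (sx a)) (e (sy a)); congr alead.
  apply/funext => q; rewrite /kvec big_nil expr0 !mul1r /au /av /= !mul1r.
  by rewrite !fps_coef_bool !andbT !mulr_natr.
exists r; split.
  move=> s k ok; have [g0|g0] := posnP g.
    by exists 0 => i; have := ltn_ord i; lia.
  case: k ok => [|k] ok.
    by exists 0 => i; rewrite fps_coef0 r_ord // mulr0 mul0r.
  have os : fps_ord k s.
    suff Q j : (j <= k)%N -> fps_ord j s by apply: Q.
    elim: j => [//|j IH] jk l; rewrite ltnS leq_eqVlt => /orP[/eqP->|lj]; last first.
      exact: IH (ltnW jk) _ lj.
    apply: (@komega_torsion_free g P) => // i; rewrite r1.
    have oj := IH (ltnW jk); have := fps_coefM oj (r_ord i); rewrite addn1 => <-.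
    by apply: ok.
  exists (s k) => i; rewrite r1 -(fps_coefM os (r_ord i)); by rewrite addn1.
pose f0 : fgrp (surface_gen g) -> magnus r :=
  fgrp_lift (fun t : surface_gen g => qpi (aff_rels r) (e (unsplit t))).
have f0M : {morph f0 : x y / (x * y)%g} by apply: fgrp_liftM.
have f0r x : surface_rels x -> f0 x = 1%g.
  move=> ->; transitivity (qpi (aff_rels r) (aff_tr r)); last first.
    by apply: qpi_eq1; exists 1; congr aff_tr; apply/funext => i; rewrite mul1r.
  rewrite -rE (hom_prod (@qpiM _ _)) (hom_prod f0M); apply: eq_bigr => a _.
  by rewrite (homR f0M) (homR (@qpiM _ _)) /f0 !fgrp_liftE.
pose f1 : Pi -> magnus r := qgrp_lift f0.
have f1M : {morph f1 : x y / (x * y)%g} by apply: qgrp_liftM.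
have f1d x : derived2 x -> f1 x = 1%g by apply: (derived2_ker f1M); apply: magnus_commute.
exists (qgrp_lift f1); split; first by apply: qgrp_liftM.
move=> i; rewrite qgrp_liftE // /surf_gen /f1 qgrp_liftE // /f0 fgrp_liftE.
by rewrite fintype.splitK.
Qed.

Lemma surface_gr_indep (K : groupType) (c : 'I_(g + g) -> K) (f : K -> H) m :
  {morph f : x y / (x * y)%g} -> (forall i, f (c i) = surf_c i) ->
  indep (@basic_val _ m (@sbad g) _ (grB c m)).
Proof.
move=> fM fc; have P := mpoly_ring (g + g); pose X := @pr_X _ P.
have [r [r_lead [f' [f'M f'c]]]] := surf_magnus P.
have FM : {morph f' \o f : x y / (x * y)%g} by move=> x y; rewrite /= fM f'M.
have Fc i : (f' \o f) (c i) = qpi _ (aff_gen (X i) i) by rewrite /= fc f'c.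
have [h hL hE] := magnus_functional r_lead FM Fc m.
apply: (indep_linear hL) => d dE.
suff [z zE] : lineq (komega X) (\sum_p d p *: basic_val (kvec X) p).
  exact: (@kvec_indep_surface _ P _ _ z zE).
apply: lspan_lineq; rewrite -[X in lspan _ X]subr0; apply/lquotP.
rewrite linear_sum [RHS](linear0 (lpi _)) -[RHS]dE; apply: eq_bigr => p _.
by rewrite linearZ /= /basic_val hE // size_behead size_tuple.
Qed.

Lemma chen_rank_surface m :
  chen_rank Pi m.+2 = Some #|chen_index m (@sbad g)|.
Proof.
apply: (@dimQ_family _ _ (@basic_val _ m (@sbad g) _ (grB surf_c m))).
  move=> v; apply: (@gr_span_surface g H surf_c m v (@metab_commute Pi) surf_c_gen) => s sm.
  by rewrite surf_c_rel cfold1 tau1.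
exact: (@surface_gr_indep _ _ idfun).
Qed.

Lemma chen_rank_surface1 : chen_rank Pi 1 = Some (g + g)%N.
Proof.
have -> : Some (g + g)%N = Some #|'I_(g + g)| by rewrite card_ord.
apply: (@dimQ_family _ _ (fun i => tau 0 (surf_c i))) => [v|].
  apply: lspan_ind (tau_span v) => _ [x _ <-].
  apply: (additive_gen_span (f := tau 0)) (surf_c_gen0 x) => [y z|].
    exact: (@tauM _ 0).
  by move=> _ [i _ <-]; apply: span_in; exists i.
have P := mpoly_ring (g + g); pose X := @pr_X _ P.
have [r [_ [f [fM fc]]]] := surf_magnus P.
have [h hL hE] := magnus_functional1 fM fc.
apply: (indep_linear hL) => c cE; apply: (@pr_X_indep _ P).
by rewrite -[RHS]cE; apply: eq_bigr => i _; rewrite hE.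
Qed.
End SurfaceChen.

(** * Chen ranks of Seifert groups *)

Section MetabelianTorsion.
Local Open Scope group_scope.
Variable H : groupType.
Local Notation L := (@lower_central_rec H).
Hypothesis Hmet : forall a b, L 1 a -> L 1 b -> commute a b.

Lemma metabRXl a w k : L 1 a -> [~ a ^+ k, w] = [~ a, w] ^+ k.
Proof.
move=> La; elim: k => [|k IH]; first by rewrite !expg0 comm1g.
by rewrite !expgS metabRMl ?IH //; apply: lcsX.
Qed.

Lemma commXg_mod (z w : H) j : exists2 l, L 3 l &
  [~ z ^+ j, w] = [~ z, w] ^+ j * [~ [~ z, w], z] ^+ 'C(j, 2) * l.
Proof.
set a := [~ z, w]; set q := [~ a, z]; have La : L 1 a by apply: lcs1R.
have Lq : L 2 q by apply: lcsR.
have Lq1 := lcsS Lq.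
elim: j => [|j [l Ll IH]].
  by exists 1; [apply: lcs1 | rewrite !expg0 comm1g !mulg1].
have Ll1 : L 1 l by apply: lcs_le Ll.
have Laj := lcsX j La; have Lqc := lcsX 'C(j, 2) Lq1.
pose l2 := [~ q, z] ^+ 'C(j, 2) * [~ l, z].
have Ll2 : L 3 l2 by apply: lcsM; [apply/lcsX/lcsR | apply: lcsS; apply: lcsR].
have Ll21 : L 1 l2 by apply: lcs_le Ll2.
have E : [~ [~ z ^+ j, w], z] = q ^+ j * l2.
  rewrite IH (metabRMl Hmet z (lcsM Laj Lqc) Ll1) (metabRMl Hmet z Laj Lqc).
  rewrite (metabRXl z j La) (metabRXl z _ Lq1); exact: esym (mulgA _ _ _).
exists (l * l2); first exact: lcsM.
rewrite expgSr commMgE E IH -/a binS bin1 expgnDr expgSr.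
have arrange (x t u v y k : H) : commute (t * u * (v * k)) y -> commute u v ->
    x * t * u * (v * k) * y = x * y * (t * v) * (u * k).
  move=> C1 C2; have -> : x * t * u * (v * k) * y = x * ((t * u * (v * k)) * y).
    by rewrite !mulgA.
  by rewrite C1 !mulgA -[_ * u * v]mulgA C2 !mulgA.
have Lqj := lcsX j Lq1; apply: arrange; last exact: Hmet.
by apply: Hmet La; apply: lcsM (lcsM Lqc Ll1) (lcsM Lqj Ll21).
Qed.

Lemma comm_root_torsion (z : H) n : (0 < n)%N -> (forall w, commute (z ^+ n) w) ->
  forall w, exists2 m, (0 < m)%N & L 3 ([~ z, w] ^+ m).
Proof.
move=> n0 zn w; have [l Ll] := commXg_mod z w n.
set a := [~ z, w]; set q := [~ a, z]; set k := 'C(n, 2).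
have La : L 1 a by apply: lcs1R.
have Lq : L 2 q by apply: lcsR.
have Lq1 := lcsS Lq.
have /commgP/eqP -> := zn w => E.
have L1 : L 3 (a ^+ n * q ^+ k).
  have -> : a ^+ n * q ^+ k = l^-1 by symmetry; apply: mulg1_eq; rewrite (Hmet _ _) -?E //;
    [apply: lcs_le Ll | apply: lcsM; apply: lcsX].
  exact: lcsV.
have Lqk : L 3 ([~ q, z] ^+ k) by apply/lcsX/lcsR.
have Lqn : L 3 (q ^+ n).
  have := lcsS (lcsR z L1); rewrite metabRMl ?metabRXl -?/q //; try exact: lcsX.
  by move=> L2; have := lcsM L2 (lcsV Lqk); rewrite mulgK.
exists (n * n)%N; first by rewrite muln_gt0 n0.
have := lcsX n L1; rewrite expgMn; last by apply: Hmet; apply: lcsX.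
rewrite -!expgnA [(k * n)%N]mulnC (expgnA q) => L2.
by have := lcsM L2 (lcsV (lcsX k Lqn)); rewrite mulgK.
Qed.

(* [x] is central modulo the isolator of Gamma_4. *)
Definition quasi_central (x : H) :=
  forall w, exists2 m, (0 < m)%N & L 3 ([~ x, w] ^+ m).

Lemma quasi_central1 : quasi_central 1.
Proof. by move=> w; exists 1%N => //; rewrite comm1g; apply: lcs1. Qed.

Lemma quasi_centralM x y : quasi_central x -> quasi_central y -> quasi_central (x * y).
Proof.
move=> Cx Cy w; have [m m0 Lm] := Cx w; have [k k0 Lk] := Cy w.
exists (m * k)%N; first by rewrite muln_gt0 m0.
have -> : [~ x * y, w] = [~ x, w] ^ y * [~ y, w] by rewrite /commg /conjg !gnorm.
rewrite expgMn; last by apply: Hmet; [apply/lcsJ/lcs1R | apply: lcs1R].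
rewrite -conjXg; apply: lcsM; first by apply: lcsJ; rewrite expgnA; apply: lcsX.
by rewrite mulnC expgnA; apply: lcsX.
Qed.

Lemma quasi_centralV x : quasi_central x -> quasi_central x^-1.
Proof.
move=> Cx w; have [m m0 Lm] := Cx w; exists m => //.
have -> : [~ x^-1, w] = ([~ x, w] ^-1) ^ x^-1 by rewrite /commg /conjg !gnorm.
by rewrite -conjXg expVgn; apply/lcsJ/lcsV.
Qed.

Lemma quasi_central_expgz x n : quasi_central x -> quasi_central (expgz x n).
Proof.
move=> Cx; have CX k : quasi_central (x ^+ k).
  elim: k => [|k IH]; first exact: quasi_central1.
  by rewrite expgS; apply: quasi_centralM.
by case: n => k //=; apply: quasi_centralV.
Qed.

Lemma quasi_central_prod (J : Type) (r : seq J) (F : J -> H) :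
  (forall j, quasi_central (F j)) -> quasi_central (\prod_(j <- r) F j).
Proof.
by move=> CF; elim/big_rec: _ => [|j x _]; [apply: quasi_central1 | apply: quasi_centralM].
Qed.

Variables (n : nat) (c : 'I_n -> H).

Lemma tau_cfold_torsion k a d s m : m = (size s + k.+1)%N ->
  L k.+1 a -> (0 < d)%N -> L k.+2 (a ^+ d) -> tau m (cfold c a s) = 0%R.
Proof.
move=> -> La d0 Ld; have La1 : L 1 a by apply: lcs_le La.
have Lf : L (size s + k.+1).+1 (cfold c (a ^+ d) s) by rewrite -addnS; apply: lcs_cfold.
have := tau0 Lf; rewrite (cfoldX Hmet) // tauX; last exact: lcs_cfold.
rewrite -scaler_nat => /eqP; rewrite scaler_eq0 pnatr_eq0.
by case/orP => [/eqP d00|/eqP //]; rewrite d00 in d0.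
Qed.

Lemma tau_cfold_quasi_central a s : L 1 a -> quasi_central a -> s != [::] ->
  tau (size s).+1 (cfold c a s) = 0%R.
Proof.
case: s => [//|l s] La Ca _; have [m m0 Lm] := Ca (c l).
by apply: (tau_cfold_torsion (a := [~ a, c l])) (lcsR _ La) m0 Lm; rewrite addn2.
Qed.

Definition isolator2 : set H := [set x | L 1 x /\ exists2 m, (0 < m)%N & L 2 (x ^+ m)].

Lemma isolator2_nclosure x : nclosure isolator2 x -> isolator2 x.
Proof.
elim=> [_ [y [w [[Ly [m m0 Lm]] ->]]]||u v _ [Lu [m m0 Lm]] _ [Lv [k k0 Lk]]|u _ [Lu [m m0 Lm]]].
- by split; [apply: lcsJ | exists m => //; rewrite -conjXg; apply: lcsJ].
- by split; [apply: lcs1 | exists 1%N => //; apply: lcs1].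
- split; first exact: lcsM.
  exists (m * k)%N; first by rewrite muln_gt0 m0.
  rewrite expgMn; last exact: Hmet.
  by apply: lcsM; [|rewrite mulnC]; rewrite expgnA; apply: lcsX.
- by split; [apply: lcsV | exists m => //; rewrite expVgn; apply: lcsV].
Qed.

Lemma quasi_central_qpi x (y : qgrp isolator2) :
  quasi_central x -> commute (qpi isolator2 x) y.
Proof.
move=> Cx; rewrite -[y]qpiK; apply/commgP/eqP; rewrite -(homR (@qpiM _ _)).
apply: qpi_eq1; split; first exact: lcs1R.
by have [m m0 Lm] := Cx (repr y); exists m => //; apply: lcsS.
Qed.

Lemma isolator2_pow a d : (0 < d)%N -> qpi isolator2 a ^+ d = 1 ->
  exists2 m, (0 < m)%N & L 2 (a ^+ m).
Proof.
move=> d0; rewrite -(homX (@qpiM _ _)) -[RHS](hom1 (@qpiM _ isolator2)) => /esym/qgrpP.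
move=> /isolator2_nclosure; rewrite invg1 mul1g => -[_ [m m0 Lm]].
by exists (d * m)%N; rewrite ?muln_gt0 ?d0 // expgnA.
Qed.
End MetabelianTorsion.

Section RationalPower.
Local Open Scope group_scope.
Variables (K : groupType) (h : K).

(* A central x with x^d = h^(d q); p and r avoid negative exponents. *)
Definition rat_pow (x : K) (q : rat) := (forall y, commute x y) /\
  exists d p r : nat, [/\ (0 < d)%N, x ^+ d * h ^+ p = h ^+ r &
    (r%:R - p%:R = d%:R * q)%R].

Lemma rat_powM x y q q' : rat_pow x q -> rat_pow y q' -> rat_pow (x * y) (q + q')%R.
Proof.
move=> [Cx [d [p [r [d0 E1 E2]]]]] [Cy [d' [p' [r' [d'0 E1' E2']]]]]; split.
  by move=> z; apply/commute_sym/commuteM; apply: commute_sym.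
exists (d * d')%N, (p * d' + p' * d)%N, (r * d' + r' * d)%N; split.
- by rewrite muln_gt0 d0.
- have hh k l : commute (h ^+ k) (h ^+ l) by apply/commuteX2/commute_refl.
  have F1 : x ^+ (d * d') * h ^+ (p * d') = h ^+ (r * d').
    by rewrite !expgnA -expgMn ?E1 //; apply: commuteX2.
  have F2 : y ^+ (d * d') * h ^+ (p' * d) = h ^+ (r' * d).
    by rewrite mulnC !expgnA -expgMn ?E1' //; apply: commuteX2.
  rewrite expgMn // !expgnDr -F1 -F2 !mulgA; congr (_ * _); rewrite -!mulgA.
  by congr (_ * _); apply: commuteX2.
- rewrite !natrD !natrM mulrDr -[(d%:R * d'%:R * q)%R]mulrA [(d'%:R * q)%R]mulrC mulrA.
  rewrite -E2 -[(d%:R * d'%:R * q')%R]mulrA -E2'; ring.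
Qed.

Lemma rat_powV x q : rat_pow x q -> rat_pow x^-1 (- q)%R.
Proof.
move=> [Cx [d [p [r [d0 E1 E2]]]]]; split; first by move=> z; apply/commute_sym/commuteV/commute_sym.
exists d, r, p; split=> //; last by rewrite mulrN -E2 opprB.
by rewrite -E1 expVgn mulKg.
Qed.

Lemma rat_pow1 : rat_pow 1 0%R.
Proof.
split; first by move=> y; apply/commute_sym/commute1.
by exists 1%N, 0%N, 0%N; split=> //; rewrite ?mulg1 // subrr mulr0.
Qed.

Lemma rat_pow_prod (J : Type) (s : seq J) (F : J -> K) (q : J -> rat) :
  (forall j, rat_pow (F j) (q j)) ->
  rat_pow (\prod_(j <- s) F j) (\sum_(j <- s) q j)%R.
Proof.
move=> FQ; elim: s => [|j s IH]; first by rewrite !big_nil; apply: rat_pow1.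
by rewrite !big_cons; apply: rat_powM.
Qed.

Lemma rat_pow_expgz n : (forall y, commute h y) -> rat_pow (expgz h n) n%:~R%R.
Proof.
move=> Ch; have CX k y : commute (h ^+ k) y by apply/commute_sym/commuteX/commute_sym.
have P k : rat_pow (h ^+ k) k%:R%R.
  split=> //; exists 1%N, 0%N, k; split=> //; first by rewrite mulg1.
  by rewrite subr0 mul1r.
by case: n => k; [apply: P | apply: rat_powV; apply: P].
Qed.

Lemma rat_pow_root x a n : (0 < a)%N -> (forall y, commute h y) -> (forall y, commute x y) ->
  x ^+ a * expgz h n = 1 -> rat_pow x (- (n%:~R / a%:R))%R.
Proof.
move=> a0 Ch Cx E; split=> //.
have aQ : a%:R != 0%R :> rat by rewrite pnatr_eq0 -lt0n.
case: n E => k E.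
  by exists a, k, 0%N; split=> //; rewrite sub0r mulrN mulrC divfK.
exists a, 0%N, k.+1; split=> //; first by apply: (mulIg (h ^- k.+1)); rewrite mulg1 E mulgV.
by rewrite NegzE mulrNz mulNr opprK mulrC divfK // subr0.
Qed.

Lemma rat_pow0 x : rat_pow x 0%R -> exists2 d, (0 < d)%N & x ^+ d = 1.
Proof.
move=> [_ [d [p [r [d0 E1]]]]]; rewrite mulr0 => /eqP; rewrite subr_eq0 eqr_nat => /eqP rp.
by exists d => //; apply: (mulIg (h ^+ p)); rewrite mul1g E1 rp.
Qed.
End RationalPower.

Section AdditiveMaps.
Variables (K : groupType) (W : lmodType rat) (f : K -> W).
Hypothesis fM : forall x y, f (x * y)%g = f x + f y.

Lemma add_hom1 : f 1%g = 0.
Proof. by apply: (@addIr _ (f 1%g)); rewrite -fM mulg1 add0r. Qed.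
Lemma add_homV x : f x^-1%g = - f x.
Proof. by apply/eqP; rewrite -addr_eq0 -fM mulVg add_hom1. Qed.
Lemma add_homX x n : f (x ^+ n)%g = n%:R *: f x.
Proof.
elim: n => [|n IH]; first by rewrite add_hom1 scale0r.
by rewrite expgS fM IH -natr1 scalerDl scale1r addrC.
Qed.
Lemma add_homXz x n : f (expgz x n) = n%:~R *: f x.
Proof.
by case: n => n /=; rewrite ?add_homV add_homX // NegzE mulrNz scaleNr.
Qed.
Lemma add_hom_prod (J : Type) (r : seq J) (F : J -> K) :
  f (\prod_(j <- r) F j)%g = \sum_(j <- r) f (F j).
Proof.
elim: r => [|j r IH]; first by rewrite !big_nil add_hom1.
by rewrite !big_cons fM IH.
Qed.
Lemma add_homR x y : f [~ x, y]%g = 0.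
Proof. by rewrite /commg /conjg !(fM, add_homV) addrA -opprD addNr. Qed.
Lemma add_hom_root (z h : K) (a b : int) : a%:~R != 0 :> rat ->
  (expgz z a * expgz h b = 1)%g -> f z = - (b%:~R / a%:~R) *: f h.
Proof.
move=> a0 /(congr1 f); rewrite fM !add_homXz add_hom1 => /eqP.
rewrite addr_eq0 => /eqP E; apply: (scalerI a0).
by rewrite E scalerA mulrN mulrC divfK // scaleNr.
Qed.
End AdditiveMaps.

Section SeifertRoots.
Variables (s : nat) (b : int) (alpha beta : 'I_s -> int).
Hypothesis alpha_ge2 : forall i, 2 <= alpha i.

Lemma alpha_nat i : exists2 a : nat, (0 < a)%N & alpha i = a.
Proof. by have := alpha_ge2 i; case: (alpha i) => // a a2; exists a => //; lia. Qed.

Lemma alpha_neq0 i : (alpha i)%:~R != 0 :> rat.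
Proof. by have [a a0 ->] := alpha_nat i; rewrite -[_%:~R]/(a%:R) pnatr_eq0 -lt0n. Qed.

Lemma add_hom_euler (K : groupType) (W : lmodType rat) (f : K -> W)
    (c h : K) (Z : 'I_s -> K) :
  (forall x y, f (x * y)%g = f x + f y) ->
  (c * \prod_(i < s) Z i = expgz h b)%g ->
  (forall i, (expgz (Z i) (alpha i) * expgz h (beta i) = 1)%g) ->
  f c = - (euler_number b alpha beta *: f h).
Proof.
move=> fM /(congr1 f) E Zr; move: E; rewrite fM (add_hom_prod fM) (add_homXz fM).
move=> /eqP; rewrite eq_sym -subr_eq => /eqP <-.
rewrite /euler_number scalerBl scaleNr scaler_suml opprB opprK addrC; congr (_ + _).
rewrite -sumrN; apply: eq_bigr => i _.
by rewrite (add_hom_root fM (alpha_neq0 i) (Zr i)) scaleNr opprK.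
Qed.
End SeifertRoots.

Record seifert_rel (g s : nat) (b : int) (alpha beta : 'I_s -> int) (K : groupType)
  (X : 'I_(g + g) -> K) (Z : 'I_s -> K) (h : K) : Prop := SeifertRel {
  sr_central : forall x, commute h x;
  sr_prod : (\prod_(a < g) [~ X (sx a), X (sy a)] * \prod_(i < s) Z i = expgz h b)%g;
  sr_root : forall i, (expgz (Z i) (alpha i) * expgz h (beta i) = 1)%g
}.

Section SeifertRelations.
Variables (g s : nat) (b : int) (alpha beta : 'I_s -> int).
Hypothesis alpha_ge2 : forall i, 2 <= alpha i.
Variables (K : groupType) (X : 'I_(g + g) -> K) (Z : 'I_s -> K) (h : K).
Hypothesis rel : seifert_rel b alpha beta X Z h.
Local Notation e := (euler_number b alpha beta).
Local Notation c := (\prod_(a < g) [~ X (sx a), X (sy a)])%g.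

Lemma seifert_hom_Z (W : lmodType rat) (f : K -> W) i :
  (forall x y, f (x * y)%g = f x + f y) ->
  f (Z i) = - ((beta i)%:~R / (alpha i)%:~R) *: f h.
Proof. by move=> fM; apply: add_hom_root (sr_root rel i) => //; apply: alpha_neq0. Qed.

Lemma seifert_hom_h (W : lmodType rat) (f : K -> W) :
  (forall x y, f (x * y)%g = f x + f y) -> e *: f h = 0.
Proof.
move=> fM; have := add_hom_euler alpha_ge2 fM (sr_prod rel) (sr_root rel).
rewrite (add_hom_prod fM) big1 => [/eqP|a _]; last exact: add_homR.
by rewrite eq_sym oppr_eq0 => /eqP.
Qed.

Lemma seifert_gr_central_h : gr_central h.
Proof.
move=> n a La; have /commgP/eqP -> := commute_sym (sr_central rel a).
exact: tau1.
Qed.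

Lemma seifert_gr_central_Z i : gr_central (Z i).
Proof.
move=> n a La; rewrite (@seifert_hom_Z _ (fun y => tau n.+1 [~ a, y]%g)).
  by rewrite (seifert_gr_central_h La) scaler0.
by move=> x y; apply: tauRr.
Qed.

Hypothesis Kmet : forall a b : K,
  lower_central_rec 1 a -> lower_central_rec 1 b -> commute a b.

Lemma seifert_expgz_central n x : commute (expgz h n) x.
Proof.
have CX k y : commute (h ^+ k)%g y.
  by apply/commute_sym/commuteX/commute_sym/(sr_central rel).
by case: n => k /=; [|apply/commute_sym/commuteV/commute_sym].
Qed.

Lemma seifert_root_nat i : exists2 a : nat, (0 < a)%N &
  alpha i = a /\ (Z i ^+ a * expgz h (beta i) = 1)%g.
Proof.
have [a a0 aE] := alpha_nat alpha_ge2 i; exists a => //; split=> //.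
by have := sr_root rel i; rewrite aE.
Qed.

Lemma seifert_quasi_central_h : quasi_central h.
Proof.
move=> w; exists 1%N => //; have /commgP/eqP -> := sr_central rel w.
exact: lcs1.
Qed.

Lemma seifert_quasi_central_Z i : quasi_central (Z i).
Proof.
have [a a0 [_ E]] := seifert_root_nat i.
apply: (comm_root_torsion Kmet a0) => w.
have -> : (Z i ^+ a)%g = (expgz h (beta i))^-1%g.
  by apply: (mulIg (expgz h (beta i))); rewrite E mulVg.
exact/commute_sym/commuteV/commute_sym/seifert_expgz_central.
Qed.

Lemma seifert_cE : c = (expgz h b * (\prod_(i < s) Z i)^-1)%g.
Proof. by rewrite -(sr_prod rel) mulgK. Qed.

Lemma seifert_quasi_central_c : quasi_central c.
Proof.
rewrite seifert_cE; apply: (quasi_centralM Kmet).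
  by apply: (quasi_central_expgz Kmet); apply: seifert_quasi_central_h.
apply: quasi_centralV; apply: (quasi_central_prod Kmet).
exact: seifert_quasi_central_Z.
Qed.

Lemma seifert_lcs1_c : lower_central_rec 1 c.
Proof. by apply: lcs_prod => a _; apply: lcs1R. Qed.

Lemma seifert_c_torsion : e = 0 ->
  exists2 m, (0 < m)%N & lower_central_rec 2 (c ^+ m)%g.
Proof.
move=> e0; pose p := qpi (@isolator2 K); have pM : {morph p : x y / (x * y)%g} := @qpiM _ _.
have C x y : quasi_central x -> commute (p x) y by move=> Cx; apply: quasi_central_qpi.
have Ch y : commute (p h) y := C _ _ seifert_quasi_central_h.
have Qc : rat_pow (p h) (p c) 0.
  have -> : 0 = b%:~R - \sum_(i < s) - ((beta i)%:~R / (alpha i)%:~R) :> rat.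
    by rewrite sumrN opprK; apply/esym/eqP; rewrite -oppr_eq0 opprD; apply/eqP; exact: e0.
  rewrite seifert_cE pM (homV pM) (hom_prod pM) (hom_expgz pM).
  apply: rat_powM; first exact: rat_pow_expgz.
  apply: rat_powV; apply: rat_pow_prod => i; have [a a0 [aE E]] := seifert_root_nat i.
  rewrite aE; apply: rat_pow_root => //; last by rewrite -(homX pM) -(hom_expgz pM) -pM E (hom1 pM).
  by move=> y; apply/C/seifert_quasi_central_Z.
have [d d0 E] := rat_pow0 Qc; exact: (isolator2_pow Kmet d0 E).
Qed.

Lemma seifert_gr_rel m t : size t = m -> (e = 0 \/ m <> 0%N) ->
  tau m.+1 (cfold X c t) = 0.
Proof.
move=> tm [e0|m0].
  have [d d0 Ld] := seifert_c_torsion e0.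
  apply: (tau_cfold_torsion Kmet X _ _ d0 Ld); first by rewrite tm addn1.
  exact: seifert_lcs1_c.
rewrite -tm; apply: (tau_cfold_quasi_central Kmet); first exact: seifert_lcs1_c.
  exact: seifert_quasi_central_c.
by case: (t) tm m0 => // <-.
Qed.
End SeifertRelations.

Section SeifertGroup.
Variables (g s : nat) (b : int) (alpha beta : 'I_s -> int).
Local Notation G := (seifert_group g b alpha beta).
Local Notation rels := (@seifert_rels g s b alpha beta).

Definition seif_x (i : 'I_(g + g)) : G :=
  qpi rels (fgen (inl (inl (fintype.split i)) : seifert_gen g s)).
Definition seif_z (i : 'I_s) : G := qpi rels (fgen (inl (inr i) : seifert_gen g s)).
Definition seif_h : G := qpi rels (fgen (inr tt : seifert_gen g s)).

Lemma seifert_group_gen x : gen (range seif_x `|` range seif_z `|` [set seif_h]) x.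
Proof.
apply: gen_sub (qgrp_gen (@fgrp_gen _) x) => _ [_ [t _ <-] <-]; apply: gen_in.
case: t => [[t|i]|[]]; last by right.
- by left; left; exists (unsplit t) => //; rewrite /seif_x unsplitK.
- by left; right; exists i.
Qed.

Lemma seifert_group_rel : seifert_rel b alpha beta seif_x seif_z seif_h.
Proof.
have pM := @qpiM _ rels; split.
- move=> x; elim: (qgrp_gen (@fgrp_gen _) x) => [_ [_ [t _ <-] <-]||u v _ Cu _ Cv|u _ Cu].
  + apply/commgP/eqP; rewrite -(homR pM); apply: qpi_eq1.
    by apply: Or31; exists t.
  + exact: commute1.
  + exact: commuteM.
  + exact: commuteV.
- have /eqP : qpi rels (\prod_(i < g) [~ @seifert_x g s i, @seifert_y g s i] *
      \prod_(i < s) seifert_z g i * (expgz (seifert_h g s) b)^-1)%g = 1%g.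
    by apply: qpi_eq1; apply: Or32.
  rewrite pM (homV pM) divg_eq1 pM !(hom_prod pM) (hom_expgz pM) => /eqP <-.
  congr (_ * _)%g; apply: eq_bigr => a _.
  by rewrite (homR pM) /seif_x split_sx split_sy.
- move=> i; rewrite -!(hom_expgz pM) -pM; apply: qpi_eq1.
  by apply: Or33; exists i.
Qed.

Lemma seifert_hom (K : groupType) (X : 'I_(g + g) -> K) (Z : 'I_s -> K) (h : K) :
  seifert_rel b alpha beta X Z h ->
  exists f : G -> K, [/\ {morph f : x y / (x * y)%g}, forall i, f (seif_x i) = X i,
    forall i, f (seif_z i) = Z i & f seif_h = h].
Proof.
move=> [Kh Kp Kz].
pose v (t : seifert_gen g s) := match t with
  | inl (inl t) => X (unsplit t) | inl (inr i) => Z i | inr _ => h end.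
pose f0 := fgrp_lift v; have f0M : {morph f0 : x y / (x * y)%g} by apply: fgrp_liftM.
have f0E t : f0 (fgen t) = v t by apply: fgrp_liftE.
have f0r x : rels x -> f0 x = 1%g.
  case=> [[t ->]|->|[i ->]].
  - by rewrite (homR f0M) !f0E; apply/eqP/commgP/Kh.
  - rewrite f0M (homV f0M) f0M !(hom_prod f0M) (hom_expgz f0M) !f0E /=.
    apply/eqP; rewrite divg_eq1 -Kp; apply/eqP; congr (_ * _)%g.
      by apply: eq_bigr => a _; rewrite (homR f0M) !f0E.
    by apply: eq_bigr => a _; rewrite f0E.
  - by rewrite f0M !(hom_expgz f0M) !f0E Kz.
exists (qgrp_lift f0); split; first by apply: qgrp_liftM.
- by move=> i; rewrite qgrp_liftE // f0E /= fintype.splitK.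
- by move=> i; rewrite qgrp_liftE // f0E.
- by rewrite qgrp_liftE // f0E.
Qed.

Lemma seifert_rel_hom (K K' : groupType) (f : K -> K') X Z h :
  {morph f : x y / (x * y)%g} -> (forall y, exists x, y = f x) ->
  @seifert_rel g s b alpha beta K X Z h ->
  seifert_rel b alpha beta (f \o X) (f \o Z) (f h).
Proof.
move=> fM fS [Kh Kp Kz]; split.
- by move=> y; have [x ->] := fS y; rewrite /commute -!fM Kh.
- rewrite -(hom_expgz fM) -Kp fM !(hom_prod fM); congr (_ * _)%g.
  by apply: eq_bigr => a _; rewrite (homR fM).
- by move=> i; rewrite -!(hom_expgz fM) -fM Kz (hom1 fM).
Qed.

Lemma seifert_hom_surface : exists f : G -> surface_group g,
  {morph f : x y / (x * y)%g} /\ forall i, f (seif_x i) = surf_gen i.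
Proof.
have z1 n : expgz (1%g : surface_group g) n = 1%g.
  by case: n => n /=; rewrite expg1n ?invg1.
have R : seifert_rel b alpha beta (@surf_gen g) (fun=> 1%g) 1%g.
  split=> [x||i]; first exact/commute_sym/commute1.
    by rewrite surf_rel z1 big1 // mulg1.
  by rewrite !z1 mulg1.
by have [f [fM fx _ _]] := seifert_hom R; exists f.
Qed.
End SeifertGroup.

(* The carrier ignores M, which selects the group law. *)
Definition heis n (M : 'I_n -> 'I_n -> rat) := (('I_n -> rat^o) * rat)%type.

Section Heisenberg.
Variables (n : nat) (M : 'I_n -> 'I_n -> rat).
Local Notation V := ('I_n -> rat^o).

Definition bform (v w : V) : rat := \sum_i \sum_j M i j * (v i * w j).

Lemma bformDl v v' w : bform (v + v') w = bform v w + bform v' w.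
Proof.
rewrite /bform -big_split; apply: eq_bigr => i _; rewrite -big_split /=.
by apply: eq_bigr => j _; rewrite -mulrDr -mulrDl.
Qed.
Lemma bformDr v w w' : bform v (w + w') = bform v w + bform v w'.
Proof.
rewrite /bform -big_split; apply: eq_bigr => i _; rewrite -big_split /=.
by apply: eq_bigr => j _; rewrite -mulrDr -mulrDr.
Qed.
Lemma bform0l w : bform 0 w = 0.
Proof. by apply: (@addIr _ (bform 0 w)); rewrite -bformDl !add0r. Qed.
Lemma bform0r v : bform v 0 = 0.
Proof. by apply: (@addIr _ (bform v 0)); rewrite -bformDr !add0r. Qed.
Lemma bformNl v w : bform (- v) w = - bform v w.
Proof. by apply/eqP; rewrite -addr_eq0 -bformDl addNr bform0l. Qed.
Lemma bformNr v w : bform v (- w) = - bform v w.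
Proof. by apply/eqP; rewrite -addr_eq0 -bformDr addNr bform0r. Qed.

Definition unitv (i : 'I_n) : V := fun j => (j == i)%:R.

Lemma bform_unit i j : bform (unitv i) (unitv j) = M i j.
Proof.
rewrite /bform (bigD1 i) //= [X in _ + X]big1 ?addr0 => [|k /negbTE ki]; last first.
  by rewrite big1 // => l _; rewrite /unitv ki mul0r mulr0.
rewrite (bigD1 j) //= big1 ?addr0 => [|k /negbTE kj]; last first.
  by rewrite /unitv kj mulr0 mulr0.
by rewrite /unitv !eqxx !mulr1.
Qed.

Local Notation heis := (heis M).
HB.instance Definition _ := Choice.copy heis (V * rat)%type.
Definition heis_mul (a b : heis) : heis := (a.1 + b.1, a.2 + b.2 + bform a.1 b.1).
Definition heis_inv (a : heis) : heis := (- a.1, - a.2 + bform a.1 a.1).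
Definition heis_one : heis := (0, 0).

Fact heis_mulA : associative heis_mul.
Proof.
move=> a b c; congr (_, _); first exact: addrA.
by rewrite /= bformDl bformDr; ring.
Qed.
Fact heis_mul1 : left_id heis_one heis_mul.
Proof. by move=> [v s]; congr (_, _); rewrite /= ?bform0l ?addr0 add0r. Qed.
Fact heis_mulr1 : right_id heis_one heis_mul.
Proof. by move=> [v s]; congr (_, _); rewrite /= ?bform0r ?addr0. Qed.
Fact heis_mulV : left_inverse heis_one heis_inv heis_mul.
Proof.
move=> [v s]; congr (_, _); rewrite /= ?addNr // bformNl.
by rewrite addrAC addrK addNr.
Qed.
Fact heis_mulrV : right_inverse heis_one heis_inv heis_mul.
Proof.
move=> [v s]; congr (_, _); rewrite /= ?subrr // bformNr.
by rewrite addrA subrr add0r subrr.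
Qed.
HB.instance Definition _ := isGroup.Build heis
  heis_mulA heis_mul1 heis_mulr1 heis_mulV heis_mulrV.

Lemma heisM2 (a b : heis) : (a * b)%g.2 = a.2 + b.2 + bform a.1 b.1. Proof. by []. Qed.

Lemma heis_central (s : rat) (a : heis) : commute ((0, s) : heis) a.
Proof.
case: a => v t; congr (_, _); rewrite /= ?add0r ?addr0 // bform0l bform0r !addr0.
exact: addrC.
Qed.

Lemma heis_commg (a b : heis) :
  [~ a, b]%g = ((0 : V), bform a.1 b.1 - bform b.1 a.1) :> heis.
Proof.
apply: (mulgI (b * a)%g); rewrite -commgC; case: a b => [v s] [w t]; congr (_, _) => /=.
  by rewrite addr0 addrC.
by rewrite bform0r addr0; ring.
Qed.

Lemma heis_tr_prod (J : Type) (r : seq J) (F : J -> rat) :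
  (\prod_(j <- r) ((0, F j) : heis))%g = ((0 : V), \sum_(j <- r) F j).
Proof.
elim: r => [|j r IH]; first by rewrite !big_nil.
rewrite !big_cons IH; congr (_, _); rewrite /= ?addr0 //.
by rewrite bform0l addr0.
Qed.

Lemma heis_tr_expgz (s : rat) (k : int) :
  expgz ((0, s) : heis) k = ((0 : V), k%:~R * s).
Proof.
have X m : (((0, s) : heis) ^+ m)%g = ((0 : V), m%:R * s).
  elim: m => [|m IH]; first by rewrite mul0r.
  rewrite expgS IH; congr (_, _); rewrite /= ?addr0 // bform0l addr0.
  by rewrite -natr1 mulrDl mul1r addrC.
case: k => m; rewrite [expgz _ _]/= X // NegzE mulrNz.
by congr (_, _); rewrite /= ?oppr0 // bform0l addr0 mulNr.
Qed.

Lemma heis_lcs1 (a : heis) : lower_central_rec 1 a -> exists s, a = (0, s).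
Proof.
elim=> [_ [x [y [_ _ ->]]]||_ _ _ [x ->] _ [y ->]|_ _ [x ->]].
- by rewrite heis_commg; eexists.
- by exists 0.
- by exists (x + y); congr (_, _); rewrite /= ?addr0 // bform0l addr0.
- by exists (- x); congr (_, _); rewrite /= ?oppr0 // bform0l addr0.
Qed.

Lemma heis_commute (a b : heis) :
  lower_central_rec 1 a -> lower_central_rec 1 b -> commute a b.
Proof. by move=> /heis_lcs1 [x ->] _; apply: heis_central. Qed.

Lemma heis_lcs2 (a : heis) : lower_central_rec 2 a -> a = 1%g.
Proof.
elim=> [_ [x [y [/heis_lcs1 [z ->] _ ->]]]||_ _ _ -> _ ->|_ _ ->] //.
- by apply/eqP/commgP/heis_central.
- by rewrite mulg1.
- by rewrite invg1.
Qed.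
End Heisenberg.

Section SeifertChen.
Variables (g s : nat) (b : int) (alpha beta : 'I_s -> int).
Hypothesis alpha_ge2 : forall i, 2 <= alpha i.
Local Notation G := (seifert_group g b alpha beta).
Local Notation e := (euler_number b alpha beta).
Local Notation V := ('I_(g + g) -> rat^o).
Local Notation H := (metab G).

Definition omega_pairing (M : 'I_(g + g) -> 'I_(g + g) -> rat) :=
  \sum_(a < g) (M (sx a) (sy a) - M (sy a) (sx a)).

Lemma seifert_heis_rel M k : omega_pairing M = - (e * k) ->
  seifert_rel b alpha beta (fun i => (unitv i, 0) : heis M)
    (fun i => ((0 : V), - ((beta i)%:~R / (alpha i)%:~R * k)) : heis M)
    ((0, k) : heis M).
Proof.
move=> Mk; split.
- exact: heis_central.
- under eq_bigr => a _ do rewrite heis_commg /= !bform_unit.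
  rewrite !heis_tr_prod heis_tr_expgz; congr (_, _); rewrite /= ?addr0 // bform0l addr0.
  rewrite -/(omega_pairing M) Mk sumrN -mulr_suml /euler_number; ring.
- move=> i; rewrite !heis_tr_expgz; congr (_, _); rewrite /= ?addr0 // bform0l addr0.
  by rewrite mulrN mulrA [_%:~R * (_ / _)]mulrC divfK ?alpha_neq0 // addNr.
Qed.

Lemma seifert_heis M k : omega_pairing M = - (e * k) ->
  exists f : G -> heis M, [/\ {morph f : x y / (x * y)%g},
    forall i, f (seif_x b alpha beta i) = (unitv i, 0),
    forall i, f (seif_z g b alpha beta i) = ((0 : V), - ((beta i)%:~R / (alpha i)%:~R * k)) &
    f (seif_h g b alpha beta) = (0, k)].
Proof. by move=> /seifert_heis_rel /seifert_hom. Qed.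

Definition sc (i : 'I_(g + g)) : H := qpi (@derived2 G) (seif_x b alpha beta i).
Definition scz (i : 'I_s) : H := qpi (@derived2 G) (seif_z g b alpha beta i).
Definition sch : H := qpi (@derived2 G) (seif_h g b alpha beta).

Lemma seifert_metab_rel : seifert_rel b alpha beta sc scz sch.
Proof.
apply: (seifert_rel_hom (f := qpi (@derived2 G))) (seifert_group_rel _ _ _ _).
  exact: qpiM.
by move=> y; exists (repr y); rewrite qpiK.
Qed.

Lemma seifert_metab_gen x : gen (range sc `|` range scz `|` [set sch]) x.
Proof.
apply: gen_sub (qgrp_gen (@seifert_group_gen _ _ _ _ _) x) => _ [y Sy <-]; apply: gen_in.
case: Sy => [[[i _ <-]|[i _ <-]]|->]; last by right.
- by left; left; exists i.
- by left; right; exists i.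
Qed.

Lemma seifert_metab_gen_central x : gen (range sc `|` @gr_central H) x.
Proof.
apply: gen_sub (seifert_metab_gen x) => y Sy; apply: gen_in.
case: Sy => [[[i _ <-]|[i _ <-]]|->].
- by left; exists i.
- right; exact: (seifert_gr_central_Z alpha_ge2 seifert_metab_rel).
- right; exact: (seifert_gr_central_h seifert_metab_rel).
Qed.

Lemma seifert_heis_metab M k : omega_pairing M = - (e * k) ->
  exists f : H -> heis M, [/\ {morph f : x y / (x * y)%g},
    forall i, f (sc i) = (unitv i, 0) & f sch = (0, k)].
Proof.
move=> /seifert_heis [f [fM fx fz fh]].
have fd x : derived2 x -> f x = 1%g by apply: (derived2_ker fM); apply: heis_commute.
exists (qgrp_lift f); split; first by apply: qgrp_liftM.
- by move=> i; rewrite qgrp_liftE.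
- by rewrite qgrp_liftE.
Qed.

Lemma tau0M x y : tau 0 (x * y)%g = tau 0 x + tau 0 y :> gr H 1.
Proof. exact: (@tauM _ 0). Qed.

Lemma seifert_gr1_span v : lspan (range (fun i => tau 0 (sc i)) `|` [set tau 0 sch]) v.
Proof.
apply: lspan_ind (tau_span v) => _ [x _ <-].
apply: (additive_gen_span (f := tau 0)) (seifert_metab_gen x); first exact: tau0M.
move=> _ [[[i _ <-]|[i _ <-]]|->].
- by apply: span_in; left; exists i.
- rewrite (seifert_hom_Z alpha_ge2 seifert_metab_rel _ tau0M).
  by apply/span_Z/span_in; right.
- by apply: span_in; right.
Qed.

Lemma seifert_gr1_xi M k (f : H -> heis M) : {morph f : x y / (x * y)%g} ->
  (forall i, f (sc i) = (unitv i, 0)) -> f sch = (0, k) ->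
  exists2 h : gr H 1 -> V, linear h & (forall i, h (tau 0 (sc i)) = unitv i) /\ h (tau 0 sch) = 0.
Proof.
move=> fM fc fh; have [||h hL hE] := @tau_univ H 0 V (fun x => (f x).1).
- by move=> x y _ _; rewrite fM.
- by move=> x /(lcs_hom fM) /heis_lcs1 [t ->].
by exists h => //; split=> [i|]; rewrite hE // ?fc ?fh.
Qed.

Lemma unitv_indep n (c : 'I_n -> rat) :
  \sum_i c i *: (unitv i : 'I_n -> rat^o) = 0 -> forall i, c i = 0.
Proof.
move=> E i; have := congr1 (fun f => f i) E; rewrite fct_sumE (bigD1 i) // big1.
  move=> {}E; have : c i * (i == i)%:R + 0 = 0 by exact: E.
  by rewrite eqxx mulr1 addr0.
move=> j /negbTE ji; rewrite -[LHS]/(c j * (i == j)%:R).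
by rewrite eq_sym ji mulr0.
Qed.

Lemma chen_rank_seifert1_neq0 : e != 0 -> chen_rank G 1 = Some (g + g)%N.
Proof.
move=> e0; have -> : Some (g + g)%N = Some #|'I_(g + g)| by rewrite card_ord.
apply: (@dimQ_family _ _ (fun i => tau 0 (sc i))) => [v|].
  apply: lspan_ind (seifert_gr1_span v) => _ [[i _ <-]|->]; first by apply: span_in; exists i.
  have /eqP := seifert_hom_h alpha_ge2 seifert_metab_rel tau0M.
  by rewrite scaler_eq0 (negbTE e0) => /eqP ->; apply: span_0.
have [|f [fM fc fh]] := @seifert_heis_metab (fun _ _ => 0) 0.
  by rewrite mulr0 oppr0 /omega_pairing big1 // => a _; rewrite subrr.
have [h hL [hc _]] := seifert_gr1_xi fM fc fh.
apply: (indep_linear hL) => c cE; apply: unitv_indep.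
by rewrite -[RHS]cE; apply: eq_bigr => i _; rewrite hc.
Qed.

Lemma sum_option (W : zmodType) (T : finType) (F : option T -> W) :
  \sum_o F o = F None + \sum_t F (Some t).
Proof.
rewrite (bigD1 None) //=; congr (_ + _).
rewrite (reindex_omap Some id) //=; last by case.
by apply: eq_bigl => t; rewrite eqxx.
Qed.

Lemma chen_rank_seifert1_eq0 : e = 0 -> chen_rank G 1 = Some (g + g).+1.
Proof.
move=> e0; have -> : Some (g + g).+1 = Some #|{: option 'I_(g + g)}| by rewrite card_option card_ord.
pose E (o : option 'I_(g + g)) := if o is Some i then tau 0 (sc i) else tau 0 sch.
apply: (@dimQ_family _ _ E) => [v|].
  apply: lspan_ind (seifert_gr1_span v) => _ [[i _ <-]|->]; apply: span_in.
    by exists (Some i).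
  by exists None.
have [|f [fM fc fh]] := @seifert_heis_metab (fun _ _ => 0) 1.
  by rewrite e0 mul0r oppr0 /omega_pairing big1 // => a _; rewrite subrr.
have [h hL [hc hh]] := seifert_gr1_xi fM fc fh.
have B0 v w : bform (fun _ _ => 0) v w = 0 :> rat.
  by rewrite /bform big1 // => i _; rewrite big1 // => j _; rewrite mul0r.
have [||k kL kE] := @tau_univ H 0 rat^o (fun x => (f x).2).
- by move=> x y _ _; rewrite fM heisM2 B0 addr0.
- move=> x; elim=> [_ [u [v [_ _ ->]]]||u v _ Fu _ Fv|u _ Fu].
  + by rewrite (homR fM) heis_commg /= !B0 subrr.
  + by rewrite (hom1 fM).
  + by rewrite fM heisM2 Fu Fv B0 !addr0.
  + by rewrite (homV fM) /= B0 Fu oppr0 addr0.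
move=> c cE.
have cN : c None = 0.
  have := congr1 k cE; rewrite (linear_fun_sum _ _ _ kL) (linear_fun0 kL) (bigD1 None) //= big1.
    by rewrite (linear_funZ kL) kE // fh addr0 -[_ *: _]/(_ * _) mulr1.
  by move=> [i|] // _; rewrite (linear_funZ kL) kE // fc scaler0.
have cS : forall i, c (Some i) = 0.
  apply: unitv_indep; have := congr1 h cE.
  rewrite (linear_fun_sum _ _ _ hL) (linear_fun0 hL) sum_option /= cN scale0r (linear_fun0 hL).
  by rewrite add0r => {2}<-; apply: eq_bigr => i _; rewrite (linear_funZ hL) hc.
by case.
Qed.

Lemma chen_rank_seifert2_neq0 : e != 0 -> chen_rank G 2 = Some 'C(g + g, 2).
Proof.
move=> e0; have -> : 'C(g + g, 2) = #|chen_index 0 (@pred0 'I_(g + g))|.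
  by rewrite card_chen_index mul1n addn0.
apply: (@dimQ_family _ _ (@basic_val _ 0 pred0 _ (grB sc 0))) => [v|].
  exact: (gr_span_basic (@metab_commute _) seifert_metab_gen_central).
move=> c cE p0; pose i0 := (sval p0).1; pose j0 := thead (sval p0).2.
pose M i j : rat := ((i == i0) && (j == j0))%:R.
have [|f [fM fc _]] := @seifert_heis_metab M (- (omega_pairing M / e)).
  by rewrite mulrN opprK mulrC divfK.
have [||k kL kE] := @tau_univ H 1 rat^o (fun x => (f x).2).
- move=> x y Lx Ly; rewrite fM heisM2.
  by have [t ->] := heis_lcs1 (lcs_hom fM Lx); rewrite bform0l addr0.
- by move=> x /(lcs_hom fM) /heis_lcs2 ->.
have := congr1 k cE; rewrite (linear_fun_sum _ _ _ kL) (linear_fun0 kL).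
have kB i j : k (grB sc 0 i j [::]) = M i j - M j i.
  by rewrite /grB kE /= ?(homR fM) ?heis_commg ?fc /= ?bform_unit //; apply: lcs1R.
have p_nil (p : chen_index 0 (@pred0 'I_(g + g))) : behead (sval p).2 = [::] :> seq _.
  by apply: size0nil; rewrite size_behead size_tuple.
rewrite (bigD1 p0) //= big1 ?addr0.
  rewrite (linear_funZ kL) /basic_val p_nil kB /M !eqxx /=.
  have lt : (j0 < i0)%N by rewrite /i0 /j0; case: (p0) => q /= /and3P[].
  have -> : (thead (sval p0).2 == i0) = false.
    by apply/negbTE; apply: contraTneq lt => <-; rewrite ltnn.
  by rewrite subr0 -[_ *: _]/(_ * _) mulr1.
move=> p pp; rewrite (linear_funZ kL) /basic_val p_nil kB /M.
have lt : (thead (sval p).2 < (sval p).1)%N by case: (p) => q /= /and3P[].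
have lt0 : (j0 < i0)%N by rewrite /i0 /j0; case: (p0) => q /= /and3P[].
case: andP => [[/eqP ii /eqP jj]|_].
  case/eqP: pp; apply: val_inj; rewrite /= [sval p]surjective_pairing [sval p0]surjective_pairing ii.
  by congr (_, _); apply: val_inj; rewrite /= -[LHS]behead_chen -[RHS]behead_chen jj !p_nil.
case: andP => [[/eqP ij /eqP ji]|_]; last by rewrite subrr scaler0.
by move: lt; rewrite ij ji ltnNge (ltnW lt0).
Qed.

Lemma chen_rank_seifert m : e = 0 \/ m <> 0%N ->
  chen_rank G m.+2 = Some #|chen_index m (@sbad g)|.
Proof.
move=> em; apply: (@dimQ_family _ _ (@basic_val _ m (@sbad g) _ (grB sc m))).
  move=> v; apply: (@gr_span_surface g H sc m v (@metab_commute G) seifert_metab_gen_central).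
  move=> t tm; exact: (seifert_gr_rel alpha_ge2 seifert_metab_rel (@metab_commute G) tm em).
have [f0 [f0M f0x]] := seifert_hom_surface g b alpha beta.
have pM := @qpiM _ (@derived2 (surface_group g)).
pose f1 x : metab (surface_group g) := qpi _ (f0 x).
have f1M : {morph f1 : x y / (x * y)%g} by move=> x y; rewrite /f1 f0M pM.
have f1d x : derived2 x -> f1 x = 1%g by apply: (derived2_ker f1M); apply: metab_commute.
apply: (@surface_gr_indep g H sc (qgrp_lift f1)); first by apply: qgrp_liftM.
by move=> i; rewrite qgrp_liftE // /f1 f0x.
Qed.
End SeifertChen.

(** * Metabelian Lie algebras *)

Section LieBasics.
Variable L : lieAlgType.
Implicit Types x y z : L.

Lemma lieDl x y z : lie (x + y) z = lie x z + lie y z.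
Proof. exact: (linear_funD (lie_linearl z)). Qed.
Lemma lieDr x y z : lie z (x + y) = lie z x + lie z y.
Proof. exact: (linear_funD (lie_linearr z)). Qed.
Lemma lieZl k x z : lie (k *: x) z = k *: lie x z.
Proof. exact: (linear_funZ (lie_linearl z)). Qed.
Lemma lieZr k x z : lie z (k *: x) = k *: lie z x.
Proof. exact: (linear_funZ (lie_linearr z)). Qed.
Lemma lie0l z : lie 0 z = 0 :> L.
Proof. exact: (linear_fun0 (lie_linearl z)). Qed.
Lemma lie0r z : lie z 0 = 0 :> L.
Proof. exact: (linear_fun0 (lie_linearr z)). Qed.
Lemma lieNl x z : lie (- x) z = - lie x z.
Proof. exact: (linear_funN (lie_linearl z)). Qed.
Lemma lieNr x z : lie z (- x) = - lie z x.
Proof. exact: (linear_funN (lie_linearr z)). Qed.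
End LieBasics.

Definition lie_hom (L L' : lieAlgType) (f : L -> L') :=
  linear f /\ forall x y, f (lie x y) = lie (f x) (f y).

Lemma lie_pi_hom (L : lieAlgType) (S : set L) : lie_hom (lie_pi S).
Proof.
split; first exact: lie_pi_linear.
by move=> x y; rewrite -lie_quot_lieE.
Qed.

Lemma lie_pi_eq0 (L : lieAlgType) (S : set L) x : lie_pi S x = 0 <-> lideal S x.
Proof.
have <- : lie_pi S 0 = 0 by exact: (linear_fun0 (@lie_pi_linear _ S)).
by rewrite -{2}[x]subr0; apply: lie_piP.
Qed.

Lemma lie_quot_lift (L L' : lieAlgType) (S : set L) (f : L -> L') :
  lie_hom f -> (forall x, S x -> f x = 0) ->
  exists2 h : lie_quot S -> L', lie_hom h & forall x, h (lie_pi S x) = f x.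
Proof.
move=> [fL fl] fS; pose F := GRing.isLinear.Build rat L L' *:%R f fL.
pose f' : {linear L -> L'} := HB.pack f F.
have f0 x : lideal S x -> f' x = 0.
  elim=> [y /fS //||y z _ fy _ fz|k y _ fy|y z _ fz].
  - exact: linear0.
  - by rewrite linearD fy fz addr0.
  - by rewrite linearZ /= -[f y]/(f' y) fy scaler0.
  - by rewrite [LHS]fl -[f z]/(f' z) fz lie0r.
have E x : lquot_lift f' (lie_pi S x) = f x by apply: lquot_liftE.
exists (lquot_lift f') => //; split; first exact: (lquot_lift_linear f0).
move=> x y; have [u ->] := lie_pi_surj x; have [v ->] := lie_pi_surj y.
by rewrite -(lie_pi_hom S).2 !E fl.
Qed.

Section FreeLieLift.
Variables (V : lmodType rat) (L : lieAlgType) (f : V -> L).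
Hypothesis fL : linear f.

Fixpoint lterm_eval (t : lterm V) : L := match t with
  | LGen v => f v
  | LZero => 0
  | LOpp t => - lterm_eval t
  | LAdd t u => lterm_eval t + lterm_eval u
  | LScale k t => k *: lterm_eval t
  | LLie t u => lie (lterm_eval t) (lterm_eval u)
  end.

Lemma lterm_eval_eq t u : lterm_eq t u -> lterm_eval t = lterm_eval u.
Proof.
elim=> //=; try by move=> *; congruence.
- by move=> *; apply: addrA.
- by move=> *; apply: addrC.
- by move=> *; apply: add0r.
- by move=> *; apply: addNr.
- by move=> *; apply: scalerA.
- by move=> *; apply: scale1r.
- by move=> *; apply: scalerDr.
- by move=> *; apply: scalerDl.
- by move=> *; rewrite lieDl lieZl.
- by move=> *; rewrite lieDr lieZr.
- by move=> *; apply: liexx.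
- by move=> *; apply: jacobi.
Qed.

Definition freeLie_lift (x : freeLie V) : L := lterm_eval (repr x).

Lemma freeLie_lift_pi t : freeLie_lift (flpi t) = lterm_eval t.
Proof. exact/lterm_eval_eq/lterm_repr. Qed.

Lemma freeLie_lift_gen v : freeLie_lift (lgen v) = f v.
Proof. exact: freeLie_lift_pi. Qed.

Lemma freeLie_lift_hom : lie_hom freeLie_lift.
Proof.
split=> [k x y|x y]; rewrite -[x]flpiK -[y]flpiK.
  by rewrite flpiZ flpiD !freeLie_lift_pi.
by rewrite -[lie _ _]/(fl_lie _ _) fl_lieE !freeLie_lift_pi.
Qed.
End FreeLieLift.

Section MetabelianLie.
Variable L : lieAlgType.
Hypothesis Lmet : forall a b c d : L, lie (lie a b) (lie c d) = 0.

Definition lfold (I : Type) (c : I -> L) (a : L) (s : seq I) :=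
  foldl (fun x l => lie x (c l)) a s.

Definition derived (a : L) := lspan [set z | exists x y, z = lie x y] a.

Lemma derived_lie x y : derived (lie x y).
Proof. by apply: span_in; exists x, y. Qed.

Lemma derived_comm a b : derived a -> derived b -> lie a b = 0.
Proof.
move=> Da; elim=> [_ [c [d ->]]||u v _ Cu _ Cv|k u _ Cu].
- elim: Da => [_ [x [y ->]]||u v _ Cu _ Cv|k u _ Cu] //.
  + exact: lie0l.
  + by rewrite lieDl Cu Cv addr0.
  + by rewrite lieZl Cu scaler0.
- exact: lie0r.
- by rewrite lieDr Cu Cv addr0.
- by rewrite lieZr Cu scaler0.
Qed.

Lemma lieACA a x y : derived a -> lie (lie a x) y = lie (lie a y) x.
Proof.
move=> Da; have J := jacobi a x y.
rewrite (derived_comm Da (derived_lie x y)) add0r in J.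
rewrite [lie (lie a x) y]lieC [lie (lie a y) x]lieC [lie a y]lieC lieNr opprK.
by apply/eqP; rewrite eq_sym -addr_eq0 J.
Qed.

Lemma lie2_derived2 (x : L) : @lie_derived2 L x -> x = 0.
Proof.
have D u : lie_commutator setT setT u -> derived u.
  by apply: lspan_ind => _ [a [b [_ _ ->]]]; apply: derived_lie.
elim=> [_ [a [b [/D Da /D Db ->]]]||u v _ -> _ ->|k u _ ->].
- exact: derived_comm.
- by [].
- exact: addr0.
- exact: scaler0.
Qed.

Variables (V : lmodType rat) (p : freeLie V -> L) (n : nat) (v : 'I_n -> V) (Vc : set V).
Hypothesis p_hom : lie_hom p.
Hypothesis Vspan : forall w, lspan (range v `|` Vc) w.
Hypothesis Vcentral : forall w x, Vc w -> lie x (p (lgen w)) = 0.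
Local Notation c := (fun i => p (lgen (v i))).

Definition lieB i j s : L := lfold c (lie (c i) (c j)) s.

Lemma lfold_linear s : linear (lfold c ^~ s).
Proof.
elim: s => [//|l s IH] k x y; rewrite /lfold /= -[foldl _ _ _]/(lfold c _ s).
by rewrite lieDl lieZl IH.
Qed.

Lemma lieB_alt i j s : lieB i j s = - lieB j i s.
Proof. by rewrite /lieB lieC (linear_funN (lfold_linear s)). Qed.

Lemma lieB_perm i j s s' : perm_eq s s' -> lieB i j s = lieB i j s'.
Proof.
move=> ps; apply: (@foldl_perm _ _ _ derived) ps => [a x _|a x y Da|].
- exact: derived_lie.
- exact: lieACA.
- exact: derived_lie.
Qed.

Lemma lieB_jacobi i j l s : lieB i j (l :: s) + lieB j l (i :: s) + lieB l i (j :: s) = 0.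
Proof.
rewrite /lieB /lfold /= -!/(lfold c _ s) -!(linear_funD (lfold_linear s)).
have := jacobi (c l) (c i) (c j); rewrite ![lie (c _) (lie _ _)]lieC -!opprD => /eqP.
by rewrite oppr_eq0 => /eqP ->; apply: (linear_fun0 (lfold_linear s)).
Qed.

Lemma lieB_deg i j s : exists2 x, lie_deg (size s).+2 x & lieB i j s = p x.
Proof.
elim/last_ind: s => [|s l [x dx E]].
  exists (lie (lgen (v i)) (lgen (v j))); last by rewrite p_hom.2.
  exact: (@deg_lie _ 1 1 _ _ (deg_gen _) (deg_gen _)).
exists (lie x (lgen (v l))); last by rewrite p_hom.2 -E /lieB /lfold foldl_rcons.
by rewrite size_rcons -addn1; apply: deg_lie => //; apply: deg_gen.
Qed.

Definition lie_comp (k : nat) : set L := match k with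
  | 0 => [set 0]
  | 1 => lspan ((p \o @lgen V) @` (range v `|` Vc))
  | m.+2 => lspan [set x | exists i j s, size s = m /\ x = lieB i j s]
  end.

Lemma lie_comp0 k : lie_comp k 0.
Proof. by case: k => [|[|k]] //; apply: span_0. Qed.
Lemma lie_compD k x y : lie_comp k x -> lie_comp k y -> lie_comp k (x + y).
Proof.
case: k => [|[|k]]; [by move=> -> ->; rewrite addr0 | exact: span_D | exact: span_D].
Qed.
Lemma lie_compZ k a x : lie_comp k x -> lie_comp k (a *: x).
Proof. case: k => [|[|k]]; [by move=> ->; rewrite scaler0 | exact: span_Z | exact: span_Z]. Qed.

Lemma lie_comp_lie1 k x y : lie_comp k x -> lie_comp 1 y -> lie_comp k.+1 (lie x y).
Proof.
move=> Cx Cy; elim: Cy => [_ [w Sw <-]||u u' _ Cu _ Cu'|a u _ Cu]; first last.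
- by rewrite lieZr; apply: lie_compZ.
- by rewrite lieDr; apply: lie_compD.
- by rewrite lie0r; apply: lie_comp0.
case: Sw => [[l _ <-]|Vw]; last first.
  by have -> : lie x ((p \o @lgen V) w) = 0 by [exact: Vcentral]; apply: lie_comp0.
case: k Cx => [->|[|m]]; first by rewrite lie0l; apply: lie_comp0.
- elim=> [_ [w' Sw' <-]||u u' _ Cu _ Cu'|a u _ Cu]; first last.
  + by rewrite lieZl; apply: lie_compZ.
  + by rewrite lieDl; apply: lie_compD.
  + by rewrite lie0l; apply: lie_comp0.
  case: Sw' => [[i _ <-]|Vw']; last first.
    have -> : lie ((p \o @lgen V) w') (c l) = 0 by rewrite lieC [lie _ _]Vcentral // oppr0.
    exact: lie_comp0.
  by apply: span_in; exists i, l, [::].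
- elim=> [_ [i [j [s [sm ->]]]]||u u' _ Cu _ Cu'|a u _ Cu]; first last.
  + by rewrite lieZl; apply: lie_compZ.
  + by rewrite lieDl; apply: lie_compD.
  + by rewrite lie0l; apply: lie_comp0.
  apply: span_in; exists i, j, (rcons s l); rewrite size_rcons sm; split=> //.
  by rewrite /lieB /lfold foldl_rcons.
Qed.

Lemma lie_comp_derived m x : lie_comp m.+2 x -> derived x.
Proof.
apply: lspan_ind => _ [i [j [s [_ ->]]]]; rewrite /lieB.
by elim/last_ind: s => [|s l IH]; rewrite /lfold ?foldl_rcons; apply: derived_lie.
Qed.

Lemma lie_deg_comp k x : lie_deg k x -> lie_comp k (p x).
Proof.
elim=> [w|{}k|{}k y z _ Cy _ Cz|{}k a y _ Cy|i j y z _ Cy _ Cz].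
- apply: (lspan_linear (f := fun w => p (lgen w))) (Vspan w) => [a u u'|u Su].
    by rewrite lgen_linear p_hom.1.
  by apply: span_in; exists u.
- by rewrite (linear_fun0 p_hom.1); apply: lie_comp0.
- by rewrite (linear_funD p_hom.1); apply: lie_compD.
- by rewrite (linear_funZ p_hom.1); apply: lie_compZ.
rewrite p_hom.2; case: j Cz => [->|[|j]]; first by rewrite lie0r; apply: lie_comp0.
  by move=> Cz; rewrite addn1; apply: lie_comp_lie1.
case: i Cy => [->|[|i] Cy] Cz; first by rewrite lie0l; apply: lie_comp0.
  rewrite lieC -scaleN1r; apply: lie_compZ; rewrite add1n; exact: lie_comp_lie1.
rewrite derived_comm; [exact: lie_comp0 | exact: lie_comp_derived Cy | exact: lie_comp_derived Cz].
Qed.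

Lemma lie_deg_span_basic m x : lie_deg m.+2 x ->
  lspan (range (@basic_val _ m pred0 _ lieB)) (p x).
Proof.
move=> /lie_deg_comp; apply: lspan_ind => _ [i [j [s [sm ->]]]].
apply: span_basic => //.
- by move=> *; apply: lieB_alt.
- by move=> *; apply: lieB_perm.
- by move=> *; apply: lieB_jacobi.
Qed.
End MetabelianLie.

(* The semidirect product of the abelian Lie algebra R acting by              *)
(* multiplication on the abelian Lie algebra R^n.                             *)
Definition koszul_lie n (R : comAlgType rat) := (R * ('I_n -> R))%type.
HB.instance Definition _ n (R : comAlgType rat) :=
  GRing.Lmodule.copy (koszul_lie n R) (R * ('I_n -> R))%type.

Section KoszulLie.
Variables (n : nat) (R : comAlgType rat).
Local Notation T := (koszul_lie n R).
Definition koszul_bracket (x y : T) : T := (0, fun q => x.1 * y.2 q - y.1 * x.2 q).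

Fact koszul_linearl y : linear (koszul_bracket^~ y).
Proof.
move=> k x x'; congr (_, _); first by rewrite /= scaler0 addr0.
apply/funext => q; rewrite /koszul_bracket /=.
have E (a a' b c c' d : R) : (k *: a + a') * b - d * (k *: c + c') =
    k *: (a * b - d * c) + (a' * b - d * c').
  by rewrite mulrDl mulrDr -scalerAl -scalerAr scalerBr opprD addrACA.
exact: E.
Qed.
Fact koszul_xx x : koszul_bracket x x = 0.
Proof. by congr (_, _); apply/funext => q; rewrite subrr. Qed.
Fact koszul_linearr x : linear (koszul_bracket x).
Proof.
have C y z : koszul_bracket y z = - koszul_bracket z y.
  congr (_, _); first by rewrite /= oppr0.
  apply/funext => q; have E (a c : R) : a - c = - (c - a) by rewrite opprB.
  exact: E.
by move=> k y z; rewrite C koszul_linearl (C _ y) (C _ z) scalerN opprD.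
Qed.
Fact koszul_jacobi x y z : koszul_bracket x (koszul_bracket y z) +
  koszul_bracket y (koszul_bracket z x) + koszul_bracket z (koszul_bracket x y) = 0.
Proof.
congr (_, _); first by rewrite /= !addr0.
apply/funext => q.
have E (a b c a' b' c' : R) : (a * (b * c' - c * b') - 0 * a') +
   (b * (c * a' - a * c') - 0 * b') + (c * (a * b' - b * a') - 0 * c') = 0.
  by ring.
exact: E.
Qed.
HB.instance Definition _ := isLieAlgebra.Build T
  koszul_linearl koszul_linearr koszul_xx koszul_jacobi.
End KoszulLie.

(** * Homology and cup products of Seifert groups *)

Section WedgeTheory.
Variable V : lmodType rat.

Lemma wedge_span (w : wedge2 V) : lspan [set wedge p.1 p.2 | p in setT] w.
Proof.
rewrite -[w]lpiK (linext_malg (repr w)) linear_sum; apply: lspan_sum => -[x y] _.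
by rewrite linearZ; apply/span_Z/span_in; exists (x, y).
Qed.

Lemma wedge_ext (W : lmodType rat) (f h : wedge2 V -> W) : linear f -> linear h ->
  (forall u v, f (wedge u v) = h (wedge u v)) -> forall w, f w = h w.
Proof.
move=> fL hL E w; elim: (wedge_span w) => [_ [[u v] _ <-]||u v _ Eu _ Ev|k u _ Eu].
- exact: E.
- by rewrite (linear_fun0 fL) (linear_fun0 hL).
- by rewrite (linear_funD fL) (linear_funD hL) Eu Ev.
- by rewrite (linear_funZ fL) (linear_funZ hL) Eu.
Qed.

Let lie_lgenl (w : V) : linear (fun v => lie (lgen v) (lgen w)).
Proof. by move=> k u v; rewrite lgen_linear lie_linearl. Qed.
Let lie_lgenr (w : V) : linear (fun v => lie (lgen w) (lgen v)).
Proof. by move=> k u v; rewrite lgen_linear lie_linearr. Qed.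
Let lie_lgen_xx (w : V) : lie (lgen w) (lgen w) = 0.
Proof. exact: liexx. Qed.

Lemma wedge_lie_linear : linear (@wedge_lie V).
Proof. exact: (wedge_lift_linear lie_lgenl lie_lgenr lie_lgen_xx). Qed.
Lemma wedge_lie_wedge u v : wedge_lie (wedge u v) = lie (lgen u) (lgen v) :> freeLie V.
Proof. exact: (wedge_liftE lie_lgenl lie_lgenr lie_lgen_xx). Qed.
End WedgeTheory.

Section Homology.
Variable G : groupType.

Definition h1 (x : G) : H_1 G := lpi (range (@bar_d2 G)) << x >>.

Lemma bar_d2U (x y : G) : bar_d2 << (x, y) >> = << y >> - << (x * y)%g >> + << x >>.
Proof. by rewrite /bar_d2 linextU. Qed.

Lemma bar_d2_linear : linear (@bar_d2 G).
Proof. exact: linext_is_linear. Qed.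

Lemma h1M x y : h1 (x * y)%g = h1 x + h1 y.
Proof.
rewrite /h1 lpiD; apply/lquotP/span_in; exists (- << (x, y) >>) => //.
by rewrite (linear_funN bar_d2_linear) bar_d2U opprD opprB -addrA -opprD [_ + << x >>]addrC.
Qed.

Lemma h1_span v : lspan (range h1) v.
Proof.
rewrite -[v]lpiK (linext_malg (repr v)) linear_sum; apply: lspan_sum => x _.
by rewrite linearZ; apply/span_Z/span_in; exists x.
Qed.

Fact coh_subproof (f : G -> rat^o) : (forall x y, f (x * y)%g = f x + f y) ->
  `[< lspan [set f | cobar_d1 f = 0] (f : cobar1 G) >].
Proof.
move=> fM; apply/asboolP/span_in/funext => -[x y]; rewrite /cobar_d1 /= fM.
have E (a c : rat) : c - (a + c) + a = 0 by ring.
exact: E.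
Qed.
Definition coh f (fM : forall x y, f (x * y)%g = f x + f y) : coH1 G :=
  exist _ (f : cobar1 G) (coh_subproof fM).

Definition cup_pairing (f u : coH1 G) (z : bar2 G) : rat^o :=
  linext (cup_cochain f u : (G * G)%type -> rat^o) z.

Lemma cup_pairing_linear f u : linear (cup_pairing f u).
Proof. exact: linext_is_linear. Qed.

Lemma cup_pairingU f u x y :
  cup_pairing f u << (x, y) >> = (val f : G -> rat) x * (val u : G -> rat) y.
Proof. by rewrite /cup_pairing linextU. Qed.

Lemma kron2_cup f u (z : cycles2 G) : kron2 (cup f u) (lpi _ z) = cup_pairing f u (val z).
Proof. exact: kron2E. Qed.

Lemma cup_pairing_antisym f u z : bar_d2 z = 0 -> cup_pairing f u z = - cup_pairing u f z.
Proof.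
move=> dz; apply/eqP; rewrite -addr_eq0; apply/eqP.
have := linext_cobar_d1 (fun x => - ((val f : G -> rat) x * (val u : G -> rat) x)) z.
rewrite dz linear0 => <-; have := linext_funP z (cup_cochain f u) (cup_cochain u f) 1.
rewrite scale1r => <-; congr linext; apply/funext => -[x y].
rewrite scale1r /cobar_d1 /cup_cochain /= !coH1M.
have E (a b c d : rat) : a * d + c * b = - (b * d) - - ((a + b) * (c + d)) + - (a * c) by ring.
exact: E.
Qed.

Let wedge_lift_comb (B B' B'' : H_1 G -> H_1 G -> rat^o) k t :
  (forall a b, B'' a b = k *: B a b + B' a b) ->
  wedge_lift B'' t = k *: wedge_lift B t + wedge_lift B' t.
Proof.
move=> BE; rewrite /wedge_lift /lquot_lift -linext_funP.
by congr linext; apply/funext => p; rewrite BE.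
Qed.

Let kron_wedgel t (u : coH1 G) : linear (fun f => wedge_lift (kron_det f u) t).
Proof.
move=> k f1 f2; apply: wedge_lift_comb => x y; rewrite /kron_det !kron1_linearl.
have E (a b c d p q : rat) : (k * a + b) * c - (k * d + p) * q =
  k * (a * c - d * q) + (b * c - p * q) by ring.
exact: E.
Qed.
Let kron_wedger t (f : coH1 G) : linear (fun u => wedge_lift (kron_det f u) t).
Proof.
move=> k f1 f2; apply: wedge_lift_comb => x y; rewrite /kron_det !kron1_linearl.
have E (a b c d p q : rat) : c * (k * a + b) - q * (k * d + p) =
  k * (c * a - q * d) + (c * b - q * p) by ring.
exact: E.
Qed.
Let kron_wedge_xx t (f : coH1 G) : wedge_lift (kron_det f f) t = 0.
Proof.
rewrite /wedge_lift /lquot_lift; apply: linext0 => p.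
by rewrite /kron_det mulrC subrr.
Qed.

Lemma kron_wedge_wedge (f u : coH1 G) t : kron_wedge (wedge f u) t = wedge_lift (kron_det f u) t.
Proof. exact: (wedge_liftE (kron_wedgel t) (kron_wedger t) (kron_wedge_xx t)). Qed.

Lemma kron_wedge_linear (t : wedge2 (H_1 G)) : linear (fun w => kron_wedge w t).
Proof. exact: (wedge_lift_linear (kron_wedgel t) (kron_wedger t) (kron_wedge_xx t)). Qed.

Lemma kron_det_lift_linear (f u : coH1 G) :
  linear (wedge_lift (kron_det f u) : wedge2 (H_1 G) -> rat^o).
Proof.
exact: (wedge_lift_linear (kron_det_linearl f u) (kron_det_linearr f u) (kron_det_alt f u)).
Qed.

Lemma kron_det_liftE (f u : coH1 G) a b : wedge_lift (kron_det f u) (wedge a b) = kron_det f u a b.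
Proof.
exact: (wedge_liftE (kron_det_linearl f u) (kron_det_linearr f u) (kron_det_alt f u)).
Qed.

Lemma kron2_linear (c : H_2 G) : linear (fun f => kron2 f c).
Proof.
move=> k a a'; rewrite -[c]lpiK -[a]lpiK -[a']lpiK -linearP !kron2E.
exact: linext_funP.
Qed.

Lemma mu_linear : linear (@mu G).
Proof. exact: (wedge_lift_linear (@cup_linearl G) (@cup_linearr G) (@cup_alt G)). Qed.

Lemma mu_dualP (z : bar2 G) (dz : bar_d2 z = 0) t :
  (forall f u, wedge_lift (kron_det f u) t = cup_pairing f u z) ->
  exists c, mu_dual c t.
Proof.
move=> E; have zP : `[< lspan [set c | bar_d2 c = 0] z >] by apply/asboolP/span_in.
pose z' : cycles2 G := exist _ z zP.
exists (lpi _ z'); apply: wedge_ext; first exact: kron_wedge_linear.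
  move=> k w w'; rewrite mu_linear; exact: kron2_linear.
by move=> f u; rewrite kron_wedge_wedge E mu_wedge kron2_cup.
Qed.

Lemma kron_detE (f u : coH1 G) x y : kron_det f u (h1 x) (h1 y) =
  (val f : G -> rat) x * (val u : G -> rat) y - (val f : G -> rat) y * (val u : G -> rat) x.
Proof. by rewrite /kron_det !kron1E. Qed.

Lemma mu_dual_commute x y : commute x y -> exists c, mu_dual c (wedge (h1 x) (h1 y)).
Proof.
move=> xy; apply: (@mu_dualP (<< (x, y) >> - << (y, x) >>)).
  rewrite (linear_funD bar_d2_linear) (linear_funN bar_d2_linear) !bar_d2U -xy.
  have E (a b d : bar1 G) : a - b + d - (d - b + a) = 0.
    by have -> : a - b + d = d - b + a by [rewrite addrAC [a + d]addrC addrAC]; rewrite subrr.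
  exact: E.
move=> f u; rewrite kron_det_liftE kron_detE.
have L := cup_pairing_linear f u.
by rewrite (linear_funD L) (linear_funN L) !cup_pairingU.
Qed.

Definition comm_chain (x y : G) : bar2 G :=
  << ((y * x)%g, [~ x, y]%g) >> + << (y, x) >> - << (x, y) >>.

Lemma comm_chain_d x y : bar_d2 (comm_chain x y) = << [~ x, y]%g >>.
Proof.
have L := bar_d2_linear.
rewrite /comm_chain (linear_funD L) (linear_funN L) (linear_funD L).
rewrite (bar_d2U (y * x)%g) (bar_d2U y) (bar_d2U x) -(commgC x y).
have E (p q r u v : bar1 G) : p - q + r + (u - r + v) - (v - q + u) = p.
  rewrite -[p - q + r + _]addrA [u - r + v]addrAC [r + _]addrC subrK.
  by rewrite [v - q + u]addrAC [v + u]addrC opprB [LHS]addrA [_ + q]addrAC subrK addrK.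
exact: E.
Qed.

Lemma comm_chain_pairing f u x y :
  cup_pairing f u (comm_chain x y) = - kron_det f u (h1 x) (h1 y).
Proof.
have L := cup_pairing_linear f u.
rewrite /comm_chain (linear_funD L) (linear_funN L) (linear_funD L).
rewrite (cup_pairingU f u (y * x)%g) (cup_pairingU f u y) (cup_pairingU f u x).
have -> : (val u : G -> rat) [~ x, y]%g = 0 by exact: (add_homR (W := rat^o) (@coH1M _ u)).
rewrite kron_detE.
have E (p q r t w : rat) : w * 0 + p * q - r * t = - (r * t - p * q) by ring.
exact: E.
Qed.

Definition hpi : freeLie (H_1 G) -> holonomy_metab G := @holonomy_metab_pi G.

Lemma hpi_hom : lie_hom hpi.
Proof.
have h1 := lie_pi_hom [set wedge_lie t | t in [set t | exists c : H_2 G, mu_dual c t]].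
have h2 := lie_pi_hom (@lie_derived2 (holonomy G)).
split=> [k x y|x y]; rewrite /hpi /holonomy_metab_pi.
  by rewrite h1.1 h2.1.
by rewrite h1.2 h2.2.
Qed.

Lemma hpi_rel c t : mu_dual c t -> hpi (wedge_lie t) = 0.
Proof.
move=> ct; rewrite /hpi /holonomy_metab_pi.
have -> : lie_pi _ (wedge_lie t) = 0 :> holonomy G.
  by apply/lie_pi_eq0/lideal_in; exists t => //; exists c.
exact: (linear_fun0 (@lie_pi_linear _ _)).
Qed.

Lemma hpi_metab (a b c d : holonomy_metab G) : lie (lie a b) (lie c d) = 0.
Proof.
have P := lie_pi_hom (@lie_derived2 (holonomy G)).
have [[x ->] [y ->]] := conj (lie_pi_surj a) (lie_pi_surj b).
have [[u ->] [v ->]] := conj (lie_pi_surj c) (lie_pi_surj d).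
rewrite -(P.2 x y) -(P.2 u v) -(P.2 (lie x y) (lie u v)); apply/lie_pi_eq0/lideal_in/span_in.
exists (lie x y), (lie u v).
have D (s t : holonomy G) : lie_commutator setT setT (lie s t).
  by apply: span_in; exists s, t.
by split; [exact: D | exact: D |].
Qed.

Lemma holonomy_lift (T : lieAlgType) (I : set T) (f : H_1 G -> T) : linear f ->
  (forall a b c d : T, lie (lie a b) (lie c d) = 0) ->
  (forall c t, mu_dual c t -> lideal I (freeLie_lift f (wedge_lie t))) ->
  exists2 F : holonomy_metab G -> lie_quot I, lie_hom F &
    forall x, F (hpi x) = lie_pi I (freeLie_lift f x).
Proof.
move=> fL Tmet fI; have fH := freeLie_lift_hom fL; have pH := lie_pi_hom I.
have Qmet (a b c d : lie_quot I) : lie (lie a b) (lie c d) = 0.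
  have [[x ->] [y ->]] := conj (lie_pi_surj a) (lie_pi_surj b).
  have [[u ->] [v ->]] := conj (lie_pi_surj c) (lie_pi_surj d).
  by rewrite -(pH.2 x y) -(pH.2 u v) -(pH.2 (lie x y) (lie u v)) Tmet (linear_fun0 pH.1).
pose p x := lie_pi I (freeLie_lift f x).
have ph : lie_hom p.
  by split=> [k x y|x y]; rewrite /p ?fH.1 ?fH.2 ?pH.1 ?pH.2.
have [|q qh qE] := lie_quot_lift ph
  (S := [set wedge_lie t | t in [set t | exists c : H_2 G, mu_dual c t]]).
  by move=> _ [t [c ct] <-]; apply/lie_pi_eq0; apply: fI ct.
have [|F Fh FE] := lie_quot_lift qh (S := @lie_derived2 (holonomy G)).
  move=> x Dx; apply: (lie2_derived2 Qmet).
  have qD u : lie_commutator setT setT u -> lie_commutator setT setT (q u).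
    apply: lspan_linear => [|_ [a [b [_ _ ->]]]]; first exact: qh.1.
    by rewrite qh.2; apply: span_in; exists (q a), (q b).
  apply: (lspan_linear qh.1) Dx => _ [a [b [Da Db ->]]]; rewrite qh.2.
  by apply: span_in; exists (q a), (q b); split=> //; apply: qD.
by exists F => // x; rewrite /hpi /holonomy_metab_pi FE qE.
Qed.
End Homology.

Lemma koszul_metab n (R : comAlgType rat) (a b c d : koszul_lie n R) :
  lie (lie a b) (lie c d) = 0.
Proof.
congr (_, _); apply/funext => q.
have E (x y : R) : 0 * x - 0 * y = 0 by rewrite !mul0r subrr.
exact: E.
Qed.

Lemma koszul_lideal n (R : comAlgType rat) (w : 'I_n -> R) (x : koszul_lie n R) :
  lideal [set (0, w) : koszul_lie n R] x -> x.1 = 0 /\ lineq w x.2.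
Proof.
elim=> [_ ->||u v _ [u1 u2] _ [v1 v2]|k u _ [u1 u2]|u v _ [v1 v2]] /=.
- by split=> //; exists 1; apply/funext => q; rewrite mul1r.
- by split=> //; exists 0; apply/funext => q; rewrite mul0r.
- split; first by rewrite u1 v1 addr0.
  by apply: lspan_lineq; apply: span_D; apply: span_in.
- split; first by rewrite u1 scaler0.
  by apply: lspan_lineq; apply: span_Z; apply: span_in.
- split=> //; case: v2 => r rE; exists (u.1 * r); apply/funext => q.
  have E (a c d : R) : v.1 = 0 -> v.2 q = c * d -> a * v.2 q - v.1 * u.2 q = a * c * d.
    by move=> -> ->; rewrite mul0r subr0 mulrA.
  by apply: E => //; rewrite rE.
Qed.

Definition ab_lie (V : lmodType rat) : Type := V.
HB.instance Definition _ (V : lmodType rat) := GRing.Lmodule.copy (ab_lie V) V.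
Section AbLie.
Variable V : lmodType rat.
Let br (x y : ab_lie V) : ab_lie V := 0.
Fact ab_linearl y : linear (br^~ y).
Proof. by move=> k u v; rewrite /br scaler0 addr0. Qed.
Fact ab_linearr x : linear (br x).
Proof. by move=> k u v; rewrite /br scaler0 addr0. Qed.
Fact ab_xx x : br x x = 0. Proof. by []. Qed.
Fact ab_jacobi x y z : br x (br y z) + br y (br z x) + br z (br x y) = 0.
Proof. by rewrite /br !addr0. Qed.
HB.instance Definition _ := isLieAlgebra.Build (ab_lie V)
  ab_linearl ab_linearr ab_xx ab_jacobi.
End AbLie.

Lemma lideal0 (L : lieAlgType) (x : L) : lideal set0 x -> x = 0.
Proof.
elim=> [//|//|u v _ -> _ ->|k u _ ->|u v _ ->]; first exact: addr0.
- exact: scaler0.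
- exact: lie0r.
Qed.

Lemma holonomy_deg1_indep (G : groupType) (J : finType) (v : J -> H_1 G) :
  indep v -> indep (fun j => @hpi G (lgen (v j))).
Proof.
move=> vI; pose f (x : H_1 G) : ab_lie (H_1 G) := x.
have fL : linear f by [].
have [||F Fh FE] := @holonomy_lift G (ab_lie (H_1 G)) set0 f fL; first by [].
  move=> c t _; suff -> : freeLie_lift f (wedge_lie t) = 0 by apply: lideal_0.
  have [fhL fhl] := freeLie_lift_hom fL.
  apply: (wedge_ext (f := fun t => freeLie_lift f (wedge_lie t)) (h := fun=> 0)) t.
  - by move=> k u w; rewrite wedge_lie_linear fhL.
  - by move=> k u w; rewrite scaler0 addr0.
  - by move=> u w; rewrite wedge_lie_wedge fhl.
move=> c cE; apply: vI.
have := congr1 F cE; rewrite (linear_fun_sum _ _ _ Fh.1) (linear_fun0 Fh.1).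
under eq_bigr => j _ do rewrite (linear_funZ Fh.1) FE (freeLie_lift_gen fL).
have pL := (lie_pi_hom (set0 : set (ab_lie (H_1 G)))).1.
under eq_bigr => j _ do rewrite -(linear_funZ pL).
by rewrite -(linear_fun_sum _ _ _ pL) => /lie_pi_eq0 /lideal0.
Qed.

Lemma add_hom_ext (K : groupType) (W : lmodType rat) (f f' : K -> W) (S : set K) :
  (forall x y, f (x * y)%g = f x + f y) -> (forall x y, f' (x * y)%g = f' x + f' y) ->
  (forall x, S x -> f x = f' x) -> forall x, gen S x -> f x = f' x.
Proof.
move=> fM f'M E x; elim=> [y /E//||y z _ Ey _ Ez|y _ Ey].
- by rewrite !add_hom1.
- by rewrite fM f'M Ey Ez.
- by rewrite !add_homV // Ey.
Qed.

Lemma linext_sum_fun (X : choiceType) (J : Type) (r : seq J) (F : J -> X -> rat^o) z :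
  linext (fun x => \sum_(j <- r) F j x) z = \sum_(j <- r) linext (F j) z.
Proof.
rewrite /linext exchange_big; apply: eq_bigr => x _ /=.
by rewrite scaler_sumr.
Qed.

Section SeifertHomology.
Variables (g s : nat) (b : int) (alpha beta : 'I_s -> int).
Hypothesis alpha_ge2 : forall i, 2 <= alpha i.
Local Notation G := (seifert_group g b alpha beta).
Local Notation e := (euler_number b alpha beta).
Local Notation V := ('I_(g + g) -> rat^o).
Local Notation x_ := (@seif_x g s b alpha beta).
Local Notation z_ := (@seif_z g s b alpha beta).
Local Notation h_ := (seif_h g b alpha beta).
Local Notation rel := (seifert_group_rel g b alpha beta).

Lemma seifert_xi : exists Xi : G -> V, [/\ forall x y, Xi (x * y)%g = Xi x + Xi y,
  forall i, Xi (x_ i) = unitv i, Xi h_ = 0 &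
  forall M k, omega_pairing M = - (e * k) -> exists phi : G -> rat^o,
    [/\ forall x y, phi (x * y)%g = phi x + phi y + bform M (Xi x) (Xi y),
        forall i, phi (x_ i) = 0 & phi h_ = k]].
Proof.
have [|f0 [f0M f0x f0z f0h]] := @seifert_heis g s b _ beta alpha_ge2 (fun _ _ => 0) 0.
  by rewrite mulr0 oppr0 /omega_pairing big1 // => a _; rewrite subrr.
have add0 x y : (f0 (x * y)%g).1 = (f0 x).1 + (f0 y).1 by rewrite f0M.
exists (fun x => (f0 x).1); split; [exact: add0 | by move=> i; rewrite f0x | by rewrite f0h |].
move=> M k /(seifert_heis alpha_ge2) [f [fM fx fz fh]].
have add x y : (f (x * y)%g).1 = (f x).1 + (f y).1 by rewrite fM.
have E x : (f x).1 = (f0 x).1.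
  apply: (add_hom_ext (f := fun x => (f x).1) add add0) (seifert_group_gen x).
  by move=> _ [[[i _ <-]|[i _ <-]]|->]; rewrite ?fx ?f0x ?fz ?f0z ?fh ?f0h.
exists (fun x => (f x).2); split; [|by move=> i; rewrite fx|by rewrite fh].
by move=> x y; rewrite -!E fM.
Qed.

Lemma seifert_h1_gen v :
  lspan (range (fun i => h1 (x_ i)) `|` [set h1 h_]) v.
Proof.
apply: lspan_ind (h1_span v) => _ [x _ <-].
apply: (additive_gen_span (f := @h1 G)) (seifert_group_gen x); first exact: h1M.
move=> _ [[[i _ <-]|[i _ <-]]|->].
- by apply: span_in; left; exists i.
- rewrite (seifert_hom_Z alpha_ge2 rel _ (@h1M _)).
  by apply/span_Z/span_in; right.
- by apply: span_in; right.
Qed.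

Lemma seifert_h1_h : e != 0 -> h1 h_ = 0.
Proof.
move=> e0; have /eqP := seifert_hom_h alpha_ge2 rel (@h1M _).
by rewrite scaler_eq0 (negbTE e0) => /eqP.
Qed.

(* Two 1-cocycles are proportional along such elements, so cup products       *)
(* evaluate symmetrically on the bar chains built from them.                  *)
Definition h_like : set G :=
  [set x | exists q : rat, forall f : coH1 G,
     (val f : G -> rat) x = q * (val f : G -> rat) h_].

Lemma h_like_gen x : gen h_like x -> h_like x.
Proof.
elim=> [//||u v _ [q qE] _ [r rE]|u _ [q qE]].
- by exists 0 => f; rewrite mul0r (add_hom1 (W := rat^o) (@coH1M _ f)).
- by exists (q + r) => f; rewrite coH1M qE rE mulrDl.
- by exists (- q) => f; rewrite (add_homV (W := rat^o) (@coH1M _ f)) qE mulNr.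
Qed.

Definition sym_boundary : set (bar1 G) := [set w | exists2 y, w = bar_d2 y &
  forall f u, cup_pairing f u y = cup_pairing u f y].

Lemma sym_boundary_span w : lspan sym_boundary w -> sym_boundary w.
Proof.
have L := @bar_d2_linear G; have P := @cup_pairing_linear G.
elim=> [//||_ _ _ [y -> ys] _ [z -> zs]|k _ _ [y -> ys]].
- by exists 0 => [|f u]; rewrite ?(linear_fun0 L) // !(linear_fun0 (P _ _)).
- exists (y + z) => [|f u]; first by rewrite (linear_funD L).
  by rewrite !(linear_funD (P _ _)) ys zs.
- exists (k *: y) => [|f u]; first by rewrite (linear_funZ L).
  by rewrite !(linear_funZ (P _ _)) ys.
Qed.

Lemma sym_boundary_commutators : e = 0 ->
  sym_boundary (\sum_(a < g) << [~ x_ (sx a), x_ (sy a)]%g >>).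
Proof.
move=> e0; apply: sym_boundary_span.
pose K := subgrp h_like; pose kap (x : K) := lpi sym_boundary << (val x : G) >>.
have mk x : h_like x -> exists x' : K, val x' = x.
  move=> hx; have p : `[< gen h_like x >] by apply/asboolP/gen_in.
  by exists (exist _ x p).
have kM (x y : K) : kap (x * y)%g = kap x + kap y.
  rewrite /kap lpiD; apply/lquotP/span_in; exists (- << (val x, val y) >>).
    rewrite (linear_funN (@bar_d2_linear G)) bar_d2U.
    have E (p q r : bar1 G) : p - (q + r) = - (r - p + q).
      by rewrite [q + r]addrC !opprD opprK addrA [p - r]addrC.
    exact: E.
  move=> f u; rewrite !(linear_funN (@cup_pairing_linear G _ _)) !cup_pairingU.
  have [q qE] := h_like_gen (asboolW (valP x)); have [r rE] := h_like_gen (asboolW (valP y)).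
  rewrite !qE !rE; congr (- _); ring.
have vM : {morph (val : K -> G) : x y / (x * y)%g} by move=> x y.
have [h' h'E] : exists x' : K, val x' = h_ by apply: mk; exists 1 => f; rewrite mul1r.
have /choice [Z' Z'E] i : exists x' : K, val x' = z_ i.
  apply: mk; exists (- ((beta i)%:~R / (alpha i)%:~R)) => f.
  exact: (seifert_hom_Z alpha_ge2 rel (W := rat^o) _ (@coH1M _ f)).
have /choice [C' C'E] a : exists x' : K, val x' = [~ x_ (sx a), x_ (sy a)]%g.
  apply: mk; exists 0 => f; rewrite mul0r.
  exact: (add_homR (W := rat^o) (@coH1M _ f)).
have := add_hom_euler (h := h') (Z := Z') (c := (\prod_(a < g) C' a)%g)
  (b := b) (beta := beta) alpha_ge2 kM.
rewrite e0 scale0r oppr0 (add_hom_prod kM) => E.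
have {}E : \sum_(a < g) kap (C' a) = 0.
  apply: E.
  - apply: val_inj; rewrite vM !(hom_prod vM) (hom_expgz vM) h'E -(sr_prod rel).
    by congr (_ * _)%g; apply: eq_bigr => i _.
  - by move=> i; apply: val_inj; rewrite vM !(hom_expgz vM) h'E Z'E (sr_root rel).
rewrite -[X in lspan _ X]subr0; apply/lquotP; rewrite [RHS](linear0 (lpi _)) -[RHS]E.
by rewrite linear_sum; apply: eq_bigr => a _; rewrite /kap C'E.
Qed.

Lemma seifert_mu_dual : e = 0 ->
  exists c, mu_dual c (\sum_(a < g) wedge (h1 (x_ (sx a))) (h1 (x_ (sy a)))).
Proof.
move=> e0; have [y dy ys] := sym_boundary_commutators e0.
pose z : bar2 G := y - \sum_(a < g) comm_chain (x_ (sx a)) (x_ (sy a)).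
have L := @bar_d2_linear G.
have dz : bar_d2 z = 0.
  rewrite /z (linear_funD L) (linear_funN L) (linear_fun_sum _ _ _ L) -dy.
  by under [X in _ - X]eq_bigr => a _ do rewrite comm_chain_d; rewrite subrr.
apply: (mu_dualP dz) => f u.
have zE f' u' : cup_pairing f' u' z = cup_pairing f' u' y +
    \sum_(a < g) kron_det f' u' (h1 (x_ (sx a))) (h1 (x_ (sy a))).
  have P := @cup_pairing_linear G f' u'.
  rewrite (linear_funD P) (linear_funN P) (linear_fun_sum _ _ _ P) -sumrN; congr (_ + _).
  by apply: eq_bigr => a _; rewrite comm_chain_pairing opprK.
have K0 : \sum_(a < g) kron_det f u (h1 (x_ (sx a))) (h1 (x_ (sy a))) +
    \sum_(a < g) kron_det u f (h1 (x_ (sx a))) (h1 (x_ (sy a))) = 0.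
  rewrite -big_split big1 // => a _.
  have E (p q r t : rat) : p * q - r * t + (t * r - q * p) = 0 by ring.
  exact: E.
have y0 : cup_pairing f u y = 0.
  have /eqP := cup_pairing_antisym f u dz; rewrite -addr_eq0 !zE (ys u f) addrACA K0.
  by rewrite addr0 -mulr2n mulrn_eq0 => /eqP.
rewrite zE y0 add0r (linear_fun_sum _ _ _ (@kron_det_lift_linear G f u)).
by apply: eq_bigr => a _; rewrite kron_det_liftE.
Qed.
End SeifertHomology.

Section SeifertHolonomy.
Variables (g s : nat) (b : int) (alpha beta : 'I_s -> int).
Hypothesis alpha_ge2 : forall i, 2 <= alpha i.
Local Notation G := (seifert_group g b alpha beta).
Local Notation e := (euler_number b alpha beta).
Local Notation V := ('I_(g + g) -> rat^o).
Local Notation x_ := (@seif_x g s b alpha beta).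
Local Notation h_ := (seif_h g b alpha beta).

Section Xi.
Variable Xi : G -> V.
Hypothesis XiM : forall x y, Xi (x * y)%g = Xi x + Xi y.
Hypothesis Xix : forall i, Xi (x_ i) = unitv i.
Hypothesis Xih : Xi h_ = 0.
Hypothesis Xiphi : forall M k, omega_pairing M = - (e * k) -> exists phi : G -> rat^o,
    [/\ forall x y, phi (x * y)%g = phi x + phi y + bform M (Xi x) (Xi y),
        forall i, phi (x_ i) = 0 & phi h_ = k].

Definition xi (i : 'I_(g + g)) : coH1 G :=
  coh (f := fun x => Xi x i) (fun x y => congr1 (fun v : V => v i) (XiM x y)).

Lemma xi_pairing0 M k (z : bar2 G) : omega_pairing M = - (e * k) -> bar_d2 z = 0 ->
  \sum_i \sum_j M i j *: cup_pairing (xi i) (xi j) z = 0.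
Proof.
move=> /Xiphi [phi [phiM _ _]] dz.
have := linext_cobar_d1 (fun x => - phi x) z; rewrite dz linear0.
have -> : cobar_d1 (fun x => - phi x) =
    (fun p : (G * G)%type => \sum_i \sum_j M i j *: cup_cochain (xi i) (xi j) p).
  apply/funext => -[x y]; rewrite /cobar_d1 /= phiM.
  have E (p q r : rat) : - q - - (p + q + r) + - p = r by ring.
  apply: etrans (E _ _ _) _; rewrite /bform; apply: eq_bigr => i _; exact: eq_bigr.
rewrite linext_sum_fun => H; apply: etrans H; apply: eq_bigr => i _.
rewrite linext_sum_fun; apply: eq_bigr => j _; rewrite /cup_pairing.
have := linext_funP z (cup_cochain (xi i) (xi j)) (fun=> 0) (M i j).
rewrite [linext (fun=> 0) z]linext0 // addr0 => <-.
by congr linext; apply/funext => p; rewrite addr0.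
Qed.

Definition unitM (i j k l : 'I_(g + g)) : rat := ((k == i) && (l == j))%:R.

Lemma sum_unitM (N : 'I_(g + g) -> 'I_(g + g) -> rat^o) i j :
  \sum_k \sum_l unitM i j k l *: N k l = N i j.
Proof.
rewrite (bigD1 i) //= [X in _ + X]big1 ?addr0 => [|k /negbTE ki]; last first.
  by rewrite big1 // => l _; rewrite /unitM ki scale0r.
rewrite (bigD1 j) //= big1 ?addr0 => [|l /negbTE lj]; last by rewrite /unitM lj andbF scale0r.
by rewrite /unitM !eqxx scale1r.
Qed.

Lemma omega_pairingB (M N : 'I_(g + g) -> 'I_(g + g) -> rat) k :
  omega_pairing (fun i j => M i j - k * N i j) =
  omega_pairing M - k * omega_pairing N :> rat.
Proof.
rewrite /omega_pairing mulr_sumr -sumrB; apply: eq_bigr => a _; ring.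
Qed.

Lemma xi_pairing_neq0 z i j : e != 0 -> bar_d2 z = 0 -> cup_pairing (xi i) (xi j) z = 0.
Proof.
move=> e0 dz; have := @xi_pairing0 (unitM i j) (- (omega_pairing (unitM i j) / e)) z.
rewrite sum_unitM; apply => //.
by rewrite mulrN opprK mulrC divfK.
Qed.

Lemma xi_pairing_eq0 z i j (a : 'I_g) : e = 0 -> bar_d2 z = 0 ->
  cup_pairing (xi i) (xi j) z =
  omega_pairing (unitM i j) *: cup_pairing (xi (sx a)) (xi (sy a)) z.
Proof.
move=> e0 dz; set w := omega_pairing (unitM i j).
have w1 : omega_pairing (unitM (sx a) (sy a)) = 1.
  have ll k l : (sx k == sx l :> 'I_(g + g)) = (k == l) by exact: (inj_eq (@lshift_inj _ _)).
  have rl k l : (sy k == sx l :> 'I_(g + g)) = false by exact: eq_rlshift.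
  rewrite /omega_pairing (bigD1 a) //= big1 => [|k /negbTE ka].
    by rewrite /unitM !eqxx rl addr0 subr0.
  by rewrite /unitM ll rl ka subrr.
have := @xi_pairing0 (fun k l => unitM i j k l - w * unitM (sx a) (sy a) k l) 0 z.
rewrite omega_pairingB w1 mulr1 subrr mulr0 oppr0 => /(_ erefl dz).
under eq_bigr => k _ do under eq_bigr => l _ do rewrite scalerBl -scalerA.
under eq_bigr => k _ do rewrite sumrB -scaler_sumr.
by rewrite sumrB -scaler_sumr !sum_unitM => /eqP; rewrite subr_eq0 => /eqP.
Qed.
End Xi.
End SeifertHolonomy.

(** * Holonomy Chen ranks of Seifert groups *)

Section KoszulMap.
Variables (G : groupType) (n : nat) (R : comAlgType rat) (X : 'I_n -> R).
Variable xs : 'I_n -> coH1 G.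

Definition kmap (v : H_1 G) : koszul_lie n R :=
  (\sum_i (kron1 (xs i) v : rat) *: X i, fun q => (kron1 (xs q) v : rat)%:A).

Lemma kmap_linear : linear kmap.
Proof.
move=> k u v; congr (_, _) => /=.
  rewrite scaler_sumr -big_split; apply: eq_bigr => i _ /=.
  by rewrite kron1_linearr scalerDl -scalerA.
apply/funext => q.
have E (a c : rat) : (k * a + c) *: (1 : R) = k *: (a *: 1) + c *: 1.
  by rewrite scalerDl scalerA.
by rewrite kron1_linearr; exact: E.
Qed.

Lemma kmap_wedge t : freeLie_lift kmap (wedge_lie t) =
  ((0, fun q => \sum_i (wedge_lift (kron_det (xs i) (xs q)) t : rat) *: X i)
    : koszul_lie n R).
Proof.
have [fL fl] := freeLie_lift_hom kmap_linear.
apply: (wedge_ext (f := fun t => freeLie_lift kmap (wedge_lie t)) (h := fun t =>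
  ((0, fun q => \sum_i (wedge_lift (kron_det (xs i) (xs q)) t : rat) *: X i)
    : koszul_lie n R))) t.
- by move=> k u w; rewrite wedge_lie_linear fL.
- move=> k u w; congr (_, _); first by rewrite /= scaler0 addr0.
  apply/funext => q; rewrite /= -[RHS]/(k *: \sum_i _ + \sum_i _) scaler_sumr -big_split.
  apply: eq_bigr => i _ /=.
  by rewrite (kron_det_lift_linear _ _) scalerDl -scalerA.
move=> u v; rewrite wedge_lie_wedge fl !(freeLie_lift_gen kmap_linear).
congr (_, _); apply/funext => q /=.
rewrite -!scalerAr !mulr1 !scaler_sumr -sumrB; apply: eq_bigr => i _.
rewrite kron_det_liftE.
have E (p q0 r t : rat) (x : R) : p *: (q0 *: x) - r *: (t *: x) = (q0 * p - t * r) *: x.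
  by rewrite !scalerA -scalerBl mulrC [r * t]mulrC.
exact: E.
Qed.

Variable v : 'I_n -> H_1 G.
Hypothesis xv : forall i j, kron1 (xs i) (v j) = (i == j)%:R.

Lemma kmap_v i : kmap (v i) = (X i, fun q => (q == i)%:R).
Proof.
congr (_, _).
  rewrite (bigD1 i) //= xv eqxx scale1r big1 ?addr0 // => j /negbTE ji.
  by rewrite xv ji scale0r.
by apply/funext => q; rewrite xv; case: eqP => _; rewrite ?scale1r ?scale0r.
Qed.

Lemma koszul_bracketE (x y : koszul_lie n R) :
  lie x y = ((0, fun q => x.1 * y.2 q - y.1 * x.2 q) : koszul_lie n R).
Proof. by []. Qed.

Lemma kmap_lieB i j s (p : freeLie (H_1 G) -> koszul_lie n R) : lie_hom p ->
  (forall w, p (lgen w) = kmap w) ->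
  lieB p v i j s = ((0, kvec X i j s) : koszul_lie n R).
Proof.
move=> ph pE; rewrite /lieB; elim/last_ind: s => [|s l IH].
  rewrite /= !pE !kmap_v koszul_bracketE; congr (_, _); apply/funext => q.
  by rewrite /kvec big_nil expr0 !mul1r /= !mulr_natr.
rewrite /lfold foldl_rcons -/(lfold _ _ s) IH pE kmap_v koszul_bracketE.
congr (_, _); apply/funext => q; rewrite kvec_rcons.
have E (a c d : R) : 0 * a - c * d = - (c * d) by rewrite mul0r sub0r.
exact: E.
Qed.
End KoszulMap.

Lemma lieB_hom (L L' : lieAlgType) (V : lmodType rat) (p : freeLie V -> L) (F : L -> L')
  n (v : 'I_n -> V) i j s : lie_hom F -> F (lieB p v i j s) = lieB (F \o p) v i j s.
Proof.
move=> [FL Fl]; rewrite /lieB -Fl; move: (lie (p _) (p _)).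
by elim: s => [//|l s IH] a; rewrite /lfold /= -!/(lfold _ _ s) IH Fl.
Qed.

Section HolonomyIndep.
Variables (G : groupType) (n : nat) (R : comAlgType rat) (X w : 'I_n -> R).
Variables (xs : 'I_n -> coH1 G) (v : 'I_n -> H_1 G).
Hypothesis xv : forall i j, kron1 (xs i) (v j) = (i == j)%:R.
Hypothesis rel_w : forall c t, mu_dual c t -> lineq w
  (fun q => \sum_i (wedge_lift (kron_det (xs i) (xs q)) t : rat) *: X i).

Lemma holonomy_indep_lineq m (bad : pred 'I_n) (c : chen_index m bad -> rat) :
  \sum_p c p *: basic_val (lieB (@hpi G) v) p = 0 ->
  lineq w (\sum_p c p *: basic_val (kvec X) p).
Proof.
have kL := kmap_linear X xs; pose I : set (koszul_lie n R) := [set (0, w)].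
have [||F Fh FE] := @holonomy_lift G _ I (kmap X xs) kL.
- exact: koszul_metab.
- move=> c0 t ct; rewrite kmap_wedge; have [r rE] := rel_w ct.
  have -> : ((0, fun q => \sum_i (wedge_lift (kron_det (xs i) (xs q)) t : rat) *: X i)
      : koszul_lie n R) = lie ((r, 0) : koszul_lie n R) ((0, w) : koszul_lie n R).
    rewrite koszul_bracketE; congr (_, _); rewrite rE; apply/funext => q.
    have E (a d : R) : a = a - 0 * d by rewrite mul0r subr0.
    exact: E.
  by apply/lideal_lie/lideal_in.
have pH := lie_pi_hom I.
move=> cE; have := congr1 F cE.
rewrite (linear_fun_sum _ _ _ Fh.1) (linear_fun0 Fh.1).
have fH := freeLie_lift_hom kL.
have E p : F (c p *: basic_val (lieB (@hpi G) v) p) =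
    lie_pi I (c p *: ((0, basic_val (kvec X) p) : koszul_lie n R)).
  rewrite (linear_funZ Fh.1) (linear_funZ pH.1) /basic_val (lieB_hom _ _ _ _ _ Fh).
  rewrite -(@kmap_lieB _ _ _ X xs v xv _ _ _ _ fH (freeLie_lift_gen kL)).
  rewrite (lieB_hom _ _ _ _ _ pH); suff -> : F \o @hpi G = lie_pi I \o freeLie_lift (kmap X xs) by [].
  by apply/funext => x; rewrite /= FE.
under eq_bigr => p _ do rewrite E.
rewrite -(linear_fun_sum _ _ _ pH.1) => /lie_pi_eq0 /koszul_lideal [_].
congr (lineq w _); elim/big_rec2: _ => [//|p x y _ <-]; by [].
Qed.
End HolonomyIndep.

Section SeifertHolonomySpan.
Variables (g s : nat) (b : int) (alpha beta : 'I_s -> int).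
Hypothesis alpha_ge2 : forall i, 2 <= alpha i.
Local Notation G := (seifert_group g b alpha beta).
Local Notation e := (euler_number b alpha beta).
Local Notation V := ('I_(g + g) -> rat^o).
Local Notation x_ := (@seif_x g s b alpha beta).
Local Notation h_ := (seif_h g b alpha beta).
Local Notation v_ := (fun i => h1 (x_ i)).

Lemma hpi_surj (y : holonomy_metab G) : exists x, y = hpi x.
Proof.
have [u ->] := lie_pi_surj y; have [x ->] := lie_pi_surj u.
by exists x.
Qed.

Lemma hpi_central (y : G) : (forall x, commute x y) ->
  forall z : holonomy_metab G, lie z (hpi (lgen (h1 y))) = 0.
Proof.
move=> yC z; have [x ->] := hpi_surj z; have pH := @hpi_hom G.
rewrite -[x]flpiK; elim: (repr x) => [v||t IH|t IHt u IHu|k t IH|t IHt u IHu].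
- rewrite -[flpi _]/(lgen v); elim: (h1_span v) => [_ [a _ <-]||u w _ Eu _ Ew|k u _ Eu].
  + have [c ct] := mu_dual_commute (yC a).
    by rewrite -pH.2 -wedge_lie_wedge (hpi_rel ct).
  + by rewrite (linear_fun0 (@lgen_linear _)) (linear_fun0 pH.1) lie0l.
  + by rewrite (linear_funD (@lgen_linear _)) (linear_funD pH.1) lieDl Eu Ew addr0.
  + by rewrite (linear_funZ (@lgen_linear _)) (linear_funZ pH.1) lieZl Eu scaler0.
- by rewrite (linear_fun0 pH.1) lie0l.
- by rewrite -fl_oppE [hpi _](linear_funN pH.1) lieNl IH oppr0.
- by rewrite -flpiD (linear_funD pH.1) lieDl IHt IHu addr0.
- by rewrite -flpiZ (linear_funZ pH.1) lieZl IH scaler0.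
- rewrite -fl_lieE [hpi _]pH.2.
  have := jacobi (hpi (flpi t)) (hpi (flpi u)) (hpi (lgen (h1 y))).
  rewrite IHu lie0r add0r [lie (hpi (lgen _)) (hpi (flpi t))]lieC IHt oppr0 lie0r add0r.
  by move=> J; rewrite lieC J oppr0.
Qed.

Lemma holonomy_seifert_span_neq0 m x : e != 0 -> lie_deg m.+2 x ->
  lspan (range (@basic_val _ m pred0 _ (lieB (@hpi G) v_))) (hpi x).
Proof.
move=> e0; apply: (lie_deg_span_basic (@hpi_metab G) (Vc := set0) (@hpi_hom G)) => // w.
apply: lspan_ind (@seifert_h1_gen g s b alpha beta alpha_ge2 w) => _ [[i _ <-]|->].
  by apply: span_in; left; exists i.
by rewrite (@seifert_h1_h g s b alpha beta alpha_ge2 e0); apply: span_0.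
Qed.

Lemma holonomy_seifert_span_eq0 m x : e = 0 -> lie_deg m.+2 x ->
  lspan (range (@basic_val _ m (@sbad g) _ (lieB (@hpi G) v_))) (hpi x).
Proof.
move=> e0 dx; have hC z y : [set h1 h_] z -> lie y (hpi (lgen z)) = 0.
  move=> ->; apply: hpi_central => a; apply: commute_sym.
  exact: (sr_central (seifert_group_rel g b alpha beta)).
have Hspan w : lspan (range v_ `|` [set h1 h_]) w.
  by apply: (@seifert_h1_gen g s b alpha beta alpha_ge2).
have := lie_deg_comp (@hpi_metab G) (@hpi_hom G) Hspan hC dx.
apply: lspan_ind => _ [i [j [t [tm ->]]]].
apply: (span_basic_surface (B := lieB (@hpi G) v_)) => //.
- by move=> *; apply: lieB_alt.
- by move=> *; apply: (lieB_perm (@hpi_metab G)).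
- by move=> *; apply: lieB_jacobi.
move=> u _; rewrite /lieB -(linear_fun_sum _ _ _ (lfold_linear _ _ u)).
have [c ct] := @seifert_mu_dual g s b alpha beta alpha_ge2 e0; have := hpi_rel ct.
rewrite (linear_fun_sum _ _ _ (@wedge_lie_linear _)) (linear_fun_sum _ _ _ (@hpi_hom G).1).
under eq_bigr => a _ do rewrite wedge_lie_wedge (@hpi_hom G).2.
by move=> ->; apply: (linear_fun0 (lfold_linear _ _ u)).
Qed.
End SeifertHolonomySpan.

Lemma holonomy_chen_rank_basis (G : groupType) n (v : 'I_n -> H_1 G) m (bad : pred 'I_n) :
  (forall x, lie_deg m.+2 x ->
    lspan (range (@basic_val _ m bad _ (lieB (@hpi G) v))) (hpi x)) ->
  indep (@basic_val _ m bad _ (lieB (@hpi G) v)) ->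
  holonomy_chen_rank G m.+2 = Some #|chen_index m bad|.
Proof.
move=> S I; apply: dimQ_lsub I => [_ [x dx <-]|p]; first exact: S.
have [x dx E] := lieB_deg v (@hpi_hom G) (sval p).1 (thead (sval p).2) (behead (sval p).2).
by apply: span_in; exists x; [rewrite size_behead size_tuple in dx | rewrite /basic_val E].
Qed.

Lemma holonomy_chen_rank1 (G : groupType) (J : finType) (v : J -> H_1 G) :
  (forall w, lspan (range v) w) -> indep v -> holonomy_chen_rank G 1 = Some #|J|.
Proof.
move=> S I; have [L _] := @hpi_hom G.
apply: (dimQ_lsub _ _ (holonomy_deg1_indep I)) => [_ [x dx <-]|j].
  have C k y : lie_deg k y -> k = 1%N -> lspan (range (fun j => @hpi G (lgen (v j)))) (hpi y).
    move=> dy; elim: {k y} dy => [w|k|k y z _ Cy _ Cz|k a y _ Cy|i j y z dy Cy dz Cz] k1.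
    - apply: (lspan_linear (f := fun w => @hpi G (lgen w))) (S w) => [a u u'|_ [j _ <-]].
        by rewrite lgen_linear L.
      by apply: span_in; exists j.
    - by rewrite (linear_fun0 L); apply: span_0.
    - by rewrite (linear_funD L); apply: span_D; auto.
    - by rewrite (linear_funZ L); apply: span_Z; auto.
    have D0 k' (t : freeLie (H_1 G)) : lie_deg k' t -> k' = 0%N -> t = 0.
      elim=> {k' t} [w|//|k u u' _ Eu _ Eu'|k a u _ Eu|k l u u' _ Eu _ Eu'] k0 //.
      + by rewrite Eu // Eu' // addr0.
      + by rewrite Eu // scaler0.
      + by rewrite Eu ?lie0l //; lia.
    have [i0|i1] := posnP i.
      by rewrite (D0 _ _ dy i0) lie0l (linear_fun0 L); apply: span_0.
    by rewrite (D0 _ _ dz) ?lie0r ?(linear_fun0 L); [apply: span_0 | lia].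
  exact: (C _ _ dx).
by apply: span_in; exists (lgen (v j)) => //; apply: deg_gen.
Qed.

Lemma sum_omega_unitM g (R : comAlgType rat) (X : 'I_(g + g) -> R) q :
  \sum_i omega_pairing (unitM i q) *: X i = komega X q.
Proof.
rewrite komegaE.
under eq_bigr => i _ do rewrite /omega_pairing scaler_suml.
rewrite exchange_big; apply: eq_bigr => a _ /=.
under eq_bigr => i _ do rewrite scalerBl.
rewrite sumrB; congr (_ - _).
  rewrite (bigD1 (sx a)) //= big1 ?addr0 => [|i /negbTE ia].
    by rewrite /unitM eqxx [q == _]eq_sym; case: eqP => _; rewrite ?scale1r ?scale0r.
  by rewrite /unitM eq_sym ia scale0r.
rewrite (bigD1 (sy a)) //= big1 ?addr0 => [|i /negbTE ia].
  by rewrite /unitM eqxx [q == _]eq_sym; case: eqP => _; rewrite ?scale1r ?scale0r.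
by rewrite /unitM eq_sym ia scale0r.
Qed.

Lemma mu_dual_pairing (G : groupType) (f u : coH1 G) c t : mu_dual c t ->
  wedge_lift (kron_det f u) t = cup_pairing f u (val (repr c)).
Proof.
by move=> ct; rewrite -kron_wedge_wedge ct mu_wedge -{1}[c]lpiK kron2_cup.
Qed.

Lemma h1_sum_eq0 (G : groupType) (J : finType) (w : J -> G) (c : J -> rat) :
  \sum_j c j *: h1 (w j) = 0 :> H_1 G ->
  forall f : G -> rat^o, (forall x y, f (x * y)%g = f x + f y) ->
  \sum_j c j * f (w j) = 0.
Proof.
move=> E f fM; have L := kron1_linearr (coh fM).
have := congr1 (kron1 (coh fM)) E; rewrite (linear_fun0 L) (linear_fun_sum _ _ _ L).
by under eq_bigr => j _ do rewrite (linear_funZ L) kron1E.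
Qed.

Section SeifertHolonomyRanks.
Variables (g s : nat) (b : int) (alpha beta : 'I_s -> int).
Hypothesis alpha_ge2 : forall i, 2 <= alpha i.
Local Notation G := (seifert_group g b alpha beta).
Local Notation e := (euler_number b alpha beta).
Local Notation x_ := (@seif_x g s b alpha beta).
Local Notation h_ := (seif_h g b alpha beta).
Local Notation v_ := (fun i => h1 (x_ i)).

Lemma holonomy_chen_rank_neq0 m : e != 0 ->
  holonomy_chen_rank G m.+2 = Some #|chen_index m (@pred0 'I_(g + g))|.
Proof.
move=> e0; apply: (holonomy_chen_rank_basis (v := v_)) => [x|].
  exact: (holonomy_seifert_span_neq0 alpha_ge2 e0).
have [Xi [XiM Xix Xih Xiphi]] := @seifert_xi g s b _ beta alpha_ge2.
have P := mpoly_ring (g + g); pose X := @pr_X _ P.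
move=> c /(@holonomy_indep_lineq G _ _ X 0 (xi XiM) v_) H.
apply: (@kvec_indep _ _ _ P c).
have [||r ->] := H; last by apply/funext => q; rewrite mulr0.
- by move=> i j; rewrite kron1E /= Xix.
- move=> d t dt; exists 0; apply/funext => q; rewrite mul0r big1 // => i _.
  rewrite (mu_dual_pairing _ _ dt) (xi_pairing_neq0 _ Xiphi) ?scale0r //.
  exact: cycles2P.
Qed.

Lemma holonomy_chen_rank_eq0 m : e = 0 ->
  holonomy_chen_rank G m.+2 = Some #|chen_index m (@sbad g)|.
Proof.
move=> e0; apply: (holonomy_chen_rank_basis (v := v_)) => [x|].
  exact: (holonomy_seifert_span_eq0 alpha_ge2 e0).
have [Xi [XiM Xix Xih Xiphi]] := @seifert_xi g s b _ beta alpha_ge2.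
have P := mpoly_ring (g + g); pose X := @pr_X _ P.
move=> c /(@holonomy_indep_lineq G _ _ X (komega X) (xi XiM) v_) H.
have [||r rE] := H; last exact: (@kvec_indep_surface _ P _ c r rE).
- by move=> i j; rewrite kron1E /= Xix.
- move=> d t dt; have dz := cycles2P (repr d).
  have [g0|g0] := posnP g.
    by exists 0; apply/funext => q; have := ltn_ord q; lia.
  pose lam : rat := cup_pairing (xi XiM (sx (Ordinal g0))) (xi XiM (sy (Ordinal g0))) (val (repr d)).
  exists (lam%:A); apply/funext => q; rewrite -sum_omega_unitM -scalerAl mul1r scaler_sumr.
  apply: eq_bigr => i _; rewrite (mu_dual_pairing _ _ dt).
  rewrite (xi_pairing_eq0 _ Xiphi _ _ (Ordinal g0) e0 dz) scalerA; congr (_ *: _).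
  exact: mulrC.
Qed.

Lemma holonomy_chen_rank1_neq0 : e != 0 -> holonomy_chen_rank G 1 = Some (g + g)%N.
Proof.
move=> e0; have -> : Some (g + g)%N = Some #|'I_(g + g)| by rewrite card_ord.
apply: (holonomy_chen_rank1 (v := v_)) => [w|c cE].
  apply: lspan_ind (@seifert_h1_gen g s b alpha beta alpha_ge2 w) => _ [[i _ <-]|->].
    by apply: span_in; exists i.
  by rewrite (@seifert_h1_h g s b alpha beta alpha_ge2 e0); apply: span_0.
have [Xi [XiM Xix _ _]] := @seifert_xi g s b _ beta alpha_ge2.
move=> i; have := h1_sum_eq0 cE (f := fun x => Xi x i).
rewrite (bigD1 i) //= big1 => [|j /negbTE ji]; rewrite ?Xix /unitv ?eqxx ?mulr1 ?addr0.
  by apply=> x y; rewrite XiM.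
by rewrite eq_sym ji mulr0.
Qed.

Lemma holonomy_chen_rank1_eq0 : e = 0 -> holonomy_chen_rank G 1 = Some (g + g).+1.
Proof.
move=> e0; have -> : Some (g + g).+1 = Some #|{: option 'I_(g + g)}| by rewrite card_option card_ord.
pose w (o : option 'I_(g + g)) : G := if o is Some i then x_ i else h_.
apply: (holonomy_chen_rank1 (v := fun o => h1 (w o))) => [u|c cE].
  apply: lspan_ind (@seifert_h1_gen g s b alpha beta alpha_ge2 u) => _ [[i _ <-]|->]; apply: span_in.
    by exists (Some i).
  by exists None.
have [Xi [XiM Xix Xih Xiphi]] := @seifert_xi g s b _ beta alpha_ge2.
have [|phi [phiM phix phih]] := Xiphi (fun _ _ => 0) 1.
  by rewrite e0 mul0r oppr0 /omega_pairing big1 // => a _; rewrite subrr.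
case=> [i|].
  have := h1_sum_eq0 cE (f := fun x => Xi x i).
  rewrite sum_option /= Xih mulr0 add0r (bigD1 i) //= big1 => [|j /negbTE ji].
    by rewrite Xix /unitv eqxx mulr1 addr0; apply=> x y; rewrite XiM.
  by rewrite Xix /unitv eq_sym ji mulr0.
have := h1_sum_eq0 cE (f := phi).
rewrite sum_option /= phih mulr1 big1 ?addr0 => [|i _]; last by rewrite phix mulr0.
apply=> x y; rewrite phiM /bform big1 ?addr0 // => i _; rewrite big1 // => j _; exact: mul0r.
Qed.
End SeifertHolonomyRanks.

Theorem proposition9p4 (g s : nat) (b : int) (alpha beta : 'I_s -> int)
    (alpha_ge2 : forall i, 2 <= alpha i)
    (alpha_beta_coprime : forall i, coprimez (alpha i) (beta i)) :
  [/\ euler_number b alpha beta = 0 ->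
        [/\ chen_rank (seifert_group g b alpha beta) 1 = Some (2 * g + 1)%N,
            holonomy_chen_rank (seifert_group g b alpha beta) 1
              = Some (2 * g + 1)%N
          & forall k : nat, (2 <= k)%N ->
              chen_rank (seifert_group g b alpha beta) k
                = chen_rank (surface_group g) k /\
              holonomy_chen_rank (seifert_group g b alpha beta) k
                = chen_rank (surface_group g) k],
      euler_number b alpha beta != 0 ->
        forall k : nat, (1 <= k)%N ->
          holonomy_chen_rank (seifert_group g b alpha beta) k
            = chen_rank (free_group (2 * g)) k,
      euler_number b alpha beta != 0 ->
        [/\ chen_rank (seifert_group g b alpha beta) 1 = Some (2 * g)%N,
            omap Posz (chen_rank (seifert_group g b alpha beta) 2)
              = Some (g%:Z * (2 * g%:Z - 1))
          & forall k : nat, (3 <= k)%N ->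
              chen_rank (seifert_group g b alpha beta) k
                = chen_rank (surface_group g) k],
      forall k : nat, (2 <= k)%N ->
        chen_rank (free_group (2 * g)) k
          = Some ((k - 1) * 'C(2 * g + k - 2, k))%N
    & [/\ chen_rank (surface_group g) 1 = Some (2 * g)%N,
          (0 < g)%N ->
            omap Posz (chen_rank (surface_group g) 2)
              = Some (2 * g%:Z ^+ 2 - g%:Z - 1)
        & forall k : nat, (3 <= k)%N ->
            omap Posz (chen_rank (surface_group g) k)
              = Some (((k - 1) * 'C(2 * g + k - 2, k))%N%:Z
                      - 'C(2 * g + k - 3, k - 2)%:Z)]].
Proof.
have g2 : (2 * g = g + g)%N by rewrite mul2n addnn.
have bin2g : ('C(g + g, 2))%:Z = g%:Z * (2 * g%:Z - 1).
  have := mul_bin_left (g + g) 1; rewrite bin1 => E.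
  case: g E {g2} => [|n] E; first by rewrite mul0r.
  by move: E; move: 'C(_, _) => u; nia.
rewrite g2; split.
- move=> e0; split.
  + by rewrite chen_rank_seifert1_eq0 // addn1.
  + by rewrite holonomy_chen_rank1_eq0 // addn1.
  + case=> [//|[//|k]] _; rewrite chen_rank_surface chen_rank_seifert //; last by left.
    by rewrite holonomy_chen_rank_eq0.
- move=> e0 [//|[|k]] _; first by rewrite holonomy_chen_rank1_neq0 // chen_rank_free1.
  by rewrite holonomy_chen_rank_neq0 // card_chen_index chen_rank_free.
- move=> e0; split.
  + exact: chen_rank_seifert1_neq0.
  + by rewrite chen_rank_seifert2_neq0 //= bin2g.
  + case=> [//|[//|[//|k]]] _; rewrite chen_rank_surface chen_rank_seifert //.
    by right.
- case=> [//|[//|k]] _; rewrite chen_rank_free.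
  by congr (Some (_ * 'C(_, _))%N); lia.
- split; first exact: chen_rank_surface1.
  + move=> g0; rewrite chen_rank_surface /=; have := card_surface_index 0 g0.
    rewrite bin0 mul1n addn0 => E; congr Some.
    have := congr1 Posz E; rewrite PoszD bin2g => {}E.
    by move: E; move: (#|_|) => u; lia.
  + case=> [//|[//|[//|k]]] _; rewrite chen_rank_surface /=; congr Some.
    have [g0|g0] := posnP g.
      rewrite !bin_small //; try lia.
      have -> : #|chen_index k.+1 (@sbad g)| = 0%N; last by rewrite muln0.
      apply: eq_card0 => p; have := ltn_ord (sval p).1; lia.
    have := card_surface_index k.+1 g0.
    have -> : (g + g + k.+3 - 2 = g + g + k.+1)%N by lia.
    have -> : (g + g + k.+3 - 3 = g + g + k.+1 - 1)%N by lia.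
    have -> : (k.+3 - 1 = k.+2)%N by lia.
    have -> : (k.+3 - 2 = k.+1)%N by lia.
    by move: (#|_|) 'C(_, _) 'C(_, _) => u v w; lia.
Qed.
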